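(* Let $(\mathbb{L}_n(k))_{k\in\mathbb{Z}}$ be the external profile of a binary search tree with $n+1$ external nodes. For every $r\in\mathbb{N}_0$ and every compact set $L\subset(2e^{\beta_-},2e^{\beta_+})$, almost surely, as $n\to\infty$, $$ (\log n)^{r+1}\sup_{k\in\mathbb{Z}\cap(\log n)L}\left|n\left(\frac{k}{2e\log n}\right)^k\mathbb{L}_n(k)-\frac1{\sqrt{2\pi k}}\sum_{j=0}^r\frac{F_{2j}(0;\beta_n(k))}{(\log n)^j}\right|\longrightarrow0, $$ where $\beta_n(k)$ is the solution of $2e^{\beta_n(k)}=k/\log n$, and $F_{2j}(0;\beta):=W_\infty(\beta)G_{2j}(0;\beta)$ is a linear combination of $1,W_\infty(\beta),\ldots,W_\infty^{(2j)}(\beta)$. Here $G_j(x;\beta)$ is the polynomial in $x$ given explicitly by $$ G_j(x;\beta)=\frac{(-1)^j}{j!}\,e^{\frac12x^2}B_j(D_1,\ldots,D_j)e^{-\frac12x^2},\quad D_j=\frac{2e^\beta}{(j+1)(j+2)}\left(\frac{1}{\sqrt{2e^\beta}}\frac{d}{dx}\right)^{j+2}+\chi_j(\beta)\left(\frac1{\sqrt{2e^\beta}}\frac{d}{dx}\right)^{j}. $$ For example, $$ F_0(0;\beta)=W_\infty(\beta),\qquad F_2(0;\beta)=\frac14\big(W_\infty'(\beta)-W_\infty''(\beta)\big)-\frac1{24}. $$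
   Context: Binary search tree (BST) process: at time $n=0$ there is one external node, the root, at depth $0$. At each step one of the existing external nodes is picked uniformly at random, declared internal, and connected to two new external nodes, each of depth one larger than that of the picked node. After $n$ steps the tree has $n$ internal and $n+1$ external nodes; the trees for all $n$ are defined on one probability space through this evolution. The depth of a node is its distance to the root. $\mathbb{L}_n(k)$ is the number of external nodes at depth $k$ after $n$ steps ($\mathbb{L}_n(k)=0$ for $k<0$); the function $k\mapsto\mathbb{L}_n(k)$ is called the external profile. $x_{1,n},\dots,x_{n+1,n}$ are the depths of the external nodes. Let $\beta_-\approx-1.678$ and $\beta_+\approx0.768$ be the solutions of $2e^\beta(1-\beta)=1$, and let $W_n(\beta)=n^{-(2e^\beta-1)}\sum_{i=1}^{n+1}e^{\beta x_{i,n}}$, $\beta\in\mathbb{C}$. There are an open set $\mathscr{D}\subset\mathbb{C}$ containing $(\beta_-,\beta_+)$ and a random analytic function $W_\infty$ on $\mathscr{D}$ such that, almost surely, $W_n\to W_\infty$ uniformly on compact subsets of $\mathscr{D}$; one has $W_\infty(0)=1$, and almost surely $W_\infty$ has no zeros on $(\beta_-,\beta_+)$. Put $\chi_j(\beta)=(\log W_\infty)^{(j)}(\beta)$ for $j\in\mathbb{N}$, $\beta\in(\beta_-,\beta_+)$. The complete Bell polynomials $B_j(z_1,\dots,z_j)$ are defined by the formal identity $\exp\{\sum_{j\ge1}\frac{x^j}{j!}z_j\}=\sum_{j\ge0}\frac{x^j}{j!}B_j(z_1,\dots,z_j)$ (so $B_0=1$); they are applied to the commuting differential operators $D_1,D_2,\dots$.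 $\mathbb{N}_0=\{0,1,2,\dots\}$ and $(\log n)L=\{y\log n: y\in L\}$.
   Formalization: The printed example for F_2(0;β) holds at β=0 but fails in general (e.g. at β=-log 2); the theorem proves F_2(0;β)=e^{-β}((W_∞'(β)-W_∞''(β))/4-W_∞(β)/24) for all β in (β_-,β_+), and the printed formula at β=0. *)

(* Defs.v *)
From HB Require Import structures.
From mathcomp Require Import all_boot all_order all_algebra.
From mathcomp Require Import all_classical all_reals all_analysis.
From mathcomp Require Import complex.
Set Implicit Arguments.
Unset Strict Implicit.
Unset Printing Implicit Defensive.
Import Order.TTheory GRing.Theory Num.Theory.
Import numFieldNormedType.Exports.
Local Open Scope classical_set_scope.
Local Open Scope ring_scope.
Local Open Scope complex_scope.

(** * Binary search tree process *)

(* Nodes of the infinite binary tree are addressed by words over [bool]; the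
   root is the empty word and [size v] is the depth of [v].  [v m] is the
   external node picked at step [m] (steps are numbered from 0), and
   [external v n] lists the external nodes after [n] steps. *)
Fixpoint external (v : nat -> seq bool) (n : nat) : seq (seq bool) :=
  if n is m.+1 then
    [:: rcons (v m) false, rcons (v m) true & rem (v m) (external v m)]
  else [:: [::]].

(* Given the past picks, the pick at step [n] is uniform on the [n.+1] external
   nodes present at that time; this determines the law of the whole process. *)
Definition is_bst_process (d : measure_display) (T : measurableType d)
    (R : realType) (P : probability T R) (V : nat -> T -> seq bool) : Prop :=
  (forall n v, measurable [set w | V n w = v]) /\
  (forall n (v : nat -> seq bool),
    P [set w | forall i, (i <= n)%N -> V i w = v i] =
    (P [set w | forall i, (i < n)%N -> V i w = v i] *
      (if v n \in external v n then n.+1%:R^-1 else 0)%:E)%E).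

Definition ext_profile (v : nat -> seq bool) (n : nat) (k : int) : nat :=
  count (fun x => (size x)%:Z == k) (external v n).

(** * The Biggins martingale and its limit *)

Definition cexp (R : realType) (z : R[i]) : R[i] :=
  (expR (complex.Re z))%:C * (cos (complex.Im z) +i* sin (complex.Im z)).

Definition Wn (R : realType) (v : nat -> seq bool) (n : nat) (z : R[i]) : R[i] :=
  cexp (- (2 * cexp z - 1) * (ln (n%:R : R))%:C) *
  \sum_(x <- external v n) cexp (z * (size x)%:R).

(* The type [(R[i])^o] carries the topology of the complex plane, and
   [derivable f z 1] over it is complex differentiability at [z]. *)
Definition random_analytic_function (d : measure_display) (T : measurableType d)
    (R : realType) (D : set (R[i])^o) (W : T -> (R[i])^o -> (R[i])^o) : Prop :=
  (forall z, D z ->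
    measurable_fun setT (fun w => complex.Re (W w z)) /\
    measurable_fun setT (fun w => complex.Im (W w z))) /\
  (forall w z, D z -> derivable (W w) z 1).

(* Almost surely W_infinity is real on (beta_-, beta_+), being there a limit of
   real numbers, so that taking the real part loses nothing. *)
Definition on_reals (R : realType) (W : (R[i])^o -> (R[i])^o) (b : R) : R :=
  complex.Re (W b%:C).

(** * Complete Bell polynomials *)

(* [bell z j] is [j`!] times the coefficient of x^j in
   exp (\sum_(i >= 1) x^i / i! * z i).  The inner series starts at x^1, so its
   terms with i > j, and the terms m > j of the exponential series, do not
   contribute to x^j. *)
Definition bell (R : fieldType) (A : comAlgType R) (z : nat -> A) (j : nat) : A :=
  (j`!%:R : R) *:
  (\sum_(m < j.+1)
     ((m`!%:R^-1 : R)%:A)%:P *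
     (\sum_(1 <= i < j.+1) ((i`!%:R^-1 : R) *: z i)%:P * 'X^i) ^+ m)`_j.

(** * The Edgeworth coefficients *)

(* A polynomial in ['X] stands for the differential operator with constant
   coefficients obtained by reading ['X] as d/dx. *)
Definition diffop (R : realType) (p : {poly R}) (f : R -> R) (x : R) : R :=
  \sum_(i < size p) p`_i * derive1n i f x.

Section Edgeworth.
Variables (R : realType) (W : R -> R).

Definition chi (j : nat) (b : R) : R := derive1n j (fun t => ln (W t)) b.

Definition Dop (b : R) (j : nat) : {poly R} :=
  let s := 2 * expR b in
  (s / (j.+1 * j.+2)%:R) *: ((Num.sqrt s)^-1 *: 'X) ^+ j.+2 +
  chi j b *: ((Num.sqrt s)^-1 *: 'X) ^+ j.

Definition G (j : nat) (x b : R) : R :=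
  (-1) ^+ j / j`!%:R * expR (x ^+ 2 / 2) *
  diffop (bell (Dop b) j) (fun y => expR (- (y ^+ 2 / 2))) x.

Definition F (j : nat) (x b : R) : R := W b * G j x b.

End Edgeworth.

(** * The saddle point *)

Definition beta_n (R : realType) (n : nat) (k : int) : R :=
  ln (k%:~R / (2 * ln n%:R)).

Lemma beta_nP (R : realType) (n : nat) (k : int) (b : R) :
  0 < k%:~R / ln (n%:R : R) ->
  2 * expR b = k%:~R / ln n%:R <-> b = beta_n R n k.
Proof.
rewrite /beta_n; have -> : k%:~R / (2 * ln (n%:R : R)) = 2^-1 * (k%:~R / ln n%:R).
  by rewrite invfM mulrCA.
move=> kn0; split=> [<-|->]; first by rewrite mulKf ?pnatr_eq0// expRK.
have kn1 : 0 < 2^-1 * (k%:~R / ln (n%:R : R)) by rewrite mulr_gt0// invr_gt0.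
by rewrite lnK ?posrE// mulVKf// pnatr_eq0.
Qed.

Definition normalized_error (R : realType) (v : nat -> seq bool) (W : R -> R)
    (r n : nat) (k : int) : R :=
  `| n%:R * (k%:~R / (2 * expR 1 * ln n%:R)) ^ k * (ext_profile v n k)%:R
     - (Num.sqrt (2 * pi * k%:~R))^-1 *
       \sum_(j < r.+1) F W j.*2 0 (beta_n R n k) / ln n%:R ^+ j |.

(* Main.v *)
Require Import Defs.
From HB Require Import structures.
From mathcomp Require Import all_boot all_order all_algebra.
From mathcomp Require Import all_classical all_reals all_analysis.
From mathcomp Require Import complex ring lra zify.
Set Implicit Arguments.
Unset Strict Implicit.
Unset Printing Implicit Defensive.
Import Order.TTheory GRing.Theory Num.Theory.
Import numFieldNormedType.Exports.
Local Open Scope classical_set_scope.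
Local Open Scope ring_scope.
Local Open Scope complex_scope.

(**
The number of external nodes at depth k is a Fourier coefficient. Let [Sn] be the sum of
exp (z * depth) over the external nodes. For every real b, integrating
exp (- k (b + i u)) * Sn (b + i u) over u in [0, pi] and taking real parts keeps only the
nodes at depth k. The height b is chosen with 2 e^b log n = k. Since Sn (z) is
n^(2 e^z - 1) times W_n (z), the integrand then is an explicit factor times
exp (k (e^(i u) - 1 - i u)) * W_n (b + i u) ([saddle_phase]): a Gaussian peak of width
k^(-1/2) at u = 0, without linear term in the exponent. Replace W_n by its limit, expand
the limit and the rest of the exponent in powers of u, and integrate against the
Gaussian. This gives a series in k^(-1/2) whose odd terms vanish
([saddle_point_integral]).

Its coefficients are those of the theorem. The Bell polynomials of the sum that defines
[Dop] are a convolution of two families. The one in the chi generates the Taylor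
coefficients of W_infinity divided by its value, because the chi are logarithmic
derivatives; the other one generates the exponential of the part of e^z beyond its
quadratic terms, and derivatives of the Gaussian at 0 are Gaussian moments
([F_expansion], [edgeworth_sum]). The formula obtained this way also shows that F is
linear in the derivatives of W_infinity, and its first cases are computed in [F_low].

For an expansion to every order in 1 / log n one needs more than the convergence of W_n.
Near the real axis it must be faster than every power of log n, and on the rest of the
vertical segment [Sn] must be smaller than its value on the real axis by more than such a
power; both uniformly in b. In fact powers of n are gained ([profile_rates]). One step of
the process multiplies the conditional mean of [Sn] by 1 + alpha / (n + 1) with
alpha = 2 e^z - 1, and for p in (1, 2] the p-th mean of the fluctuation is bounded by
[rSn], the sum of the moduli, at p * Re z ([one_step_moment]). If 2 e^b (1 - b) > 1, that
is for b between the two roots, this noise grows more slowly than the p-th power of [Sn]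
as soon as p is close to 1 ([exists_moment_exponent]). Hence the p-th power of a suitable
deviation, plus a multiple of the noise, is after normalisation a non-negative
supermartingale ([moment_supermartingale]). The maximal inequality and the Borel-Cantelli
lemma are applied on grids of mesh 2^(-m), simultaneously at all grid points and all times
after Q^(m+1) near the axis ([inner_grid]), or after a fixed time away from it
([outer_grid]); Lipschitz bounds fill the gaps of the grids.

The probabilistic part only uses the law of finite histories: a conditional expectation is
an average over the external nodes ([step]), and the maximal inequality is proved by
induction on the horizon. On the analytic side, W_n is approximated by polynomials with
real coefficients uniformly on discs around real points, and so is its limit. Cauchy's
estimates for polynomials, obtained by averaging over roots of unity, then make the limit
a power series with real coefficients there ([approx_power_series], [limit_taylor]).
*)

Import Normc.
Local Notation Re := complex.Re.
Local Notation Im := complex.Im.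

Arguments normc {R} x : simpl never.
Arguments cexp {R} z : simpl never.

(** * Differentiation at a point *)
Section PointwiseDerivatives.
Variables (R : realType) (x : R).
Implicit Types (f g : R -> R) (a b c : R).
Lemma der_cst c : is_derive x 1 (fun=> c) 0. Proof. exact: is_derive_cst. Qed.
Lemma der_id : is_derive x 1 (fun t : R => t) 1. Proof. exact: is_derive_id. Qed.
Lemma der_add f g a b : is_derive x 1 f a -> is_derive x 1 g b ->
  is_derive x 1 (fun t => f t + g t) (a + b).
Proof. exact: is_deriveD. Qed.
Lemma der_opp f a : is_derive x 1 f a -> is_derive x 1 (fun t => - f t) (- a).
Proof. exact: is_deriveN. Qed.
Lemma der_mul f g a b : is_derive x 1 f a -> is_derive x 1 g b ->
  is_derive x 1 (fun t => f t * g t) (a * g x + f x * b).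
Proof.
move=> df dg; have /trigger_derive := is_deriveM df dg; apply.
by rewrite addrC [_ *: _]mulrC.
Qed.
Lemma der_expn f a n : is_derive x 1 f a ->
  is_derive x 1 (fun t => f t ^+ n) (n%:R * f x ^+ n.-1 * a).
Proof. move=> df; elim: n => [|n ih]; first by rewrite !mul0r; exact: der_cst.
under eq_fun do rewrite exprS; have /trigger_derive := der_mul df ih; apply.
by case: n {ih} => [|n]; rewrite /= ?mul0r ?mulr0 ?addr0 ?mul1r ?mulr1 ?expr0 // exprS; ring. Qed.
Lemma der_expR f a : is_derive x 1 f a ->
  is_derive x 1 (fun t => expR (f t)) (expR (f x) * a).
Proof. by move=> df; apply: is_derive1_comp. Qed.
Lemma der_cos f a : is_derive x 1 f a ->
  is_derive x 1 (fun t => cos (f t)) (- sin (f x) * a).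
Proof. by move=> df; apply: is_derive1_comp. Qed.
Lemma der_sin f a : is_derive x 1 f a ->
  is_derive x 1 (fun t => sin (f t)) (cos (f x) * a).
Proof. by move=> df; apply: is_derive1_comp. Qed.
Lemma der_ln f a : 0 < f x -> is_derive x 1 f a ->
  is_derive x 1 (fun t => ln (f t)) ((f x)^-1 * a).
Proof. by move=> fx df; apply: is_derive1_comp; apply: is_derive1_ln. Qed.
Lemma der_sum (I : Type) (s : seq I) (f : I -> R -> R) (a : I -> R) :
  (forall i, is_derive x 1 (f i) (a i)) ->
  is_derive x 1 (fun t => \sum_(i <- s) f i t) (\sum_(i <- s) a i).
Proof.
move=> df; elim: s => [|i s ih].
  by rewrite big_nil; under eq_fun do rewrite big_nil; exact: der_cst.
by rewrite big_cons; under eq_fun do rewrite big_cons; exact: der_add.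
Qed.
End PointwiseDerivatives.

(** Computes the derivative from the shape of the function and leaves as goal its
    equality with the announced value. *)
Ltac pointwise_derivative := eapply trigger_derive;
  [repeat first [exact: der_id | exact: der_cst | eassumption | eapply der_add | eapply der_opp
   | eapply der_mul | eapply der_expn | eapply der_expR | eapply der_cos | eapply der_sin
   | eapply der_sum => ?] | ].

(** * Complex modulus and exponential *)
Section ComplexModulus.
Variable R : realType.
Implicit Types (z w : R[i]) (x y : R).

Lemma ReD z w : Re (z + w) = Re z + Re w. Proof. by case: z w => [? ?] [? ?]. Qed.
Lemma ImD z w : Im (z + w) = Im z + Im w. Proof. by case: z w => [? ?] [? ?]. Qed.
Lemma ReN z : Re (- z) = - Re z. Proof. by case: z. Qed.
Lemma ImN z : Im (- z) = - Im z. Proof. by case: z. Qed.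
Lemma ReM z w : Re (z * w) = Re z * Re w - Im z * Im w.
Proof. by case: z w => [? ?] [? ?]. Qed.
Lemma ImM z w : Im (z * w) = Re z * Im w + Im z * Re w.
Proof. by case: z w => [? ?] [? ?]. Qed.
Lemma Re_sum (I : Type) (s : seq I) (Q : pred I) (f : I -> R[i]) :
  Re (\sum_(i <- s | Q i) f i) = \sum_(i <- s | Q i) Re (f i).
Proof. by apply: (big_morph (fun z : R[i] => Re z) (id1 := 0) ReD). Qed.
Lemma Im_sum (I : Type) (s : seq I) (Q : pred I) (f : I -> R[i]) :
  Im (\sum_(i <- s | Q i) f i) = \sum_(i <- s | Q i) Im (f i).
Proof. by apply: (big_morph (fun z : R[i] => Im z) (id1 := 0) ImD). Qed.
Lemma ReZ x z : Re (x%:C * z) = x * Re z.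
Proof. by rewrite ReM/= mul0r subr0. Qed.
Lemma ImZ x z : Im (x%:C * z) = x * Im z.
Proof. by rewrite ImM/= mul0r addr0. Qed.
Lemma complexP z w : Re z = Re w -> Im z = Im w -> z = w.
Proof. by case: z w => [? ?] [? ?] /= -> ->. Qed.

Lemma complex_eta z : Re z +i* Im z = z. Proof. by case: z. Qed.

Lemma ncE z : normc z = Num.sqrt (Re z ^+ 2 + Im z ^+ 2). Proof. by case: z. Qed.
Lemma nc_ge0 z : 0 <= normc z. Proof. by rewrite ncE sqrtr_ge0. Qed.
Lemma nc_sqr z : normc z ^+ 2 = Re z ^+ 2 + Im z ^+ 2.
Proof. by rewrite ncE sqr_sqrtr// addr_ge0// sqr_ge0. Qed.
Lemma nc_norm z : `|z| = (normc z)%:C. Proof. by case: z. Qed.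
Lemma nc_real x : normc x%:C = `|x|.
Proof. by rewrite ncE/= expr0n addr0 sqrtr_sqr. Qed.
Lemma nc_nat n : normc (n%:R : R[i]) = n%:R.
Proof. by rewrite -[n%:R](rmorph_nat (real_complex R)) nc_real normr_nat. Qed.
Lemma ncX z n : normc (z ^+ n) = normc z ^+ n.
Proof. by elim: n => [|n ih]; rewrite ?expr0 ?normc1// !exprS normcM ih. Qed.
Lemma ncZ x z : normc (x%:C * z) = `|x| * normc z.
Proof. by rewrite normcM nc_real. Qed.
Lemma ncB z w : normc (z - w) = normc (w - z).
Proof. by rewrite -normcN opprB. Qed.
Lemma ler_ncB z w : normc (z - w) <= normc z + normc w.
Proof. by rewrite (le_trans (le_normcD _ _))// normcN. Qed.
Lemma ler_nc_dist v z w : normc (z - w) <= normc (z - v) + normc (v - w).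
Proof. by have := le_normcD (z - v) (v - w); rewrite addrA subrK. Qed.
Lemma ler_nc_sub z w : normc z <= normc w + normc (z - w).
Proof. by have := le_normcD w (z - w); rewrite addrC subrK. Qed.
Lemma nc_sum (I : Type) (s : seq I) (Q : pred I) (f : I -> R[i]) :
  normc (\sum_(i <- s | Q i) f i) <= \sum_(i <- s | Q i) normc (f i).
Proof.
apply: (big_ind2 (fun a b => normc a <= b)) => //; first by rewrite normc0.
by move=> a b c d ab cd; rewrite (le_trans (le_normcD _ _))// lerD.
Qed.
Lemma Re_le_nc z : `|Re z| <= normc z.
Proof. by rewrite ncE -sqrtr_sqr ler_wsqrtr// lerDl sqr_ge0. Qed.
Lemma Im_le_nc z : `|Im z| <= normc z.
Proof. by rewrite ncE -sqrtr_sqr ler_wsqrtr// lerDr sqr_ge0. Qed.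
Lemma nc_le_ReIm z : normc z <= `|Re z| + `|Im z|.
Proof.
rewrite -[leRHS]ger0_norm ?addr_ge0// -sqrtr_sqr ncE ler_wsqrtr//.
rewrite sqrrD !real_normK ?num_real// lerD2r lerDl.
by rewrite mulrn_wge0// mulr_ge0.
Qed.
Lemma nc_prodXB m z w r : normc z <= r -> normc w <= r ->
  normc (z ^+ m - w ^+ m) <= m%:R * r ^+ m.-1 * normc (z - w).
Proof.
move=> zr wr; have r0 : 0 <= r by exact: le_trans (nc_ge0 _) zr.
rewrite subrXX normcM mulrC ler_wpM2r ?nc_ge0// (le_trans (nc_sum _ _ _))//.
rewrite (_ : _ * _ = \sum_(i < m) r ^+ m.-1); last first.
  by rewrite sumr_const card_ord mulr_natl.
apply: ler_sum => i _; rewrite normcM !ncX.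
apply: (@le_trans _ _ (r ^+ (m.-1 - i) * r ^+ i)).
  by rewrite ler_pM ?exprn_ge0 ?nc_ge0// ?lerXn2r ?nnegrE ?nc_ge0 // -subn1 -subnDA add1n subnS.
by rewrite -exprD subnK// -ltnS prednK// (leq_ltn_trans _ (ltn_ord i)).
Qed.

End ComplexModulus.

Section ComplexExp.
Variable R : realType.
Implicit Types (z w : R[i]) (x y : R).

Lemma Re_cexp z : Re (cexp z) = expR (Re z) * cos (Im z).
Proof. by rewrite /cexp ReZ. Qed.
Lemma Im_cexp z : Im (cexp z) = expR (Re z) * sin (Im z).
Proof. by rewrite /cexp ImZ. Qed.
Lemma nc_cexp z : normc (cexp z) = expR (Re z).
Proof.
rewrite /cexp ncZ ger0_norm ?expR_ge0// ncE/=.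
by rewrite cos2Dsin2 sqrtr1 mulr1.
Qed.
Lemma cexpD z w : cexp (z + w) = cexp z * cexp w.
Proof.
apply: complexP; first rewrite [RHS]ReM !Re_cexp !Im_cexp ReD ImD expRD cosD; last first.
  by rewrite [RHS]ImM !Re_cexp !Im_cexp ReD ImD expRD sinD; ring.
by ring.
Qed.
Lemma cexp_real x : cexp x%:C = (expR x)%:C.
Proof. by apply: complexP; rewrite ?Re_cexp ?Im_cexp/= ?cos0 ?sin0 ?mulr1 ?mulr0. Qed.
Lemma cexp0 : cexp (0 : R[i]) = 1.
Proof. by rewrite (_ : 0 = 0%:C)// cexp_real expR0. Qed.
Lemma cexp_neq0 z : cexp z != 0.
Proof. by apply/eqP => h; have := nc_cexp z; rewrite h normc0 => /esym/eqP; rewrite gt_eqF ?expR_gt0. Qed.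
Lemma cexpN z : cexp (- z) = (cexp z)^-1.
Proof.
apply: (mulIf (cexp_neq0 z)); rewrite mulVf ?cexp_neq0//.
by rewrite -cexpD addNr cexp0.
Qed.
(** The increment has a fixed direction, so projecting the curve on it turns
    the mean value inequality into the monotonicity of a real function. *)
Lemma nc_mean_value (f g h f' g' h' : R -> R) :
  (forall t : R, 0 <= t <= 1 -> is_derive t 1 f (f' t)) ->
  (forall t : R, 0 <= t <= 1 -> is_derive t 1 g (g' t)) ->
  (forall t : R, 0 <= t <= 1 -> is_derive t 1 h (h' t)) ->
  (forall t : R, 0 <= t <= 1 -> normc (f' t +i* g' t) <= h' t) ->
  normc ((f 1 - f 0) +i* (g 1 - g 0)) <= h 1 - h 0.
Proof.
move=> df dg dh fgh.
set v := _ +i* _; set a := Re v; set b := Im v.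
suff key (p q : R) : p ^+ 2 + q ^+ 2 <= 1 -> p * a + q * b <= h 1 - h 0.
  have [v0|v0] := eqVneq (normc v) 0.
    rewrite v0; apply: le_trans (key 0 0 _); first by rewrite !mul0r addr0.
    by rewrite expr0n addr0 ler01.
  have e : (a / normc v) ^+ 2 + (b / normc v) ^+ 2 = 1.
    by rewrite !expr_div_n -mulrDl -nc_sqr divff// expf_neq0.
  have := key (a / normc v) (b / normc v); rewrite e lexx => /(_ isT).
  by rewrite mulrAC [X in _ + X]mulrAC -mulrDl -!expr2 -nc_sqr expr2 mulfK.
move=> pq1; pose phi t := p * f t + q * g t - h t.
have dphi (t : R) : 0 <= t <= 1 -> is_derive t 1 phi (p * f' t + q * g' t - h' t).
  by move=> t01; have := df t t01; have := dg t t01; have := dh t t01 => *;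
    apply: is_deriveB; apply: is_deriveD; apply: is_deriveZ.
have [] := @MVT_segment _ phi (fun t => p * f' t + q * g' t - h' t) 0 1 ler01.
- by move=> t /[!in_itv]/= /andP[t0 t1]; apply: dphi; rewrite !ltW.
- apply/continuous_in_subspaceT => t; rewrite inE/= in_itv/= => t01.
  by apply: differentiable_continuous; apply/derivable1_diffP; have [] := dphi t t01.
move=> t; rewrite in_itv/= => t01; rewrite subr0 mulr1 => e.
have hle : p * f' t + q * g' t <= h' t.
  apply: le_trans (fgh t t01); apply: le_trans (ler_norm _) _.
  rewrite -sqrtr_sqr ncE/= ler_wsqrtr//.
  have := sqr_ge0 (p * g' t - q * f' t).
  have := mulr_ge0 (addr_ge0 (sqr_ge0 (f' t)) (sqr_ge0 (g' t))) (_ : 0 <= 1 - (p ^+ 2 + q ^+ 2)).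
  rewrite subr_ge0 => /(_ pq1); nra.
move: e; rewrite /phi /a /b /v/=; lra.
Qed.

Definition exp_trunc (n : nat) z : R[i] := \sum_(i < n) ((i`!%:R)^-1)%:C * z ^+ i.

Lemma Re_scaleX (t : R) z n : Re ((t%:C * z) ^+ n) = t ^+ n * Re (z ^+ n).
Proof. by rewrite exprMn -rmorphXn ReZ. Qed.
Lemma Im_scaleX (t : R) z n : Im ((t%:C * z) ^+ n) = t ^+ n * Im (z ^+ n).
Proof. by rewrite exprMn -rmorphXn ImZ. Qed.

(** Induction on [n]: on the segment from 0 to [z], the remainder of order [n.+1] has
    as derivative [z] times the remainder of order [n]. *)
Lemma cexp_taylor n z :
  normc (cexp z - exp_trunc n z) <= normc z ^+ n * expR (normc z) / n`!%:R.
Proof.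
elim: n z => [|n ih] z.
  rewrite /exp_trunc big_ord0 subr0 expr0 mul1r divr1 nc_cexp ler_expR.
  by rewrite (le_trans (ler_norm _))// Re_le_nc.
pose F t := cexp (t%:C * z) - exp_trunc n.+1 (t%:C * z).
pose F' t := z * (cexp (t%:C * z) - exp_trunc n (t%:C * z)).
pose h t := t ^+ n.+1 * (normc z ^+ n.+1 * expR (normc z) / n.+1`!%:R).
pose h' t := t ^+ n * (normc z ^+ n.+1 * expR (normc z) / n`!%:R).
have := @nc_mean_value (fun t => Re (F t)) (fun t => Im (F t)) h
  (fun t => Re (F' t)) (fun t => Im (F' t)) h'.
have dh (t : R) : 0 <= t <= 1 -> is_derive t 1 h (h' t).
  move=> _; rewrite /h /h'; pointwise_derivative.
  rewrite /= mulr0 addr0 mulr1 factS natrM.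
  have n1 : (n%:R + 1 : R) != 0 by rewrite natr1 pnatr_eq0.
  have nf : (n`!%:R : R) != 0 by rewrite pnatr_eq0 -lt0n fact_gt0.
  by rewrite -[n.+1%:R]natr1; field; rewrite n1 nf.
have fact_coef i (t c : R) : (i.+1`!%:R)^-1 * (i.+1%:R * t ^+ i * c) = (i`!%:R)^-1 * t ^+ i * c.
  have n1 : (i%:R + 1 : R) != 0 by rewrite natr1 pnatr_eq0.
  have nf : (i`!%:R : R) != 0 by rewrite pnatr_eq0 -lt0n fact_gt0.
  by rewrite factS natrM -[i.+1%:R]natr1; field; rewrite n1 nf.
have F'E t : F' t = z * cexp (t%:C * z) - \sum_(i < n) ((i`!%:R)^-1 * t ^+ i)%:C * (z * z ^+ i).
  rewrite /F' mulrBr mulr_sumr; congr (_ - _); apply: eq_bigr => i _.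
  by rewrite exprMn -rmorphXn/= rmorphM/=; ring.
have dRF (t : R) : 0 <= t <= 1 -> is_derive t 1 (fun t => Re (F t)) (Re (F' t)).
  move=> _.
  have -> : (fun t => Re (F t)) = fun t => expR (t * Re z) * cos (t * Im z) -
      \sum_(i < n.+1) (i`!%:R)^-1 * (t ^+ i * Re (z ^+ i)).
    apply/funext => u; rewrite /F ReD ReN Re_cexp ReZ ImZ; congr (_ - _).
    by rewrite Re_sum; apply: eq_bigr => i _; rewrite ReZ Re_scaleX.
  pointwise_derivative.
  rewrite /= big_ord_recl/= !(mul1r, mul0r, mulr0, addr0, add0r).
  rewrite F'E ReD ReN ReM Re_cexp Im_cexp ReZ ImZ Re_sum; congr (_ - _); first by ring.
  by apply: eq_bigr => i _; rewrite mul0r add0r mulr1 mulr0 addr0 ReZ exprS fact_coef.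
have dIF (t : R) : 0 <= t <= 1 -> is_derive t 1 (fun t => Im (F t)) (Im (F' t)).
  move=> _.
  have -> : (fun t => Im (F t)) = fun t => expR (t * Re z) * sin (t * Im z) -
      \sum_(i < n.+1) (i`!%:R)^-1 * (t ^+ i * Im (z ^+ i)).
    apply/funext => u; rewrite /F ImD ImN Im_cexp ReZ ImZ; congr (_ - _).
    by rewrite Im_sum; apply: eq_bigr => i _; rewrite ImZ Im_scaleX.
  pointwise_derivative.
  rewrite /= big_ord_recl/= !(mul1r, mul0r, mulr0, addr0, add0r).
  rewrite F'E ImD ImN ImM Re_cexp Im_cexp ReZ ImZ Im_sum; congr (_ - _); first by ring.
  by apply: eq_bigr => i _; rewrite mul0r add0r mulr1 mulr0 addr0 ImZ exprS fact_coef.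
have bd (t : R) : 0 <= t <= 1 -> normc (Re (F' t) +i* Im (F' t)) <= h' t.
  move=> /andP[t0 t1]; rewrite (_ : _ +i* _ = F' t); last by case: (F' t).
  rewrite /F' normcM /h'.
  have := ih (t%:C * z); rewrite ncZ ger0_norm// => ihz.
  apply: le_trans (ler_wpM2l (nc_ge0 _) ihz) _.
  rewrite exprMn exprS !mulrA [normc z * _]mulrC -!mulrA !ler_wpM2l ?exprn_ge0 ?nc_ge0//.
  by rewrite ler_wpM2r// ler_expR ler_piMl ?nc_ge0.
move/(_ dRF dIF dh bd).
have F1 : F 1 = cexp z - exp_trunc n.+1 z by rewrite /F mul1r.
have F0 : F 0 = 0.
  rewrite /F mul0r cexp0 /exp_trunc big_ord_recl expr0 invr1 mulr1 big1 ?addr0 ?subrr//.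
  by move=> i _; rewrite exprS mul0r mulr0.
rewrite F0 !subr0 F1 /h expr1n mul1r expr0n/= mul0r subr0.
by rewrite complex_eta.
Qed.

Lemma cexp_sub1_le z : normc (cexp z - 1) <= normc z * expR (normc z).
Proof.
have := cexp_taylor 1 z; rewrite /exp_trunc big_ord1 expr0 mulr1 invr1 expr1.
by rewrite mulr1.
Qed.

Lemma cexpB_le z w :
  normc (cexp z - cexp w) <= normc (z - w) * expR (normc (z - w)) * expR (Re w).
Proof.
rewrite -{1}(subrK w z) cexpD -{2}[cexp w]mul1r -mulrBl normcM nc_cexp.
by rewrite ler_wpM2r ?expR_ge0// cexp_sub1_le.
Qed.

Lemma exp_remainder_small (r e : R) : 0 < e ->
  exists n, r ^+ n * expR r / n`!%:R < e.
Proof.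
move=> e0; have := is_cvg_series_exp_coeff r => /cvg_series_cvg_0.
move=> /cvgrPdist_lt/(_ _ (divr_gt0 e0 (expR_gt0 r))) [N _ /(_ N (leqnn N))].
rewrite sub0r normrN /exp_coeff/= => h; exists N.
rewrite mulrAC -ltr_pdivlMr ?expR_gt0//.
by apply: le_lt_trans h; rewrite ler_norm.
Qed.
End ComplexExp.

(** * Cauchy estimates on polynomials *)
Section RootsOfUnity.
Variable R : realType.
Implicit Types (z : R[i]) (r B : R).

Lemma cos_lt1 (t : R) : 0 < t < 2 * pi -> cos t < 1.
Proof.
move=> /andP[t0 t2].
have s0 : 0 < sin (t / 2) by rewrite sin_gt0_pi// divr_gt0//= ltr_pdivrMr// mulrC.
have -> : cos t = 1 - 2 * sin (t / 2) ^+ 2.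
  rewrite {1}(_ : t = t / 2 + t / 2); last by field.
  by rewrite cosD -!expr2 cos2sin2; ring.
by rewrite ltrBlDr ltrDl mulr_gt0// exprn_gt0.
Qed.

Definition unity N l : R[i] := cexp (0 +i* (2 * pi * l%:R / N%:R)).

Lemma unityD N l m : unity N (l + m) = unity N l * unity N m.
Proof.
rewrite /unity -cexpD; congr cexp; apply: complexP; rewrite ?ReD ?ImD/= ?addr0//.
by rewrite natrD mulrDr mulrDl.
Qed.

Lemma unityM N l m : unity N (l * m) = unity N l ^+ m.
Proof.
elim: m => [|m ih]; last by rewrite mulnS unityD ih exprS.
by rewrite muln0 /unity mulr0 mul0r -[_ +i* _]/(0 : R[i]) cexp0.
Qed.

Lemma nc_unity N l : normc (unity N l) = 1.
Proof. by rewrite nc_cexp expR0. Qed.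

Lemma unityN N : (0 < N)%N -> unity N N = 1.
Proof.
move=> N0; apply: complexP; rewrite ?Re_cexp ?Im_cexp/= mulfK ?pnatr_eq0 -?lt0n//.
  by rewrite expR0 mul1r mulr_natl cos2pi.
by rewrite expR0 mul1r mulr_natl sin2pi.
Qed.

Lemma unity_eq1 N l : (0 < N)%N -> (unity N l == 1) = (N %| l)%N.
Proof.
move=> N0; apply/idP/idP => [|/dvdnP[q ->]]; last first.
  by rewrite mulnC unityM unityN// expr1n.
rewrite {1}(divn_eq l N) mulnC unityD unityM unityN// expr1n mul1r /dvdn.
apply: contraTT; rewrite -lt0n => r0; apply/eqP => h.
have := congr1 (@complex.Re _) h; rewrite Re_cexp/= expR0 mul1r; apply/eqP.
have N0' : 0 < N%:R :> R by rewrite ltr0n.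
rewrite lt_eqF// cos_lt1//; apply/andP; split.
  by rewrite divr_gt0// mulr_gt0 ?ltr0n// mulr_gt0// pi_gt0.
by rewrite ltr_pdivrMr// ltr_pM2l ?mulr_gt0 ?pi_gt0// ltr_nat ltn_mod.
Qed.

Lemma sum_unity N l : (0 < N)%N ->
  \sum_(j < N) unity N (l * j) = if (N %| l)%N then N%:R else 0.
Proof.
move=> N0; rewrite -unity_eq1//.
under eq_bigr do rewrite unityM.
case: ifPn => [/eqP ->|u1].
  by under eq_bigr do rewrite expr1n; rewrite sumr_const card_ord.
apply: (mulfI (x := unity N l - 1)); first by rewrite subr_eq0.
by rewrite -subrX1 -unityM mulnC unityM unityN// expr1n subrr mulr0.
Qed.

(** Averaging [p] against a character over the roots of unity of order [size p]
    isolates one coefficient, since no two exponents below [size p] agree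
    modulo [size p]. *)
Lemma cauchy_coef_le (p : {poly R[i]}) r B : 0 <= r ->
  (forall z, normc z <= r -> normc p.[z] <= B) ->
  forall i, normc p`_i * r ^+ i <= B.
Proof.
move=> r0 pB i; set N := size p.
have B0 : 0 <= B by apply: le_trans (nc_ge0 _) (pB 0 _); rewrite normc0.
have [Ni|iN] := leqP N i; first by rewrite nth_default// normc0 mul0r.
have N0 : (0 < N)%N by apply: leq_ltn_trans iN.
have NR : 0 < N%:R :> R by rewrite ltr0n.
have key : \sum_(j < N) p.[r%:C * unity N j] * unity N ((N - i) * j) = N%:R * (p`_i * r%:C ^+ i).
  have step (j m : 'I_N) : p`_m * (r%:C * unity N j) ^+ m * unity N ((N - i) * j) =
      p`_m * r%:C ^+ m * unity N ((m + (N - i)) * j).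
    by rewrite mulnDl unityD [(m * j)%N]mulnC (unityM N j m) exprMn; ring.
  under eq_bigr => j _.
    rewrite horner_coef mulr_suml (eq_bigr _ (fun m _ => step j m)).
    over.
  rewrite exchange_big/=.
  under eq_bigr => m _ do rewrite -mulr_sumr sum_unity//.
  rewrite (bigD1 (Ordinal iN))//= subnKC ?(ltnW iN)// dvdnn big1 ?addr0 1?mulrC// => m mi.
  rewrite ifF ?mulr0//; apply: contra_neqF mi => /dvdnP[q].
  move=> e; apply: val_inj => /=; move: e (ltn_ord m) iN; rewrite -/N.
  move: (nat_of_ord m) => a; case: q => [|[|q]]; rewrite ?mul0n ?mul1n; try lia; by rewrite !mulSn; lia.
rewrite -(ler_pM2l NR) -[r in r ^+ i]ger0_norm// -nc_real -ncX -normcM -nc_nat -normcM -key.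
rewrite nc_nat (le_trans (nc_sum _ _ _))//.
rewrite [leRHS](_ : _ = \sum_(j < N) B); last by rewrite sumr_const card_ord mulr_natl.
apply: ler_sum => j _; rewrite normcM nc_unity mulr1 pB//.
by rewrite ncZ nc_unity mulr1 ger0_norm.
Qed.
End RootsOfUnity.

(** * Uniform limits of polynomials on discs *)
Lemma geometric_half_le (R : realType) (q : R) n : 0 <= q <= 2^-1 ->
  \sum_(i < n) q ^+ i <= 2.
Proof.
move=> /andP[q0 q1]; elim: n => [|n ih]; first by rewrite big_ord0.
rewrite big_ord_recl expr0.
have -> : \sum_(i < n) q ^+ (lift ord0 i) = q * \sum_(i < n) q ^+ i.
  by rewrite mulr_sumr; apply: eq_bigr => i _; rewrite /= /bump/= add1n exprS.
nra.
Qed.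

(** Two indices can be compared through the sum of their errors, so the limit
    inherits the error of each term. *)
Lemma cauchy_limit (R : realType) (u e : nat -> R) :
  (forall j l, `|u j - u l| <= e j + e l) -> e @ \oo --> (0 : R) ->
  exists a, forall j, `|u j - a| <= e j.
Proof.
move=> ue /cvgrPdist_lt e0.
have small x : 0 < x -> exists N, forall n, (N <= n)%N -> e n < x.
  move=> /e0[N _ eN]; exists N => n /eN; rewrite sub0r normrN.
  by apply: le_lt_trans; exact: ler_norm.
have cu : cvgn u.
  apply/cauchy_cvgP/cauchy_exP => x x0.
  have [N eN] := small _ (divr_gt0 x0 (ltr0n R 2)).
  exists (u N); exists N => // l Nl; rewrite /ball/= (le_lt_trans (ue N l))//.
  by rewrite [x]splitr ltrD// eN.
exists (limn u) => j; apply/ler_addgt0Pr => x x0.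
have hu : `|u j - u n| @[n --> \oo] --> `|u j - limn u|.
  by apply: cvg_norm; apply: cvgB => //; exact: cvg_cst.
apply: cvgr_to_le hu _.
have [N eN] := small _ x0.
by exists N => // l Nl; rewrite (le_trans (ue j l))// lerD2l ltW// eN.
Qed.

Section PolynomialApproximation.
Variable R : realType.
Implicit Types (p q : {poly R}) (z w : R[i]) (r B e : R) (f g : R[i] -> R[i]).

Definition cev p z : R[i] := (map_poly (real_complex R) p).[z].

Lemma cevD p q z : cev (p + q) z = cev p z + cev q z.
Proof. by rewrite /cev rmorphD hornerD. Qed.
Lemma cevM p q z : cev (p * q) z = cev p z * cev q z.
Proof. by rewrite /cev rmorphM hornerM. Qed.
Lemma cevC (c : R) z : cev c%:P z = c%:C.
Proof. by rewrite /cev map_polyC hornerC. Qed.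
Lemma cevX z : cev 'X z = z.
Proof. by rewrite /cev map_polyX hornerX. Qed.
Lemma cevE p z n : (size p <= n)%N -> cev p z = \sum_(i < n) (p`_i)%:C * z ^+ i.
Proof.
move=> pn; rewrite /cev (horner_coef_wide (n := n)) ?size_map_poly//.
by apply: eq_bigr => i _; rewrite coef_map.
Qed.

Lemma cauchy_real_coef_le p r B : 0 <= r ->
  (forall z, normc z <= r -> normc (cev p z) <= B) ->
  forall i, `|p`_i| * r ^+ i <= B.
Proof.
move=> r0 pB i; have := cauchy_coef_le r0 pB i.
by rewrite coef_map nc_real.
Qed.

Lemma cev_bounded p r : exists2 B, 0 <= B & forall z, normc z <= r -> normc (cev p z) <= B.
Proof.
exists (\sum_(i < size p) `|p`_i| * `|r| ^+ i).
  by apply: sumr_ge0 => i _; rewrite mulr_ge0// exprn_ge0.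
move=> z zr; rewrite (cevE _ (leqnn _)) (le_trans (nc_sum _ _ _))//.
apply: ler_sum => i _; rewrite normcM nc_real ncX ler_wpM2l//.
by rewrite lerXn2r ?nnegrE ?nc_ge0// (le_trans zr)// ler_norm.
Qed.

(** This class of functions stands in for holomorphic functions that are real on the
    real axis. It contains the normalised profiles and is closed under uniform limits,
    and Cauchy's estimates only have to be proved for polynomials. *)
Definition poly_approx r f := forall e, 0 < e ->
  exists p, forall z, normc z <= r -> normc (f z - cev p z) <= e.

Lemma approx_bounded r f : poly_approx r f ->
  exists2 B, 0 <= B & forall z, normc z <= r -> normc (f z) <= B.
Proof.
move=> /(_ 1 ltr01)[p fp]; have [B B0 pB] := cev_bounded p r.
exists (B + 1); first by rewrite addr_ge0.
by move=> z zr; rewrite (le_trans (ler_nc_sub _ (cev p z)))// lerD ?pB ?fp.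
Qed.

Lemma approx_cev r p : poly_approx r (cev p).
Proof. by move=> e e0; exists p => z _; rewrite subrr normc0 ltW. Qed.

Lemma eq_approx r f g : f =1 g -> poly_approx r f -> poly_approx r g.
Proof. by move=> /funext ->. Qed.

Lemma approx_cst r (c : R) : poly_approx r (fun=> c%:C).
Proof. by apply: eq_approx (approx_cev r c%:P) => z; rewrite cevC. Qed.

Lemma approx_id r : poly_approx r id.
Proof. by apply: eq_approx (approx_cev r 'X) => z; rewrite cevX. Qed.

Lemma approxD r f g : poly_approx r f -> poly_approx r g ->
  poly_approx r (fun z => f z + g z).
Proof.
move=> af ag e e0; have e20 : 0 < e / 2 by rewrite divr_gt0.
have [p fp] := af _ e20; have [q gq] := ag _ e20.
exists (p + q) => z zr; rewrite cevD opprD addrACA (le_trans (le_normcD _ _))//.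
by rewrite [leRHS]splitr lerD ?fp ?gq.
Qed.

Lemma approxM r f g : poly_approx r f -> poly_approx r g ->
  poly_approx r (fun z => f z * g z).
Proof.
move=> af ag e e0.
have [C C0 gC] := approx_bounded ag.
have [p fp] := af _ (divr_gt0 (divr_gt0 e0 (ltr0n R 2)) (ltr_wpDl C0 ltr01)).
have [B B0 pB] := cev_bounded p r.
have [q gq] := ag _ (divr_gt0 (divr_gt0 e0 (ltr0n R 2)) (ltr_wpDl B0 ltr01)).
exists (p * q) => z zr.
have -> : f z * g z - cev (p * q) z = (f z - cev p z) * g z + cev p z * (g z - cev q z).
  by rewrite cevM; ring.
rewrite (le_trans (le_normcD _ _))// [leRHS]splitr !normcM lerD//.
  apply: le_trans (ler_pM (nc_ge0 _) (nc_ge0 _) (fp _ zr) (gC _ zr)) _.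
  by rewrite mulrAC ler_pdivrMr ?ltr_wpDl// ler_wpM2l ?divr_ge0 ?ltW// ltrDl.
apply: le_trans (ler_pM (nc_ge0 _) (nc_ge0 _) (pB _ zr) (gq _ zr)) _.
by rewrite mulrCA -[leRHS]mulr1 ler_wpM2l ?divr_ge0 ?ltW// ltr_pdivrMr ?mul1r ?ltrDl ?ltr_wpDl.
Qed.

Lemma approxX r f n : poly_approx r f -> poly_approx r (fun z => f z ^+ n).
Proof.
move=> af; elim: n => [|n ih].
  by apply: eq_approx (approx_cst r 1) => z; rewrite expr0.
by apply: eq_approx (approxM af ih) => z; rewrite exprS.
Qed.

Lemma approx_sum r (I : Type) (s : seq I) (f : I -> R[i] -> R[i]) :
  (forall i, poly_approx r (f i)) -> poly_approx r (fun z => \sum_(i <- s) f i z).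
Proof.
move=> af; elim: s => [|i s ih].
  by apply: eq_approx (approx_cst r 0) => z; rewrite big_nil.
by apply: eq_approx (approxD (af i) ih) => z; rewrite big_cons.
Qed.

Lemma approx_lim r f :
  (forall e, 0 < e -> exists2 g, poly_approx r g &
     forall z, normc z <= r -> normc (f z - g z) <= e) -> poly_approx r f.
Proof.
move=> fg e e0; have e20 : 0 < e / 2 by rewrite divr_gt0.
have [g ag {}fg] := fg _ e20; have [p gp] := ag _ e20.
exists p => z zr; rewrite (le_trans (ler_nc_dist (g z) _ _))//.
by rewrite [leRHS]splitr lerD ?fg ?gp.
Qed.

Lemma approx_cexp r f : poly_approx r f -> poly_approx r (fun z => cexp (f z)).
Proof.
move=> af; apply: approx_lim => e e0.
have [B B0 fB] := approx_bounded af.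
have [n nB] := exp_remainder_small B e0.
exists (fun z => exp_trunc n (f z)).
  by apply: approx_sum => i; apply: approxM (approx_cst r _) (approxX i af).
move=> z zr; apply: le_trans (ltW nB); apply: le_trans (cexp_taylor _ _) _.
rewrite ler_wpM2r ?invr_ge0// ler_pM ?exprn_ge0 ?nc_ge0 ?expR_ge0//.
  by rewrite lerXn2r ?nnegrE ?nc_ge0// fB.
by rewrite ler_expR fB.
Qed.

Lemma cev_tail_le p r B n z : 0 < r -> normc z <= r / 2 ->
  (forall i, `|p`_i| * r ^+ i <= B) ->
  normc (cev p z - \sum_(i < n) (p`_i)%:C * z ^+ i) <= 2 * B * (normc z / r) ^+ n.
Proof.
move=> r0 zr pB; set q := normc z / r.
have B0 : 0 <= B by apply: le_trans (pB 0); rewrite mulr_ge0// exprn_ge0// ltW.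
have q0 : 0 <= q by rewrite divr_ge0 ?nc_ge0// ltW.
have q2 : 0 <= q <= 2^-1 by rewrite q0 /q ler_pdivrMr// mulrC.
pose N := size p; rewrite (cevE z (leq_addl n N)) big_split_ord/=.
rewrite addrAC subrr add0r (le_trans (nc_sum _ _ _))//.
apply: (@le_trans _ _ (\sum_(i < N) B * q ^+ n * q ^+ i)).
  apply: ler_sum => i _; rewrite normcM nc_real ncX -mulrA -exprD.
  have -> : q ^+ (n + i) = (r ^+ (n + i))^-1 * normc z ^+ (n + i).
    by rewrite expr_div_n mulrC.
  rewrite mulrA ler_wpM2r ?exprn_ge0 ?nc_ge0// ler_pdivlMr ?exprn_gt0//.
rewrite -mulr_sumr -mulrA mulrC -mulrA mulrCA [B * _]mulrC.
by rewrite ler_wpM2r// mulrC ler_wpM2r ?exprn_ge0// geometric_half_le.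
Qed.

(** Cauchy's estimates pass to the limit of the coefficients, which makes a
    uniform limit of polynomials on a disc a power series. *)
Lemma approx_power_series r B f : 0 < r -> poly_approx r f ->
  (forall z, normc z <= r -> normc (f z) <= B) ->
  exists a : nat -> R, (forall i, `|a i| * r ^+ i <= B) /\
    forall n z, normc z <= r / 2 ->
      normc (f z - \sum_(i < n) (a i)%:C * z ^+ i) <= 2 * B * (normc z / r) ^+ n.
Proof.
move=> r0 af fB.
have e_gt0 (j : nat) : 0 < j.+1%:R^-1 :> R by rewrite invr_gt0.
have [p fp] := choice (fun j => af _ (e_gt0 j)).
have e_cvg : (fun j => j.+1%:R^-1 : R) @ \oo --> (0 : R) by exact: cvg_harmonic.
have coefB i j l : `|(p j)`_i - (p l)`_i| <= j.+1%:R^-1 / r ^+ i + l.+1%:R^-1 / r ^+ i.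
  rewrite -mulrDl ler_pdivlMr ?exprn_gt0// -coefB.
  apply: (@cauchy_real_coef_le (p j - p l) r); first exact: ltW.
  move=> z zr; have -> : cev (p j - p l) z = (f z - cev (p l) z) - (f z - cev (p j) z).
    by rewrite /cev rmorphB hornerD hornerN; ring.
  by rewrite [leRHS]addrC (le_trans (ler_ncB _ _))// lerD ?fp.
have /choice[a pa] i : exists a, forall j, `|(p j)`_i - a| <= j.+1%:R^-1 / r ^+ i.
  apply: (cauchy_limit (coefB i)); rewrite -[0](mul0r (r ^+ i)^-1).
  by apply: cvgM => //; exact: cvg_cst.
have pB j z : normc z <= r -> normc (cev (p j) z) <= B + j.+1%:R^-1.
  move=> zr; rewrite (le_trans (ler_nc_sub _ (f z)))// lerD ?fB//.
  by rewrite ncB fp.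
have pcB j i := cauchy_real_coef_le (ltW r0) (@pB j) i.
have small (x : R) : 0 < x -> exists j : nat, j.+1%:R^-1 < x.
  move=> x0; have /cvgrPdist_lt/(_ _ x0)[N _ /(_ N (leqnn N)) b] := e_cvg.
  by exists N; apply: le_lt_trans b; rewrite sub0r normrN; exact: ler_norm.
exists a; split.
  move=> i; apply/ler_addgt0Pr => x x0.
  have [j jx] := small (x / 2) (divr_gt0 x0 (ltr0n R 2)).
  have := pa i j; have := pcB j i.
  rewrite ler_pdivlMr ?exprn_gt0//; have := ler_normB (p j)`_i ((p j)`_i - a i).
  rewrite opprB addrC subrK => h1 h2 h3.
  apply: le_trans (ler_wpM2r (exprn_ge0 i (ltW r0)) h1) _; rewrite mulrDl.
  by apply: le_trans (lerD h2 h3) _; rewrite -addrA lerD2l [x]splitr lerD ?ltW.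
move=> n z zr; apply/ler_addgt0Pr => x x0.
have [j jx] := small (x / 5) (divr_gt0 x0 (ltr0n R 5)).
set e := j.+1%:R^-1 in jx; have e0 : 0 < e by exact: e_gt0.
have zr1 : normc z <= r by apply: le_trans zr _; lra.
have t1 := fp j z zr1; have t2 := cev_tail_le n r0 zr (pcB j).
have t3 : normc (\sum_(i < n) ((p j)`_i)%:C * z ^+ i - \sum_(i < n) (a i)%:C * z ^+ i) <= 2 * e.
  rewrite -sumrB (le_trans (nc_sum _ _ _))//.
  apply: (@le_trans _ _ (\sum_(i < n) e * (normc z / r) ^+ i)).
    apply: ler_sum => i _; rewrite -mulrBl -rmorphB normcM nc_real ncX.
    rewrite expr_div_n mulrA mulrAC ler_wpM2r ?exprn_ge0 ?nc_ge0//; exact: pa.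
  rewrite -mulr_sumr mulrC ler_wpM2r ?(ltW e0)// geometric_half_le//.
  by rewrite divr_ge0 ?nc_ge0 ?(ltW r0)//= ler_pdivrMr// mulrC.
have q1 : (normc z / r) ^+ n <= 1.
  by rewrite exprn_ile1 ?divr_ge0 ?nc_ge0 ?(ltW r0)// ler_pdivrMr// mul1r.
have q0 : 0 <= (normc z / r) ^+ n by rewrite exprn_ge0// divr_ge0 ?nc_ge0// ltW.
apply: le_trans (ler_nc_dist (cev (p j) z) _ _) _.
apply: le_trans (lerD t1 (ler_nc_dist (\sum_(i < n) ((p j)`_i)%:C * z ^+ i) _ _)) _.
rewrite -/e in t2 t3 *; nra.
Qed.

(** Term by term from Cauchy's estimates. *)
Lemma approx_lipschitz r B f z w : 0 < r -> poly_approx r f ->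
  (forall z, normc z <= r -> normc (f z) <= B) ->
  normc z <= r / 4 -> normc w <= r / 4 ->
  normc (f z - f w) <= 4 * B / r * normc (z - w).
Proof.
move=> r0 af fB zr wr.
have key e : 0 < e -> normc (f z - f w) <= 4 * (B + e) / r * normc (z - w) + 2 * e.
  move=> e0; have [p fp] := af e e0.
  have pB y : normc y <= r -> normc (cev p y) <= B + e.
    by move=> yr; rewrite (le_trans (ler_nc_sub _ (f y)))// lerD ?fB// ncB fp.
  have pcB := cauchy_real_coef_le (ltW r0) pB.
  have Be : 0 <= B + e by apply: le_trans (nc_ge0 _) (pB 0 _); rewrite normc0 ltW.
  have -> : f z - f w = (f z - cev p z) - (f w - cev p w) + (cev p z - cev p w) by ring.
  have zr1 : normc z <= r by apply: le_trans zr _; lra.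
  have wr1 : normc w <= r by apply: le_trans wr _; lra.
  rewrite (le_trans (le_normcD _ _))// addrC lerD//; last first.
    by rewrite (le_trans (ler_ncB _ _))// mulr2n mulrDl mul1r lerD ?fp.
  rewrite !(cevE _ (leqnSn (size p))) -sumrB (le_trans (nc_sum _ _ _))//.
  rewrite big_ord_recl !expr0 subrr normc0 add0r.
  apply: (@le_trans _ _ (\sum_(i < size p) (2 * (B + e) / r * normc (z - w)) * 2^-1 ^+ i)).
    apply: ler_sum => i _; rewrite -mulrBr normcM nc_real /= /bump/= add1n.
    have h := nc_prodXB i.+1 zr wr; rewrite /= in h.
    apply: le_trans (ler_wpM2l (normr_ge0 _) h) _.
    rewrite !mulrA [leRHS]mulrAC ler_wpM2r ?nc_ge0//.
    have i2 : i.+1%:R <= 2 ^+ i :> R by rewrite -natrX ler_nat ltn_expl.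
    have e4 : (r / 4) ^+ i = r ^+ i * 2^-1 ^+ i * 2^-1 ^+ i.
      by rewrite -!exprMn; congr (_ ^+ _); lra.
    rewrite e4; have := pcB i.+1; rewrite exprS => pc.
    have h2 : i.+1%:R * (2^-1 ^+ i) <= 1 :> R.
      by rewrite exprVn ler_pdivrMr ?exprn_gt0// mul1r.
    have p2 : 0 <= 2^-1 ^+ i :> R by rewrite exprn_ge0.
    rewrite [leRHS]mulrAC [leRHS]mulrC ler_pdivlMl//.
    set x := 2^-1 ^+ i in h2 p2 *; set y := i.+1%:R in h2 *.
    have -> : r * (`|p`_i.+1| * y * (r ^+ i * x * x)) = `|p`_i.+1| * (r * r ^+ i) * ((y * x) * x) by ring.
    have c0 : 0 <= `|p`_i.+1| * (r * r ^+ i) by rewrite mulr_ge0// mulr_ge0 ?exprn_ge0// ltW.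
    have yx0 : 0 <= y * x by rewrite mulr_ge0// ler0n.
    apply: le_trans (ler_pM c0 _ pc (_ : _ <= 1 * x)) _; rewrite ?mulr_ge0//.
      by rewrite ler_wpM2r.
    rewrite mul1r ler_wpM2r//; lra.
  rewrite -mulr_sumr.
  apply: le_trans (ler_wpM2l _ (geometric_half_le _ _)) _.
  - by rewrite mulr_ge0 ?nc_ge0// divr_ge0 ?(ltW r0)// mulr_ge0.
  - by rewrite invr_ge0 ler0n/= lexx.
  - by rewrite le_eqVlt; apply/orP; left; apply/eqP; ring.
apply/ler_addgt0Pr => x x0.
pose D := 4 * normc (z - w) / r + 2.
have D0 : 0 < D by rewrite ltr_wpDl// divr_ge0 ?mulr_ge0 ?nc_ge0// ltW.
apply: le_trans (key (x / D) (divr_gt0 x0 D0)) _.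
rewrite le_eqVlt; apply/orP; left; apply/eqP; rewrite /D; field.
by rewrite !gt_eqF// ltr_wpDl ?mulr_ge0 ?nc_ge0// mulr_gt0.
Qed.
End PolynomialApproximation.

(** * The profile generating function *)

Section Profile.
Variable R : realType.
Implicit Types (z w : R[i]) (b t : R) (s : seq (seq bool)).

Definition alpha z : R[i] := 2 * cexp z - 1.
Definition Sn s z : R[i] := \sum_(x <- s) cexp (z * (size x)%:R).
Definition rSn s t : R := \sum_(x <- s) expR (t * (size x)%:R).

Arguments alpha : simpl never.
Arguments Sn : simpl never.
Arguments rSn : simpl never.

Lemma WnE v n z :
  Wn v n z = cexp (- (alpha z * (ln (n%:R : R))%:C)) * Sn (external v n) z.
Proof. by rewrite /Wn mulNr. Qed.

Lemma real_natc n : n%:R = (n%:R : R)%:C :> R[i].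
Proof. by rewrite rmorph_nat. Qed.

Lemma Re_mul_nat z n : Re (z * n%:R) = Re z * n%:R.
Proof. by rewrite real_natc mulrC ReZ mulrC. Qed.

Lemma nc_Sn_le s z : normc (Sn s z) <= rSn s (Re z).
Proof.
apply: le_trans (nc_sum _ _ _) _; apply: ler_sum => x _.
by rewrite nc_cexp Re_mul_nat.
Qed.

Lemma rSn_ge0 s t : 0 <= rSn s t.
Proof. by apply: sumr_ge0 => x _; exact: expR_ge0. Qed.

Lemma Sn_real s t : Sn s t%:C = (rSn s t)%:C.
Proof.
rewrite /Sn /rSn rmorph_sum; apply: eq_bigr => x _.
by rewrite real_natc -rmorphM cexp_real.
Qed.

Lemma alpha_real b : alpha b%:C = (2 * expR b - 1)%:C.
Proof. by rewrite /alpha cexp_real rmorphB rmorphM rmorph1 rmorph_nat. Qed.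

Lemma Re_alpha z : Re (alpha z) = 2 * (expR (Re z) * cos (Im z)) - 1.
Proof. by rewrite /alpha ReD ReN real_natc ReZ Re_cexp. Qed.

Lemma nc_alpha_le z : normc (alpha z) <= 2 * expR (Re z) + 1.
Proof.
rewrite /alpha (le_trans (ler_ncB _ _))// normc1 lerD2r.
by rewrite normcM nc_nat nc_cexp.
Qed.

Lemma nc_Wn_n z v n :
  normc (Wn v n z) = expR (- (Re (alpha z) * ln n%:R)) * normc (Sn (external v n) z).
Proof. by rewrite WnE normcM nc_cexp ReN [alpha z * _]mulrC ReZ [ln _ * _]mulrC. Qed.

Lemma Wn_real v n b : Wn v n b%:C =
  (expR (- ((2 * expR b - 1) * ln n%:R)) * rSn (external v n) b)%:C.
Proof. by rewrite WnE Sn_real alpha_real -rmorphM -rmorphN cexp_real -rmorphM. Qed.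

Lemma Wn_approx v n b r : poly_approx r (fun z => Wn v n (b%:C + z)).
Proof.
have ab : poly_approx r (fun z => b%:C + z) by exact: approxD (approx_cst _ _) (approx_id _).
have acst (c : R) (f : R[i] -> R[i]) : poly_approx r f -> poly_approx r (fun z => f z * c%:C).
  by move=> af; exact: approxM af (approx_cst _ _).
have -> : (fun z => Wn v n (b%:C + z)) = fun z =>
    cexp ((cexp (b%:C + z) * 2%:C + (-1)%:C) * (- ln (n%:R : R))%:C) *
    \sum_(x <- external v n) cexp ((b%:C + z) * ((size x)%:R : R)%:C).
  apply/funext => z; rewrite WnE; congr (cexp _ * _).
    have e2 : (2%:C : R[i]) = 2 by rewrite rmorph_nat.
    have e1 : ((-1)%:C : R[i]) = -1 by rewrite rmorphN rmorph1.
    by rewrite e1 e2 [(- ln _)%:C]rmorphN /alpha; ring.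
  by apply: eq_bigr => x _; rewrite real_natc.
apply: approxM; last by apply: approx_sum => x; exact/approx_cexp/acst.
by apply/approx_cexp/acst/approxD; [apply/acst/approx_cexp|exact: approx_cst].
Qed.
End Profile.

(** * From compact convergence in the plane to bounds on discs *)

Section ComplexTopology.
Variable R : realType.
Implicit Types (z w : R[i]) (D : set (R[i])^o).

Lemma ball_nc z w (e : R) : @ball _ (R[i])^o z e%:C w <-> normc (z - w) < e.
Proof. by rewrite /ball/= nc_norm ltcR. Qed.

Lemma gt0_complex (e : R[i]) : 0 < e -> exists2 x : R, 0 < x & e = x%:C.
Proof.
case: e => x y; rewrite ltcE/= => /andP[/eqP -> x0].
by exists x.
Qed.

Lemma nbhs_nc z (A : set (R[i])^o) : nbhs (z : (R[i])^o) A ->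
  exists2 e : R, 0 < e & forall w, normc (z - w) < e -> A w.
Proof.
move=> /nbhs_ballP[_ /gt0_complex[e e0 ->] zA].
by exists e => // w /ball_nc; exact: zA.
Qed.

Lemma uniform_nc (K : set (R[i])^o) (f : nat -> R[i] -> R[i]) (g : R[i] -> R[i]) :
  {uniform K, (f : nat -> (R[i])^o -> (R[i])^o) @ \oo --> (g : (R[i])^o -> (R[i])^o)} ->
  forall e : R, 0 < e -> exists N, forall n, (N <= n)%N -> forall z, K z ->
    normc (f n z - g z) < e.
Proof.
move=> fg e e0.
have : nbhs (g : {uniform` K -> (R[i])^o})
    [set h | forall y, K y -> @ball _ (R[i])^o (g y) e%:C (h y)].
  apply/uniform_nbhs; exists [set xy | @ball _ (R[i])^o xy.1 e%:C xy.2]; split => //.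
  by rewrite -entourage_ballE; exists e%:C => //=; rewrite ltcR.
move=> /fg[N _ fN]; exists N => n Nn z Kz.
by rewrite ncB; apply/ball_nc; exact: (fN n Nn).
Qed.

Lemma rectangle_compact (a b c d : R) :
  compact [set z : (R[i])^o | a <= Re z <= b /\ c <= Im z <= d].
Proof.
have -> : [set z : (R[i])^o | a <= Re z <= b /\ c <= Im z <= d] =
    (fun p : R * R => (p.1 +i* p.2) : (R[i])^o) @` (`[a, b] `*` `[c, d]).
  apply/seteqP; split => [[x y]/= [xab ycd]|_ /= [[x y] /= [xab ycd] <-]].
    by exists (x, y); rewrite /= ?in_itv.
  by move: xab ycd; rewrite !in_itv.
apply: continuous_compact; last by apply: compact_setX; exact: segment_compact.
apply: continuous_subspaceT => -[x y] A /nbhs_nc[e e0 eA].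
exists (ball x (e / 2), ball y (e / 2)).
  by split; apply/nbhsx_ballx; rewrite divr_gt0.
move=> [x' y'] [/= xx' yy']; apply: eA; apply: le_lt_trans (nc_le_ReIm _) _ => /=.
by rewrite [e]splitr ltrD.
Qed.

Lemma tube_in_open D (a b : R) : open D ->
  (forall x, a <= x <= b -> D x%:C) ->
  exists2 r : R, 0 < r & forall x z, a <= x <= b -> normc z <= r -> D (x%:C + z).
Proof.
move=> oD abD.
have /compact_near_coveringP/(_ _ (0^'+) (fun r x => forall z, normc z <= r -> D (x%:C + z)) _) :=
  @segment_compact R a b.
case.
  move=> x; rewrite /= in_itv/= => /abD Dx.
  have /nbhs_nc[e e0 eD] : nbhs (x%:C : (R[i])^o) D by exact: open_nbhs_nbhs.
  exists (ball x (e / 2), [set r | r < e / 2]).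
    split; first by apply/nbhsx_ballx; rewrite divr_gt0.
    by apply: nbhs_right_lt; rewrite divr_gt0.
  move=> [y r] /= [xy re] z zr; apply: eD.
  rewrite opprD addrA -rmorphB (le_lt_trans (ler_ncB _ _))// nc_real [e]splitr ltrD//.
  exact: le_lt_trans zr re.
move=> e /= e0 h; have e20 : 0 < e / 2 by rewrite divr_gt0.
exists (e / 2) => // x z xab; apply: h; rewrite ?in_itv//=.
by rewrite sub0r normrN gtr0_norm// ltr_pdivrMr// ltr_pMr// ltrDl.
Qed.

Lemma discs_in_compact D (a b : R) : a <= b -> open D ->
  (forall x, a <= x <= b -> D x%:C) ->
  exists2 r : R, 0 < r & exists2 K : set (R[i])^o, compact K /\ K `<=` D &
    forall x z, a <= x <= b -> normc z <= r -> K (x%:C + z).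
Proof.
move=> ab oD abD; have [r r0 rD] := tube_in_open oD abD.
exists (r / 2); first by rewrite divr_gt0.
exists [set z : (R[i])^o | a - r / 2 <= Re z <= b + r / 2 /\ - (r / 2) <= Im z <= r / 2].
  split; first exact: rectangle_compact.
  move=> [x y] /= [/andP[ax xb] yr].
  pose c := Order.max a (Order.min b x).
  have cab : a <= c <= b by rewrite le_max lexx/= ge_max ab ge_min lexx.
  have -> : x +i* y = c%:C + ((x - c) +i* y) by apply: complexP => /=; ring.
  apply: rD => //; apply: le_trans (nc_le_ReIm _) _ => /=.
  rewrite [r]splitr lerD// ?ler_norml// /c.
  by case: (leP b x) => bx; case: (leP a _) => ax'; apply/andP; split; lra.
move=> x [u v] /andP[ax xb] zr /=; rewrite add0r.
have := le_trans (Re_le_nc (u +i* v)) zr; have := le_trans (Im_le_nc (u +i* v)) zr.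
rewrite /= !ler_norml => /andP[v1 v2] /andP[u1 u2].
by split; apply/andP; split => //; lra.
Qed.

End ComplexTopology.

Section LimitOfProfiles.
Variable R : realType.
Implicit Types (z w : R[i]) (W : R[i] -> R[i]) (v : nat -> seq bool) (a b r B : R).

(** The convergence is uniform in the centre of the disc as well, because the
    expansion of the profile has to be uniform in the saddle point. *)
Definition disc_cvg v W a b r := forall e : R, 0 < e ->
  exists N, forall n, (N <= n)%N -> forall x z, a <= x <= b -> normc z <= r ->
    normc (Wn v n (x%:C + z) - W (x%:C + z)) < e.

Lemma disc_cvg_approx v W a b r x : disc_cvg v W a b r -> a <= x <= b ->
  poly_approx r (fun z => W (x%:C + z)).
Proof.
move=> vW xab; apply: approx_lim => e /vW[N WN].
exists (fun z => Wn v N (x%:C + z)); first exact: Wn_approx.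
by move=> z zr; rewrite ncB ltW// WN.
Qed.

Lemma nc_Wn_le v n z (M : R) : `|Re z| <= M ->
  normc (Wn v n z) <= expR ((2 * expR M + 1) * `|ln n%:R|) * rSn (external v n) M.
Proof.
move=> zM; rewrite nc_Wn_n ler_pM ?expR_ge0 ?nc_ge0//.
  rewrite ler_expR (le_trans (ler_norm _))// normrN normrM ler_wpM2r//.
  apply: le_trans (Re_le_nc _) _; apply: le_trans (nc_alpha_le _) _.
  by rewrite lerD2r ler_pM2l// ler_expR (le_trans (ler_norm _)).
apply: le_trans (nc_Sn_le _ _) _; apply: ler_sum => x _.
by rewrite ler_expR ler_wpM2r// (le_trans (ler_norm _)).
Qed.

(** From some time on, all the functions are within 2 of one of them, which is an
    explicit finite sum. *)
Lemma disc_cvg_bounded v W a b r : disc_cvg v W a b r ->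
  exists2 B, 0 < B & exists N, forall x z, a <= x <= b -> normc z <= r ->
    normc (W (x%:C + z)) <= B /\ forall n, (N <= n)%N -> normc (Wn v n (x%:C + z)) <= B.
Proof.
move=> /(_ 1 ltr01)[N WN].
set M := `|a| + `|b| + r.
pose B0 := expR ((2 * expR M + 1) * `|ln N%:R|) * rSn (external v N) M.
have B00 : 0 <= B0 by rewrite mulr_ge0 ?expR_ge0// rSn_ge0.
exists (B0 + 2); first by rewrite ltr_wpDl.
exists N => x z xab zr.
have h : normc (Wn v N (x%:C + z)) <= B0.
  apply: nc_Wn_le; rewrite ReD/= (le_trans (ler_normD _ _))// /M.
  rewrite lerD//; last exact: le_trans (Re_le_nc _) zr.
  case/andP: xab => ax xb; rewrite ler_norml.
  have := ler_norm b; have := ler_norm (- a); have := normr_ge0 a; have := normr_ge0 b.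
  by rewrite normrN; lra.
have hW : normc (W (x%:C + z)) <= B0 + 1.
  apply: le_trans (ler_nc_sub _ (Wn v N (x%:C + z))) _.
  by rewrite lerD// ncB ltW// WN.
split; first by apply: le_trans hW _; rewrite lerD2l ler1n.
move=> n Nn; apply: le_trans (ler_nc_sub _ (W (x%:C + z))) _.
have -> : B0 + 2 = B0 + 1 + 1 by ring.
by rewrite lerD// ltW// WN.
Qed.
End LimitOfProfiles.

(** * Derivatives of analytic and of smooth real functions *)

Section AnalyticDerivatives.
Variable R : realType.
Implicit Types (c : nat -> R) (r x b : R) (g : R -> R).

Definition geometric_coef c r := exists C : R, forall i, `|c i| * r ^+ i <= C.

Lemma geometric_coef_cvg c r x : 0 < r -> `|x| < r -> geometric_coef c r -> cvgn (pseries c x).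
Proof.
move=> r0 xr [C cC].
have C0 : 0 <= C by apply: le_trans (cC 0); rewrite mulr_ge0// exprn_ge0// ltW.
apply: normed_cvg; apply: (@series_le_cvg _ _ (geometric C (`|x| / r))) => [n|n|n|].
- exact: normr_ge0.
- by rewrite /geometric/= mulr_ge0// exprn_ge0// divr_ge0// ltW.
- rewrite /geometric/= normrM normrX expr_div_n mulrA mulrAC ler_wpM2r ?exprn_ge0//.
  by rewrite ler_pdivlMr ?exprn_gt0.
apply: is_cvg_geometric_series.
by rewrite ger0_norm ?divr_ge0 ?(ltW r0)// ltr_pdivrMr// mul1r.
Qed.

Lemma geometric_coef_diffs c r : 0 < r -> geometric_coef c r ->
  geometric_coef (pseries_diffs c) (r / 2).
Proof.
move=> r0 [C cC]; have C0 : 0 <= C by apply: le_trans (cC 0); rewrite mulr_ge0// exprn_ge0// ltW.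
exists (C / r) => i; rewrite /pseries_diffs normrM normr_nat ler_pdivlMr//.
have i2 : i.+1%:R * (2^-1) ^+ i <= 1 :> R.
  by rewrite exprVn ler_pdivrMr ?exprn_gt0// mul1r -natrX ler_nat ltn_expl.
have -> : i.+1%:R * `|c i.+1| * (r / 2) ^+ i * r = (`|c i.+1| * r ^+ i.+1) * (i.+1%:R * 2^-1 ^+ i).
  by rewrite exprMn exprS; ring.
by rewrite -[leRHS]mulr1 ler_pM// ?mulr_ge0 ?exprn_ge0// ltW.
Qed.

Lemma geometric_coef_le c r s : 0 <= s <= r -> geometric_coef c r -> geometric_coef c s.
Proof.
move=> /andP[s0 sr] [C cC]; exists C => i; apply: le_trans (cC i).
by rewrite ler_wpM2l// lerXn2r// nnegrE (le_trans s0).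
Qed.

(** Differentiating a power series term by term requires the convergence of its second
    derivative. Each differentiation of the coefficients halves the radius, and [r / 5]
    lies between [r / 8] and the remaining [r / 4]. *)
Lemma analytic_is_derive c r g b x : 0 < r -> geometric_coef c r ->
  (forall y, `|y| < r -> g (b + y) = limn (pseries c y)) -> `|x| < r / 8 ->
  is_derive (b + x) 1 g (limn (pseries (pseries_diffs c) x)).
Proof.
move=> r0 cr gc xr.
have K5 : `|r / 5| = r / 5 by rewrite gtr0_norm// divr_gt0.
have c2 := geometric_coef_diffs r0 cr.
have c3 := geometric_coef_diffs (divr_gt0 r0 (ltr0n R 2)) c2.
have dp : is_derive x 1 (fun y => limn (pseries c y)) (limn (pseries (pseries_diffs c) x)).
  apply: (@pseries_snd_diffs _ _ (r / 5)).
  - by apply: geometric_coef_cvg cr => //; rewrite K5; lra.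
  - by apply: geometric_coef_cvg c2; rewrite ?K5; lra.
  - by apply: geometric_coef_cvg c3; rewrite ?K5; lra.
  - by rewrite K5; lra.
have {}dp : is_derive (b + x) 1 (fun y => limn (pseries c (y - b))) (limn (pseries (pseries_diffs c) x)).
  have := @is_derive1_comp _ (fun y => limn (pseries c y)) (fun y => y - b) (b + x)
    (limn (pseries (pseries_diffs c) x)) 1.
  rewrite [b + x]addrC addrK => /(_ dp); rewrite mulr1; apply.
  by pointwise_derivative; rewrite addr0.
apply: near_eq_is_derive dp.
have e0 : 0 < r - `|x| by rewrite subr_gt0 (lt_trans xr)// ltr_pdivrMr// ltr_pMr// ltr1n.
exists (r - `|x|) => //= y; rewrite /ball/= => yx.
rewrite -{2}(subrK b y) [y - b + b]addrC gc//.
have -> : y - b = x - (b + x - y) by ring.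
by rewrite (le_lt_trans (ler_normB _ _))// addrC -ltrBrDr.
Qed.

Lemma analytic_derive1n i c r g b : 0 < r -> geometric_coef c r ->
  (forall y, `|y| < r -> g (b + y) = limn (pseries c y)) ->
  derivable (derive1n i g) b 1 /\ derive1n i g b = i`!%:R * c i.
Proof.
elim: i c r g => [|i ih] c r g r0 cr gc.
  split.
    have x0 : `|0 : R| < r / 8 by rewrite normr0 divr_gt0.
    by have [] := analytic_is_derive r0 cr gc x0; rewrite addr0.
  rewrite derive1n0 -[in LHS](addr0 b) gc ?normr0// mul1r.
  apply/cvg_lim => //; apply: cvg_near_cst; exists 1%N => // n n1.
  rewrite /pseries/series/= -(prednK n1) big_nat_recl// expr0 mulr1 big1 ?addr0// => j _.
  by rewrite exprS mul0r mulr0.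
have gc' y : `|y| < r / 8 -> derive1 g (b + y) = limn (pseries (pseries_diffs c) y).
  by move=> yr; rewrite derive1E; have [_ <-] := analytic_is_derive r0 cr gc yr.
have r80 : 0 < r / 8 by rewrite divr_gt0.
have cr' : geometric_coef (pseries_diffs c) (r / 8).
  by apply: geometric_coef_le (geometric_coef_diffs r0 cr); apply/andP; split; lra.
have [d e] := ih _ _ _ r80 cr' gc'.
by rewrite /derive1n iterSr; split => //; rewrite [LHS]e /pseries_diffs factS natrM; ring.
Qed.
End AnalyticDerivatives.

Lemma leibniz_step (R : comNzRingType) n (a b : nat -> R) :
  \sum_(l < n.+1) 'C(n, l)%:R * (a l.+1 * b (n - l)%N + a l * b (n - l).+1) =
  \sum_(l < n.+2) 'C(n.+1, l)%:R * (a l * b (n.+1 - l)%N).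
Proof.
under eq_bigr do rewrite mulrDr.
rewrite big_split/= [RHS]big_ord_recl/= bin0.
have -> : \sum_(l < n.+1) 'C(n.+1, bump 0 l)%:R * (a (bump 0 l) * b (n.+1 - bump 0 l)%N) =
    \sum_(l < n.+1) 'C(n, l.+1)%:R * (a l.+1 * b (n - l)%N) +
    \sum_(l < n.+1) 'C(n, l)%:R * (a l.+1 * b (n - l)%N).
  rewrite -big_split/=; apply: eq_bigr => l _.
  by rewrite /bump/= add1n binS natrD mulrDl subSS.
rewrite addrC addrA; congr (_ + _).
rewrite big_ord_recl [in RHS]big_ord_recr/= bin0 (bin_small (ltnSn n)) mul0r addr0 subn0.
congr (_ + _); apply: eq_bigr => l _.
by rewrite /bump/= add1n -subSn// subSS.
Qed.

Section SmoothFunctions.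
Variables (R : realType) (I : set R).
Hypothesis oI : open I.
Implicit Types (f g : R -> R) (k n : nat) (x : R).

Definition smooth_to k f := forall i, (i < k)%N -> forall x, I x -> derivable (derive1n i f) x 1.

Lemma eq_near_open f g x : I x -> (forall y, I y -> f y = g y) -> \near x, f x = g x.
Proof.
move=> Ix fg; have : nbhs x I by exact: open_nbhs_nbhs.
by apply: filterS => y /fg.
Qed.

Lemma eq_derive1n f g i : (forall x, I x -> f x = g x) ->
  forall x, I x -> derive1n i f x = derive1n i g x.
Proof.
move=> fg; elim: i => // i ih x Ix.
by rewrite !derive1nS !derive1E; apply: near_eq_derive; exact: eq_near_open.
Qed.

Lemma eq_smooth_to k f g : (forall x, I x -> f x = g x) -> smooth_to k f -> smooth_to k g.
Proof.
move=> fg sf i ik x Ix; apply: near_eq_derivable (sf i ik x Ix).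
by apply: eq_near_open => // y Iy; exact: eq_derive1n.
Qed.

Lemma smooth_toS k f : smooth_to k.+1 f <->
  (forall x, I x -> derivable f x 1) /\ smooth_to k (derive1 f).
Proof.
split=> [sf|[df sf] [|i] ik x Ix].
- split=> [x Ix|i ik x Ix]; first exact: (sf 0%N).
  by rewrite /derive1n -iterSr; exact: (sf i.+1).
- exact: df.
- by rewrite /derive1n iterSr; exact: sf.
Qed.

Lemma smooth_to_le k l f : (k <= l)%N -> smooth_to l f -> smooth_to k f.
Proof. by move=> kl sf i ik; apply: sf; exact: leq_trans kl. Qed.

Lemma is_derive_derive1n k f i x : smooth_to k f -> (i < k)%N -> I x ->
  is_derive x 1 (derive1n i f) (derive1n i.+1 f x).
Proof. by move=> sf ik Ix; apply: DeriveDef; [exact: sf|rewrite derive1nS derive1E]. Qed.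

Lemma leibniz_is_derive k f g n x : smooth_to k f -> smooth_to k g -> (n < k)%N -> I x ->
  is_derive x 1 (fun y => \sum_(l < n.+1) 'C(n, l)%:R * (derive1n l f y * derive1n (n - l) g y))
    (\sum_(l < n.+1) 'C(n, l)%:R * (derive1n l.+1 f x * derive1n (n - l) g x +
            derive1n l f x * derive1n (n - l).+1 g x)).
Proof.
move=> sf sg nk Ix; apply: der_sum => l; apply: trigger_derive.
  eapply der_mul; first exact: der_cst.
  have lk : (l < k)%N by apply: leq_ltn_trans nk; rewrite -ltnS ltn_ord.
  have nlk : (n - l < k)%N by apply: leq_ltn_trans nk; exact: leq_subr.
  by eapply der_mul; [exact: is_derive_derive1n sf lk Ix|exact: is_derive_derive1n sg nlk Ix].
by rewrite mul0r add0r.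
Qed.

Lemma derive1nM k f g : smooth_to k f -> smooth_to k g -> forall n, (n <= k)%N ->
  forall x, I x -> derive1n n (fun y => f y * g y) x =
    \sum_(l < n.+1) 'C(n, l)%:R * (derive1n l f x * derive1n (n - l) g x).
Proof.
move=> sf sg; elim=> [|n ih] nk x Ix.
  by rewrite big_ord1 bin0 mul1r.
rewrite derive1nS derive1E (near_eq_derive _ (eq_near_open Ix (ih (ltnW nk)))).
have [_ ->] := leibniz_is_derive sf sg nk Ix.
exact: (leibniz_step n (fun l => derive1n l f x) (fun l => derive1n l g x)).
Qed.

Lemma smooth_toM k f g : smooth_to k f -> smooth_to k g -> smooth_to k (fun x => f x * g x).
Proof.
move=> sf sg n nk x Ix.
have [d _] := leibniz_is_derive sf sg nk Ix.
apply: near_eq_derivable d; apply: eq_near_open => // y Iy.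
by rewrite (derive1nM sf sg (ltnW nk)).
Qed.

Lemma smooth_to_cst k (c : R) : smooth_to k (fun=> c).
Proof.
elim: k c => [//|k ih] c; apply/smooth_toS; split; first by move=> x _; exact: derivable_cst.
by apply: eq_smooth_to (ih 0) => x _; rewrite derive1E derive_cst.
Qed.

Lemma smooth_toV k f : (forall x, I x -> f x != 0) -> smooth_to k f ->
  smooth_to k (fun x => (f x)^-1).
Proof.
move=> f0; elim: k => [//|k ih] sf; have [df sf'] := (smooth_toS _ _).1 sf.
apply/smooth_toS; split=> [x Ix|]; first exact: derivableV (f0 x Ix) (df x Ix).
have sV := ih (smooth_to_le (leqnSn k) sf).
apply: (@eq_smooth_to _ (fun x => -1 * derive1 f x * ((f x)^-1 * (f x)^-1))); last first.
  have s1 : smooth_to k (fun x => -1 * derive1 f x).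
    by apply: smooth_toM; [exact: smooth_to_cst|exact: sf'].
  have s2 : smooth_to k (fun x => (f x)^-1 * (f x)^-1) by apply: smooth_toM.
  by apply: smooth_toM.
move=> x Ix; rewrite [RHS]derive1E deriveV ?f0//; last exact: df.
rewrite -derive1E -[_ *: _]/(_ * _) -exprVn expr2; ring.
Qed.

Lemma derive1_ln_comp f x : derivable f x 1 -> 0 < f x ->
  is_derive x 1 (fun y => ln (f y)) (derive1 f x * (f x)^-1).
Proof.
move=> df f0; rewrite mulrC; apply: der_ln => //.
by apply: DeriveDef => //; rewrite derive1E.
Qed.

Lemma smooth_to_ln k f : (forall x, I x -> 0 < f x) -> smooth_to k f ->
  smooth_to k (fun x => ln (f x)).
Proof.
move=> f0; case: k => [//|k] sf; have [df sf'] := (smooth_toS _ _).1 sf.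
apply/smooth_toS; split=> [x Ix|]; first by have [] := derive1_ln_comp (df x Ix) (f0 x Ix).
have fn0 x : I x -> f x != 0 by move=> Ix; rewrite gt_eqF// f0.
apply: (@eq_smooth_to _ (fun x => derive1 f x * (f x)^-1)); last first.
  exact: smooth_toM sf' (smooth_toV fn0 (smooth_to_le (leqnSn k) sf)).
by move=> x Ix; rewrite [RHS]derive1E; have [_ ->] := derive1_ln_comp (df x Ix) (f0 x Ix).
Qed.

(** The Leibniz rule applied to [f' = f * (ln f)']. *)
Lemma log_derivative_rec f : (forall x, I x -> 0 < f x) -> (forall k, smooth_to k f) ->
  forall n x, I x -> derive1n n.+1 f x =
    \sum_(l < n.+1) 'C(n, l)%:R * (derive1n l f x * derive1n (n - l).+1 (fun y => ln (f y)) x).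
Proof.
move=> f0 sf n x Ix.
have slog : smooth_to n.+1 (fun y => ln (f y)) by exact: smooth_to_ln.
have [_ slog'] := (smooth_toS _ _).1 slog.
rewrite /derive1n iterSr -/(derive1n n (derive1 f)).
rewrite (@eq_derive1n _ (fun y => f y * derive1 (fun y => ln (f y)) y)) => //; last first.
  move=> y Iy; rewrite [in RHS]derive1E.
  have [_ ->] := derive1_ln_comp (sf 1%N 0%N isT y Iy) (f0 y Iy).
  by rewrite mulrCA divff ?mulr1// gt_eqF// f0.
rewrite (derive1nM (sf n) slog')//; apply: eq_bigr => l _.
by congr (_ * (_ * _)); rewrite /derive1n -iterSr.
Qed.
End SmoothFunctions.

(** * Histories of the process and the maximal inequality *)

Section Histories.
Implicit Types (v : nat -> seq bool) (h : seq (seq bool)) (x : seq bool).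

Lemma eq_external v v' n : (forall i, (i < n)%N -> v i = v' i) -> external v n = external v' n.
Proof.
elim: n => //= n ih vv'; rewrite vv'// ih// => i ni; apply: vv'; exact: ltnW.
Qed.

Definition ext h := external (nth [::] h) (size h).

Definition hist v n : seq (seq bool) := mkseq v n.

Lemma size_hist v n : size (hist v n) = n. Proof. exact: size_mkseq. Qed.

Lemma external_hist v n : external v n = ext (hist v n).
Proof. by rewrite /ext size_hist; apply: eq_external => i ni; rewrite nth_mkseq. Qed.

Lemma histS v n : hist v n.+1 = rcons (hist v n) (v n).
Proof. exact: mkseqS. Qed.

Lemma ext_rcons h x : ext (rcons h x) = [:: rcons x false, rcons x true & rem x (ext h)].
Proof.
rewrite /ext size_rcons /= nth_rcons ltnn eqxx.
rewrite (@eq_external (nth [::] (rcons h x)) (nth [::] h))// => i ih.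
by rewrite nth_rcons ih.
Qed.

Definition valid h := forall i, (i < size h)%N -> nth [::] h i \in external (nth [::] h) i.

Lemma valid_rcons h x : valid (rcons h x) <-> valid h /\ x \in ext h.
Proof.
have extE i : (i <= size h)%N -> external (nth [::] (rcons h x)) i = external (nth [::] h) i.
  by move=> ih; apply: eq_external => j ji; rewrite nth_rcons (leq_trans ji).
split=> [vx|[vh xh] i]; first split.
- move=> i ih; have := vx i; rewrite size_rcons ltnS (ltnW ih) nth_rcons ih extE; last exact: ltnW.
  by move/(_ isT).
- by have := vx (size h); rewrite size_rcons ltnSn nth_rcons ltnn eqxx extE// => /(_ isT).
- rewrite size_rcons ltnS leq_eqVlt => /orP[/eqP ->|ih].
    by rewrite nth_rcons ltnn eqxx extE.
  by rewrite nth_rcons ih extE ?(ltnW ih)//; exact: vh.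
Qed.

Lemma valid_nil : valid [::]. Proof. by []. Qed.

Lemma size_ext h : valid h -> size (ext h) = (size h).+1.
Proof.
elim/last_ind: h => // h x ih /valid_rcons[/ih sh xh].
by rewrite ext_rcons size_rcons/= size_rem// sh.
Qed.

Lemma take_hist v n m : (m <= n)%N -> take m (hist v n) = hist v m.
Proof. by move=> mn; rewrite /hist /mkseq -map_take take_iota (minn_idPl mn). Qed.
End Histories.

Section Expectation.
Variable R : realType.
Implicit Types (U : seq (seq bool) -> R) (h : seq (seq bool)).

(** [expected n U h] is the conditional expectation of [U], given the history
    [h], after [n] further steps. *)
Definition step U h : R := (\sum_(x <- ext h) U (rcons h x)) / (size h).+1%:R.
Definition expected n U h := iter n step U h.

Lemma step_le U U' h : valid h ->
  (forall x, x \in ext h -> U (rcons h x) <= U' (rcons h x)) -> step U h <= step U' h.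
Proof.
move=> vh UU; rewrite /step ler_wpM2r ?invr_ge0//.
by rewrite big_seq [leRHS]big_seq; apply: ler_sum => x; exact: UU.
Qed.

Lemma expected_le n U U' h : valid h ->
  (forall h', valid h' -> size h' = (size h + n)%N -> U h' <= U' h') ->
  expected n U h <= expected n U' h.
Proof.
elim: n U U' h => [|n ih] U U' h vh UU; first by apply: UU; rewrite ?addn0.
rewrite /expected !iterS; apply: step_le => // x xh; apply: ih => [|h' vh' sh'].
  by apply/valid_rcons.
by apply: UU => //; rewrite sh' size_rcons addSnnS.
Qed.

Lemma expectedZ n (c : R) U h : expected n (fun h => c * U h) h = c * expected n U h.
Proof.
elim: n h => // n ih h; rewrite /expected !iterS /step; under eq_bigr do rewrite [iter _ _ _ _]ih.
by rewrite -mulr_sumr mulrA.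
Qed.

Lemma expectedD n U U' h : expected n (fun h => U h + U' h) h = expected n U h + expected n U' h.
Proof.
elim: n h => // n ih h; rewrite /expected !iterS /step; under eq_bigr do rewrite [iter _ _ _ _]ih.
by rewrite big_split/= mulrDl.
Qed.

Lemma stepD U U' h : step (fun h => U h + U' h) h = step U h + step U' h.
Proof. exact: (expectedD 1). Qed.
Lemma stepZ (c : R) U h : step (fun h => c * U h) h = c * step U h.
Proof. exact: (expectedZ 1). Qed.

Lemma step_weighted_sum (I : Type) (s : seq I) (Q : pred I) (c : I -> R)
    (U : I -> seq (seq bool) -> R) h :
  step (fun h => \sum_(i <- s | Q i) c i * U i h) h = \sum_(i <- s | Q i) c i * step (U i) h.
Proof.
rewrite /step exchange_big/= mulr_suml; apply: eq_bigr => i _.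
by rewrite -mulr_sumr mulrA.
Qed.

Lemma expected_sum (I : Type) (s : seq I) (U : I -> seq (seq bool) -> R) n h :
  expected n (fun h => \sum_(i <- s) U i h) h = \sum_(i <- s) expected n (U i) h.
Proof.
elim: n h => // n ih h; rewrite /expected !iterS /step; under eq_bigr do rewrite [iter _ _ _ _]ih.
by rewrite exchange_big/= mulr_suml; apply: eq_bigr.
Qed.

Lemma expectedSr n U h : expected n.+1 U h = expected n (step U) h.
Proof. by rewrite /expected iterSr. Qed.
End Expectation.

Section MaximalInequality.
Context d (T : measurableType d) (R : realType) (P : probability T R).
Variables (V : nat -> T -> seq bool) (hV : is_bst_process P V).
Implicit Types (U : seq (seq bool) -> R) (h : seq (seq bool)).

Definition path w n := hist (fun i => V i w) n.
Definition cyl h : set T := [set w | path w (size h) = h].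

Lemma cylE h : cyl h = [set w | forall i, (i < size h)%N -> V i w = nth [::] h i].
Proof.
apply/seteqP; split=> w /= hw; last first.
  apply: (@eq_from_nth _ [::]); rewrite ?size_hist// => i ih.
  by rewrite nth_mkseq// hw.
by move=> i ih; rewrite -hw nth_mkseq.
Qed.

Lemma measurable_cyl h : measurable (cyl h).
Proof.
elim/last_ind: h => [|h x ih].
  by rewrite (_ : cyl [::] = setT)//; apply/seteqP; split.
rewrite (_ : cyl (rcons h x) = cyl h `&` [set w | V (size h) w = x]).
  by apply: measurableI => //; exact: hV.1.
rewrite /cyl size_rcons; apply/seteqP; split => w /=; rewrite /path histS.
  by move/rcons_inj => [-> ->].
by move=> [-> ->].
Qed.

Lemma P_cyl_rcons h x : P (cyl (rcons h x)) =
  (P (cyl h) * (if x \in ext h then (size h).+1%:R^-1 else 0)%:E)%E.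
Proof.
have := hV.2 (size h) (nth [::] (rcons h x)).
have -> : [set w | forall i, (i < size h)%N -> V i w = nth [::] (rcons h x) i] = cyl h.
  by rewrite cylE; apply/seteqP; split=> w /= hw i ih; have := hw i ih; rewrite nth_rcons ih.
rewrite [cyl (rcons h x)]cylE size_rcons => ->; rewrite nth_rcons ltnn eqxx.
by rewrite (@eq_external (nth [::] (rcons h x)) (nth [::] h))// => i ih; rewrite nth_rcons ih.
Qed.

Lemma P_cyl_valid h : valid h -> P (cyl h) = ((size h)`!%:R^-1)%:E.
Proof.
elim/last_ind: h => [_|h x ih /valid_rcons[vh xh]].
  rewrite (_ : cyl [::] = setT) ?probability_setT ?invr1//.
  by apply/seteqP; split.
by rewrite P_cyl_rcons ih// xh size_rcons factS natrM invfM -EFinM mulrC.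
Qed.

Lemma measurable_path n (Q : seq (seq bool) -> Prop) : measurable [set w | Q (path w n)].
Proof.
have -> : [set w | Q (path w n)] =
    \bigcup_(h : seq (seq bool)) (if `[< size h = n /\ Q h >] then cyl h else set0).
  apply/seteqP; split=> w /=.
    move=> Qw; exists (path w n) => //; rewrite ifT; first by rewrite /cyl/= size_hist.
    by apply/asboolP; rewrite size_hist.
  by move=> [h _]; case: ifPn => // /asboolP[<- Qh] /= ->.
apply: countable_bigcupT_measurable; first exact: countableP.
by move=> h; case: ifP => // _; exact: measurable_cyl.
Qed.

Lemma negligible_bigcup_countable (I : countType) (F : I -> set T) :
  (forall i, P.-negligible (F i)) -> P.-negligible (\bigcup_i F i).
Proof.
move=> nF; apply: (@negligibleS _ _ _ _ (\bigcup_n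
  (if @unpickle I n is Some i then F i else set0))).
  by move=> w [i _ Fw]; exists (pickle i); [|rewrite pickleK].
apply: negligible_bigcup => n; case: (@unpickle I n) => [i|]; first exact: nF.
exact: negligible_set0.
Qed.

Lemma negligible_bad_step h : P.-negligible (cyl h `&` [set w | V (size h) w \notin ext h]).
Proof.
apply: (@negligibleS _ _ _ _ (\bigcup_x
   (if x \in ext h then set0 else cyl (rcons h x)))).
  move=> w [hw xh]; exists (V (size h) w); first by [].
  by rewrite (negbTE xh) /cyl/= size_rcons /path histS -/(path _ _) hw.
apply: negligible_bigcup_countable => x.
case: ifPn => xh; first exact: negligible_set0.
apply/negligibleP; first exact: measurable_cyl.
by have := P_cyl_rcons h x; rewrite (negbTE xh) mule0.
Qed.

Lemma ae_valid : {ae P, forall w, forall n, valid (path w n)}.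
Proof.
apply: (@negligibleS _ _ _ _ (\bigcup_h
   (cyl h `&` [set w | V (size h) w \notin ext h]))).
  move=> w /= /existsNP[n nv].
  have : exists m, V m w \notin ext (path w m).
    elim: n nv => [[]|n ih]; first exact: valid_nil.
    rewrite /path histS => /valid_rcons nv.
    have [vn|/ih//] := pselect (valid (path w n)).
    by exists n; apply/negP => xh; apply: nv.
  move=> [m mw]; exists (path w m); first by [].
  by split; rewrite /cyl /= ?size_hist.
by apply: negligible_bigcup_countable => h; exact: negligible_bad_step.
Qed.

Lemma P_children_le h (E : set T) (c : seq bool -> R) : valid h -> measurable E ->
  (forall x, x \in ext h -> (P (cyl (rcons h x) `&` E) <= (c x)%:E)%E) ->
  (P (cyl h `&` E) <= (\sum_(x <- ext h) c x)%:E)%E.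
Proof.
move=> vh mE cE.
have [B [mB B0 badB]] := negligible_bad_step h.
have mC x : measurable (cyl (rcons h x) `&` E) by apply: measurableI => //; exact: measurable_cyl.
have mU (s : seq (seq bool)) : measurable (\big[setU/set0]_(x <- s) (cyl (rcons h x) `&` E)).
  by elim/big_ind: _ => // *; exact: measurableU.
apply: (@le_trans _ _ (P (B `|` \big[setU/set0]_(x <- ext h) (cyl (rcons h x) `&` E)))).
  apply: le_measure; rewrite ?inE; [|exact: measurableU|].
    by apply: measurableI => //; exact: measurable_cyl.
  move=> w [hw Ew]; have [xh|xh] := boolP (V (size h) w \in ext h); last by left; apply: badB.
  right; rewrite -bigcup_seq; exists (V (size h) w) => //=; split => //.
  by rewrite /cyl/= size_rcons /path histS -/(path _ _) hw.
have h1 := @measureU2 _ _ _ P _ _ mB (mU (ext h)).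
apply: le_trans h1 _; rewrite [X in (X + _)%E]B0 add0e.
have : {subset ext h <= ext h} by [].
elim: {1 3 4}(ext h) => [|x s ih] sh; first by rewrite !big_nil measure0.
rewrite !big_cons EFinD; have h2 := @measureU2 _ _ _ P _ _ (mC x) (mU s).
apply: le_trans h2 _.
apply: leeD; first by apply/cE/sh/mem_head.
by apply: ih => y ys; apply: sh; rewrite inE ys orbT.
Qed.

Section Supermartingale.
Variables (U : seq (seq bool) -> R) (N : nat).
Hypothesis U0 : forall h, 0 <= U h.
Hypothesis Usuper : forall h, valid h -> (N <= size h)%N -> step U h <= U h.

Let hit a b := [set w | exists2 j, (a <= j <= b)%N & 1 <= U (path w j)].

Let measurable_hit a b : measurable (hit a b).
Proof.
have -> : hit a b = \bigcup_(j in [set j | (a <= j <= b)%N]) [set w | 1 <= U (path w j)].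
  by apply/seteqP; split=> w [j ? ?]; exists j.
by apply: bigcup_measurable => j _; exact: (@measurable_path j (fun h => 1 <= U h)).
Qed.

Let step_fact h : (\sum_(x <- ext h) U (rcons h x) / (size (rcons h x))`!%:R) =
  step U h / (size h)`!%:R.
Proof.
rewrite /step !mulr_suml; apply: eq_bigr => x _.
by rewrite size_rcons factS natrM invfM mulrA.
Qed.

(** Conditionally on a history at which [U] is less than 1, the event is
    distributed over the possible next histories, on average of which [U] does
    not increase. *)
Let maximal_finite M h : valid h -> (N <= size h)%N ->
  (P (cyl h `&` hit (size h) (size h + M)) <= (U h / (size h)`!%:R)%:E)%E.
Proof.
elim: M h => [|M ih] h vh Nh.
all: have [U1|U1] := leP 1 (U h).
1,3: apply: (@le_trans _ _ (P (cyl h)));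
    [by apply: le_measure; rewrite ?inE; [apply: measurableI; [exact: measurable_cyl|exact: measurable_hit]|exact: measurable_cyl|]
    |by rewrite P_cyl_valid// lee_fin ler_peMl].
  rewrite (_ : _ `&` _ = set0) ?measure0 ?lee_fin ?divr_ge0//.
  apply/seteqP; split=> w //= -[hw [j]]; rewrite addn0 -eqn_leq => /eqP <-.
  by rewrite hw leNgt U1.
apply: (@le_trans _ _ (P (cyl h `&` hit (size h).+1 ((size h).+1 + M)))).
  apply: le_measure; rewrite ?inE; try by apply: measurableI; [exact: measurable_cyl|exact: measurable_hit].
  move=> w [hw [j /andP[hj jM] Uj]]; split => //; exists j => //.
  rewrite addSnnS jM andbT ltn_neqAle hj andbT; apply: contraTneq Uj => <-.
  by rewrite hw leNgt U1.
apply: (@le_trans _ _ (step U h / (size h)`!%:R)%:E); last first.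
  by rewrite lee_fin ler_wpM2r ?invr_ge0// Usuper.
rewrite -step_fact; apply: P_children_le => // x xh.
have := ih (rcons h x); rewrite size_rcons; apply; first by apply/valid_rcons.
exact: leqW.
Qed.

Let hits a := [set w | exists2 j, (a <= j)%N & 1 <= U (path w j)].

Let measurable_hits a : measurable (hits a).
Proof.
have -> : hits a = \bigcup_(j in [set j | (a <= j)%N]) [set w | 1 <= U (path w j)].
  by apply/seteqP; split=> w [j ? ?]; exists j.
by apply: bigcup_measurable => j _; exact: (@measurable_path j (fun h => 1 <= U h)).
Qed.

(** Continuity of the measure along the increasing horizons. *)
Let maximal_cyl h : valid h -> (N <= size h)%N ->
  (P (cyl h `&` hits (size h)) <= (U h / (size h)`!%:R)%:E)%E.
Proof.
move=> vh Nh.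
have mF M : measurable (cyl h `&` hit (size h) (size h + M)).
  by apply: measurableI; [exact: measurable_cyl|exact: measurable_hit].
have FE : cyl h `&` hits (size h) = \bigcup_M (cyl h `&` hit (size h) (size h + M)).
  apply/seteqP; split=> w.
    move=> [hw [j hj Uj]]; exists j => //; split => //; exists j => //.
    by rewrite hj leq_addl.
  by move=> [M _ [hw [j /andP[hj _] Uj]]]; split => //; exists j.
have nd : nondecreasing_seq (fun M => cyl h `&` hit (size h) (size h + M)).
  move=> M M' MM; apply/subsetPset => w [hw [j /andP[hj jM] Uj]]; split => //; exists j => //.
  by rewrite hj (leq_trans jM)// leq_add2l.
have mU : measurable (\bigcup_M (cyl h `&` hit (size h) (size h + M))).
  by apply: bigcupT_measurable.
have cvgP := @nondecreasing_cvg_mu _ _ _ P _ mF mU nd.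
rewrite FE -(cvg_lim _ cvgP)//; apply: lime_le; first by apply/cvg_ex; eexists; exact: cvgP.
by apply: nearW => M; exact: maximal_finite.
Qed.

Lemma maximal_expected n h : valid h -> (N <= size h + n)%N ->
  (P (cyl h `&` hits (size h + n)) <= (expected n U h / (size h)`!%:R)%:E)%E.
Proof.
elim: n h => [|n ih] h vh Nh; first by rewrite addn0 in Nh *; exact: maximal_cyl.
rewrite /expected iterS /step -mulrA -invfM -natrM -factS mulr_suml.
apply: P_children_le => // x xh.
have := ih (rcons h x); rewrite size_rcons addSnnS; apply => //.
by apply/valid_rcons.
Qed.

Lemma maximal_inequality :
  (P [set w | exists2 j, (N <= j)%N & (1 <= U (path w j))%R] <= (expected N U [::])%:E)%E.
Proof.
have := @maximal_expected N [::] valid_nil (leqnn N).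
rewrite divr1 (_ : cyl [::] = setT) ?setTI//; last by apply/seteqP; split.
Qed.
End Supermartingale.

Lemma maximal_borel_cantelli (U : nat -> seq (seq bool) -> R) (N : nat -> nat) (C : R) :
  (forall m h, 0 <= U m h) ->
  (forall m h, valid h -> (N m <= size h)%N -> step (U m) h <= U m h) ->
  (forall m, expected (N m) (U m) [::] <= C / 2 ^+ m) ->
  {ae P, forall w, exists m0, forall m, (m0 <= m)%N -> forall j, (N m <= j)%N ->
    U m (path w j) < 1}.
Proof.
move=> U0 Us UC.
pose F m := [set w | exists2 j, (N m <= j)%N & 1 <= U m (path w j)].
have mF m : measurable (F m).
  have -> : F m = \bigcup_(j in [set j | (N m <= j)%N]) [set w | 1 <= U m (path w j)].
    by apply/seteqP; split=> w [j ? ?]; exists j.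
  by apply: bigcup_measurable => j _; exact: (@measurable_path j (fun h => 1 <= U m h)).
have PF m : (P (F m) <= (C / 2 ^+ m)%:E)%E.
  by apply: le_trans (maximal_inequality (U0 m) (Us m)) _; rewrite lee_fin.
have lim0 : P (lim_sup_set F) = 0%E.
  apply: lim_sup_set_cvg0 => //.
  apply: (@le_lt_trans _ _ (\sum_(m <oo) (C * 2 / (2 ^ m.+1)%:R)%:E)%E).
    apply: lee_nneseries => // m _ /=; apply: le_trans (PF m) _.
    by rewrite lee_fin natrX exprS invfM; lra.
  apply: le_lt_trans (epsilon_trick0 _ _) _; last exact: ltry.
  rewrite mulr_ge0//; have := UC 0%N; rewrite expr0 divr1; apply: le_trans.
  have E0 : forall n h, 0 <= expected n (U 0%N) h.
    elim=> [|n ih] h; first exact: U0.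
    by rewrite /expected iterS /step divr_ge0// sumr_ge0// => x _; exact: ih.
  exact: E0.
apply: (@negligibleS _ _ _ _ (lim_sup_set F)); last first.
  by apply/negligibleP => //; apply: bigcap_measurable => // k _; exact: bigcup_measurable.
move=> w /= /forallNP hw m0 _.
have /existsNP[m] := hw m0; move=> /not_implyP[m0m] /existsNP[j] /not_implyP[Nj].
by move=> /negP; rewrite -leNgt => Uj; exists m => //; exists j.
Qed.
End MaximalInequality.

(** * One step of the process in p-th mean *)

Section PowerInequalities.
Variable R : realType.
Implicit Types (x y s p : R) (a b z : R[i]).

Lemma bernoulli_concave x s : 0 <= s <= 1 -> 0 <= x -> x `^ s <= 1 + s * (x - 1).
Proof.
move=> /andP[s0 s1]; rewrite le_eqVlt => /predU1P[<-|x0].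
  by rewrite /powR eqxx; have [->|] := eqVneq s 0; rewrite /=; lra.
have xE : x = expR (ln x) by rewrite lnK.
set u := ln x in xE.
have -> : x `^ s = expR (s * u) by rewrite /powR gt_eqF.
rewrite -[leLHS]mul1r -ler_pdivlMr ?expR_gt0// -expRN.
have -> : (1 + s * (x - 1)) * expR (- (s * u)) =
    (1 - s) * expR (- (s * u)) + s * expR ((1 - s) * u).
  have -> : expR ((1 - s) * u) = expR u * expR (- (s * u)).
    by rewrite -expRD; congr expR; ring.
  by rewrite -xE; ring.
have h1 := ler_wpM2l (_ : 0 <= 1 - s) (expR_ge1Dx (- (s * u))).
have h2 := ler_wpM2l s0 (expR_ge1Dx ((1 - s) * u)).
have {}h1 : (1 - s) * (1 + - (s * u)) <= (1 - s) * expR (- (s * u)) by apply: h1; lra.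
nra.
Qed.

Lemma bernoulli_convex x p : 1 <= p -> 0 <= x -> 1 + p * (x - 1) <= x `^ p.
Proof.
move=> p1 x0; have p0 : 0 < p by exact: lt_le_trans p1.
have h : (x `^ p) `^ p^-1 = x by rewrite -powRrM divff ?powRr1 ?gt_eqF.
have p01 : 0 <= p^-1 <= 1 by rewrite invr_ge0 (ltW p0) invf_le1.
have := bernoulli_concave p01 (powR_ge0 x p); rewrite h.
move/(ler_wpM2l (ltW p0)); rewrite mulrDr mulrA divff ?gt_eqF//; lra.
Qed.

Definition dotc a b : R := Re a * Re b + Im a * Im b.

Lemma norm_dotc a b : `|dotc a b| <= normc a * normc b.
Proof.
rewrite -(ler_sqr (normr_ge0 _)) ?nnegrE ?mulr_ge0 ?nc_ge0//.
rewrite real_normK ?num_real// exprMn !nc_sqr /dotc.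
have := sqr_ge0 (Re a * Im b - Im a * Re b); nra.
Qed.

Lemma dotc_sum a (I : Type) (r : seq I) (f : I -> R[i]) :
  dotc a (\sum_(i <- r) f i) = \sum_(i <- r) dotc a (f i).
Proof. by rewrite /dotc Re_sum Im_sum !mulr_sumr -big_split. Qed.

Lemma nc_sqrD a b : normc (a + b) ^+ 2 = normc a ^+ 2 + 2 * dotc a b + normc b ^+ 2.
Proof. by rewrite !nc_sqr ReD ImD /dotc; ring. Qed.

(** Concavity of the power [p / 2], applied to the expansion of the square of
    [normc (a + b)], gives this when [b] is the smaller one; otherwise the last term
    dominates. The term linear in [b] vanishes in the mean when [b] is centred. *)
Lemma nc_powRD a b p : 1 <= p <= 2 ->
  normc (a + b) `^ p <=
    normc a `^ p + p * normc a `^ (p - 2) * dotc a b + 6 * normc b `^ p.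
Proof.
move=> /andP[p1 p2]; have p0 : 0 < p by exact: lt_le_trans p1.
have [->|a0] := eqVneq a 0.
  rewrite add0r normc0 powR0 ?gt_eqF// /dotc/= !mul0r addr0 mulr0 !add0r.
  by rewrite ler_peMl ?powR_ge0// ler1n.
set x := normc a; set y := normc b.
have x0 : 0 < x.
  by rewrite lt_neqAle nc_ge0 andbT eq_sym; apply: contra a0 => /eqP/eq0_normc ->.
have y0 : 0 <= y by exact: nc_ge0.
set t := (2 * dotc a b + y ^+ 2) / x ^+ 2.
have x20 : x ^+ 2 != 0 by rewrite expf_neq0// gt_eqF.
have NE : normc (a + b) ^+ 2 = x ^+ 2 * (1 + t).
  by rewrite nc_sqrD -/x -/y /t [RHS]mulrDr mulr1 [x ^+ 2 * (_ / _)]mulrC divfK//; ring.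
have t1 : 0 <= 1 + t.
  by rewrite -(@pmulr_rge0 _ (x ^+ 2)) -?NE ?sqr_ge0// exprn_gt0.
have powhalf (c : R) : 0 <= c -> c `^ p = (c ^+ 2) `^ (p / 2).
  by move=> c0; rewrite -powR_mulrn// -powRrM; congr (_ `^ _); field.
have key : normc (a + b) `^ p <= x `^ p + p * x `^ (p - 2) * dotc a b + p / 2 * x `^ (p - 2) * y ^+ 2.
  rewrite powhalf ?nc_ge0// NE powRM ?sqr_ge0// -powhalf ?(ltW x0)//.
  have h := @bernoulli_concave (1 + t) (p / 2) _ t1.
  apply: le_trans (ler_wpM2l (powR_ge0 _ _) (h _)) _.
    by rewrite divr_ge0 ?(ltW p0)//= ler_pdivrMr// mul1r.
  have -> : x `^ (p - 2) = x `^ p / x ^+ 2.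
    by rewrite -powR_mulrn ?(ltW x0)// powRB// (gt_eqF x0) implybT.
  by rewrite /t le_eqVlt; apply/orP; left; apply/eqP; field; rewrite gt_eqF.
have [yx|xy] := leP y x.
  apply: le_trans key _; rewrite lerD2l.
  have [->|yn0] := eqVneq y 0; first by rewrite expr0n mulr0 mulr_ge0// powR_ge0.
  have yp : 0 < y by rewrite lt_neqAle eq_sym yn0.
  have h : x `^ (p - 2) * y ^+ 2 <= y `^ p.
    have -> : y `^ p = y `^ (p - 2) * y ^+ 2.
      by rewrite -powR_mulrn// -powRD ?subrK// yn0 implybT.
    rewrite ler_wpM2r ?sqr_ge0//.
    have -> : p - 2 = - (2 - p) by ring.
    by rewrite !powRN lef_pV2 ?posrE ?powR_gt0// ge0_ler_powR// ?nnegrE ?(ltW x0)//; lra.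
  have := powR_ge0 y p; have := powR_ge0 x (p - 2); rewrite -mulrA; nra.
have Ny : normc (a + b) `^ p <= 4 * y `^ p.
  have -> : 4 * y `^ p = (2 * y) `^ 2 / y `^ 2 * y `^ p.
    rewrite powRM// mulfK ?gt_eqF ?powR_gt0 ?(lt_trans x0)//.
    by rewrite powR_mulrn//; ring.
  apply: (@le_trans _ _ ((2 * y) `^ p)).
    rewrite ge0_ler_powR// ?nnegrE ?nc_ge0 ?mulr_ge0 ?(ltW p0)//.
    apply: le_trans (le_normcD _ _) _; rewrite -/x -/y; lra.
  rewrite !powRM// mulfK ?gt_eqF ?powR_gt0 ?(lt_trans x0)//.
  by rewrite ler_wpM2r ?powR_ge0// ler_powR// ler1n.
have h : `|p * x `^ (p - 2) * dotc a b| <= 2 * y `^ p.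
  rewrite !normrM (ger0_norm (powR_ge0 _ _)) (gtr0_norm p0) -mulrA ler_pM ?mulr_ge0 ?powR_ge0 ?(ltW p0)//.
  apply: le_trans (ler_wpM2l (powR_ge0 _ _) (norm_dotc a b)) _; rewrite -/x -/y mulrA.
  have -> : x `^ (p - 2) * x = x `^ (p - 1).
    rewrite -{2}(powRr1 (ltW x0)) -powRD; last by rewrite (gt_eqF x0) implybT.
    by congr (_ `^ _); ring.
  rewrite [leRHS](_ : _ = y `^ (p - 1) * y); last first.
    rewrite -{3}(powRr1 y0) -powRD; last by rewrite (gt_eqF (lt_trans x0 xy)) implybT.
    by congr (_ `^ _); ring.
  by rewrite ler_wpM2r// ge0_ler_powR// ?nnegrE ?(ltW x0)// ?(ltW xy)//; lra.
move: h; rewrite ler_norml => /andP[h _].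
have := powR_ge0 x p; have := powR_ge0 y p; lra.
Qed.

Lemma power_mean (I : Type) (r : seq I) (f : I -> R) p : 1 <= p -> (0 < size r)%N ->
  (forall i, 0 <= f i) ->
  ((\sum_(i <- r) f i) / (size r)%:R) `^ p <= (\sum_(i <- r) f i `^ p) / (size r)%:R.
Proof.
move=> p1 r0 f0; have p0 : 0 < p by exact: lt_le_trans p1.
set m := (size r)%:R; have m0 : 0 < m by rewrite ltr0n.
set mu := _ / m.
have mu0 : 0 <= mu by rewrite divr_ge0 ?(ltW m0)// sumr_ge0.
have [muE|mun0] := eqVneq mu 0.
  by rewrite muE powR0 ?gt_eqF// divr_ge0 ?(ltW m0)// sumr_ge0// => i _; exact: powR_ge0.
have mup : 0 < mu by rewrite lt_neqAle eq_sym mun0.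
rewrite ler_pdivlMr//.
have h i : mu `^ p * (1 + p * (f i / mu - 1)) <= f i `^ p.
  apply: le_trans (ler_wpM2l (powR_ge0 _ _) (bernoulli_convex p1 (divr_ge0 (f0 i) mu0))) _.
  by rewrite -powRM ?mu0 ?(divr_ge0 (f0 i) mu0)// mulrC divfK.
apply: le_trans (_ : \sum_(i <- r) mu `^ p * (1 + p * (f i / mu - 1)) <= _); last exact: ler_sum.
rewrite -mulr_sumr ler_wpM2l ?powR_ge0//.
rewrite big_split/= -mulr_sumr sumrB/= -mulr_suml.
have -> : \sum_(i <- r) (1 : R) = m by rewrite big_const_seq count_predT iter_addr_0.
have -> : \sum_(i <- r) f i = mu * m by rewrite /mu divfK ?gt_eqF.
by rewrite mulrAC divff// mul1r subrr mulr0 addr0.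
Qed.

Lemma powRD_le x y p : 1 <= p <= 2 -> 0 <= x -> 0 <= y -> (x + y) `^ p <= 4 * (x `^ p + y `^ p).
Proof.
move=> /andP[p1 p2] x0 y0; have p0 : 0 <= p by exact: le_trans p1.
wlog xy : x y x0 y0 / x <= y.
  move=> h; have [|/ltW] := leP x y; first exact: h.
  by move=> yx; rewrite addrC [X in 4 * X]addrC h.
apply: (@le_trans _ _ ((2 * y) `^ p)).
  by rewrite ge0_ler_powR// ?nnegrE ?addr_ge0 ?mulr_ge0//; lra.
rewrite powRM// ler_pM ?powR_ge0//; last by rewrite lerDr powR_ge0.
apply: le_trans (ler_powR _ p2) _; first by rewrite ler1n.
by rewrite powR_mulrn// -natrX ler_nat.
Qed.
End PowerInequalities.

Section OneStep.
Variable R : realType.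
Implicit Types (z : R[i]) (t p : R) (h : seq (seq bool)) (x : seq bool).

Lemma Sn_rcons h x z : x \in ext h ->
  Sn (ext (rcons h x)) z = Sn (ext h) z + alpha z * cexp (z * (size x)%:R).
Proof.
move=> xh; rewrite ext_rcons /Sn !big_cons !size_rcons.
rewrite [in RHS](perm_big _ (perm_to_rem xh)) big_cons/=.
by rewrite -natr1 mulrDr mulr1 cexpD /alpha; ring.
Qed.

Lemma rSn_rcons h x t : x \in ext h ->
  rSn (ext (rcons h x)) t = rSn (ext h) t + (2 * expR t - 1) * expR (t * (size x)%:R).
Proof.
move=> xh; rewrite ext_rcons /rSn !big_cons !size_rcons.
rewrite [in RHS](perm_big _ (perm_to_rem xh)) big_cons/=.
by rewrite -natr1 mulrDr mulr1 expRD; ring.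
Qed.

Lemma step_rSn h t : valid h ->
  step (fun h => rSn (ext h) t) h = (1 + (2 * expR t - 1) / (size h).+1%:R) * rSn (ext h) t.
Proof.
move=> vh; rewrite /step big_seq; under eq_bigr => x xh do rewrite rSn_rcons//.
rewrite -big_seq big_split/= -mulr_sumr.
rewrite big_const_seq count_predT iter_addr_0 size_ext// -mulr_natr.
rewrite -[\sum_(i <- _) _]/(rSn (ext h) t); field.
by rewrite addrC natr1 pnatr_eq0.
Qed.

(** The increment of [Sn] splits into its conditional mean and a centred part,
    and the p-th moment of the latter is controlled by [rSn] at [p * Re z]. *)
Lemma one_step_moment h z p (y : R[i]) : valid h -> 1 <= p <= 2 ->
  (\sum_(x <- ext h) normc (y + (alpha z * cexp (z * (size x)%:R) -
     alpha z * Sn (ext h) z / (size h).+1%:R)) `^ p) / (size h).+1%:R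
  <= normc y `^ p + 48 * normc (alpha z) `^ p * (rSn (ext h) (p * Re z) / (size h).+1%:R).
Proof.
move=> vh p12; pose m : R[i] := (size h).+1%:R; have /andP[p1 p2] := p12.
have p0 : 0 < p by exact: lt_le_trans p1.
have m0 : 0 < (size h).+1%:R :> R by rewrite ltr0n.
have mn0 : m != 0 by rewrite pnatr_eq0.
set b := fun x => alpha z * cexp (z * (size x)%:R) - alpha z * Sn (ext h) z / (size h).+1%:R.
have sz : \sum_(x <- ext h) (1 : R) = (size h).+1%:R.
  by rewrite big_const_seq count_predT iter_addr_0 size_ext.
have b0 : \sum_(x <- ext h) b x = 0.
  rewrite sumrB -mulr_sumr -/(Sn (ext h) z).
  have sc (c : R[i]) : \sum_(x <- ext h) c = c * m.
    by rewrite big_const_seq count_predT iter_addr_0 size_ext// mulr_natr.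
  by rewrite sc divfK// subrr.
rewrite ler_pdivrMr//.
apply: (@le_trans _ _ (\sum_(x <- ext h) (normc y `^ p + p * normc y `^ (p - 2) * dotc y (b x) + 6 * normc (b x) `^ p))).
  by apply: ler_sum => x _; exact: nc_powRD.
rewrite !big_split/= -mulr_sumr -dotc_sum b0 /dotc !mulr0 addr0 mulr0 addr0.
have -> : \sum_(x <- ext h) normc y `^ p = normc y `^ p * (size h).+1%:R.
  by rewrite -sz mulr_sumr; apply: eq_bigr => x _; rewrite mulr1.
rewrite mulrDl lerD2l -mulr_sumr -!mulrA mulVf ?gt_eqF// mulr1.
have nb x : normc (b x) `^ p <= 4 * (normc (alpha z) `^ p * expR (p * Re z * (size x)%:R) +
    normc (alpha z) `^ p * (rSn (ext h) (p * Re z) / (size h).+1%:R)).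
  apply: (@le_trans _ _ ((normc (alpha z) * expR (Re z * (size x)%:R) +
      normc (alpha z) * (rSn (ext h) (Re z) / (size h).+1%:R)) `^ p)).
    rewrite ge0_ler_powR// ?nnegrE ?nc_ge0 ?(ltW p0)//.
      by rewrite addr_ge0 ?mulr_ge0 ?nc_ge0 ?expR_ge0 ?divr_ge0 ?rSn_ge0.
    apply: le_trans (ler_ncB _ _) _; rewrite lerD//.
      by rewrite normcM nc_cexp Re_mul_nat.
    rewrite -mulrA !normcM normcV nc_nat ler_wpM2l ?nc_ge0// ler_wpM2r ?invr_ge0 ?(ltW m0)//.
    exact: nc_Sn_le.
  apply: le_trans (powRD_le p12 _ _) _.
  - by rewrite mulr_ge0 ?nc_ge0 ?expR_ge0.
  - by rewrite mulr_ge0 ?nc_ge0// divr_ge0 ?rSn_ge0.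
  rewrite ler_pM2l// !powRM ?nc_ge0 ?expR_ge0 ?divr_ge0 ?rSn_ge0//.
  have eE (u : R) : expR u `^ p = expR (p * u) by rewrite /powR gt_eqF ?expR_gt0// expRK.
  rewrite eE mulrA lerD2l ler_wpM2l ?powR_ge0//.
  rewrite -powRM ?rSn_ge0 ?invr_ge0 ?(ltW m0)//.
  have := @power_mean _ _ (ext h) (fun x => expR (Re z * (size x)%:R)) p p1.
  rewrite size_ext// => /(_ isT (fun x => expR_ge0 _)) /le_trans; apply.
  rewrite ler_wpM2r ?invr_ge0 ?(ltW m0)//; apply: ler_sum => y' _.
  by rewrite eE mulrA.
apply: (@le_trans _ _ (6 * \sum_(x <- ext h) (4 * (normc (alpha z) `^ p * expR (p * Re z * (size x)%:R) +
    normc (alpha z) `^ p * (rSn (ext h) (p * Re z) / (size h).+1%:R))))).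
  by rewrite ler_pM2l//; apply: ler_sum => x _; exact: nb.
rewrite -mulr_sumr big_split/= -mulr_sumr -/(rSn (ext h) (p * Re z)).
rewrite [X in _ + X](_ : _ = normc (alpha z) `^ p * (rSn (ext h) (p * Re z) / (size h).+1%:R) * (size h).+1%:R); last first.
  by rewrite -sz mulr_sumr; apply: eq_bigr => x _; rewrite mulr1.
rewrite -mulrA divfK ?gt_eqF//; lra.
Qed.
End OneStep.

(** * Supermartingales controlling the profile *)

Lemma sumr_const_seq (R : pzRingType) (I : Type) (s : seq I) (c : R) :
  \sum_(i <- s) c = (size s)%:R * c.
Proof. by rewrite big_const_seq count_predT iter_addr_0 mulr_natl. Qed.

Section Supermartingales.
Variable R : realType.
Implicit Types (z : R[i]) (t p : R) (h : seq (seq bool)) (x : seq bool).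

(** The p-th power of [normc Y] grows in mean by a power of the modulus of its multiplier
    and by the noise [rSn] at [p * Re z]. The noise has an explicit growth of its own, so
    adding a multiple [A] of it restores the supermartingale property after division by
    [K]. The two uses are [Y := Sn] and the deviation of [Sn] from its conditional
    mean. *)
Lemma moment_supermartingale z p (A : R) (K : nat -> R) (Y : seq (seq bool) -> R[i]) N :
  1 <= p <= 2 -> 0 <= A -> (forall n, (N <= n)%N -> 0 < K n) ->
  (forall h x, valid h -> (N <= size h)%N -> x \in ext h -> Y (rcons h x) =
     (1 + alpha z / (size h).+1%:R) * Y h +
     (alpha z * cexp (z * (size x)%:R) - alpha z * Sn (ext h) z / (size h).+1%:R)) ->
  (forall n, (N <= n)%N ->
     normc (1 + alpha z / n.+1%:R) `^ p * K n <= K n.+1 /\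
     (48 * normc (alpha z) `^ p + A * (2 * expR (p * Re z) - 1)) / n.+1%:R * K n + A * K n <= A * K n.+1) ->
  forall h, valid h -> (N <= size h)%N ->
    step (fun h => (normc (Y h) `^ p + A * rSn (ext h) (p * Re z)) / K (size h)) h <=
    (normc (Y h) `^ p + A * rSn (ext h) (p * Re z)) / K (size h).
Proof.
move=> p12 A0 K0 YE KE h vh Nh; have /andP[p1 _] := p12.
have p0 : 0 <= p by exact: le_trans p1.
set n := size h; have [K1 K2] := KE n Nh.
have Kn := K0 n Nh; have Kn1 := K0 n.+1 (leqW Nh).
set S := rSn (ext h) (p * Re z); have S0 : 0 <= S by exact: rSn_ge0.
set y := normc (Y h) `^ p; have y0 : 0 <= y by exact: powR_ge0.
have E1 : step (fun h => normc (Y h) `^ p) h <=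
    normc (1 + alpha z / n.+1%:R) `^ p * y + 48 * normc (alpha z) `^ p * (S / n.+1%:R).
  rewrite /y -powRM ?nc_ge0// -normcM.
  apply: le_trans _ (one_step_moment _ _ vh p12).
  by rewrite /step big_seq [in leRHS]big_seq; under eq_bigr => x xh do rewrite YE//.
have E2 : step (fun h => A * rSn (ext h) (p * Re z)) h =
    A * ((1 + (2 * expR (p * Re z) - 1) / n.+1%:R) * S).
  by rewrite stepZ step_rSn.
have -> : step (fun h => (normc (Y h) `^ p + A * rSn (ext h) (p * Re z)) / K (size h)) h =
    (step (fun h => normc (Y h) `^ p) h + step (fun h => A * rSn (ext h) (p * Re z)) h) / K n.+1.
  rewrite -stepD /step mulrAC; congr (_ / _); rewrite mulr_suml; apply: eq_bigr => x _.
  by rewrite size_rcons.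
rewrite ler_pdivrMr// mulrAC ler_pdivlMr//.
have m0 : 0 < n.+1%:R :> R by rewrite ltr0n.
set m := n.+1%:R in m0 E1 E2 K1 K2 *.
rewrite E2.
apply: le_trans (ler_wpM2r (ltW Kn) (lerD E1 (lexx _))) _.
have h1 := ler_wpM2r y0 K1; have h2 := ler_wpM2r S0 K2.
move: h1 h2; set q := normc _ `^ p; set c := 48 * _ `^ p; set a := 2 * _ - 1.
set mi := m^-1; nra.
Qed.

Lemma expected_rSn n t :
  expected n (fun h => rSn (ext h) t) [::] = \prod_(j < n) (1 + (2 * expR t - 1) / j.+1%:R).
Proof.
elim: n => [|n ih].
  by rewrite big_ord0 /= /ext/= /rSn big_seq1 mulr0 expR0.
rewrite expectedSr [RHS]big_ord_recr/= -ih [RHS]mulrC -expectedZ.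
by apply/eqP; rewrite eq_le; apply/andP; split; apply: expected_le valid_nil _ => h vh sh;
  rewrite step_rSn// sh.
Qed.

Definition harmonic_sum n : R := \sum_(j < n) j.+1%:R^-1.

Lemma ln_succ_bounds n : (0 < n)%N ->
  n.+1%:R^-1 <= ln n.+1%:R - ln n%:R :> R /\ ln n.+1%:R - ln n%:R <= n%:R^-1 :> R.
Proof.
move=> n0; have nR : 0 < n%:R :> R by rewrite ltr0n.
have n1R : 0 < n.+1%:R :> R by rewrite ltr0n.
have e1 : n.+1%:R = n%:R + 1 :> R by rewrite natr1.
split.
  have -> : ln n.+1%:R - ln n%:R = - ln (1 + - n.+1%:R^-1) :> R.
    have -> : 1 + - n.+1%:R^-1 = n%:R / n.+1%:R :> R.
      by rewrite e1; field; rewrite -e1 gt_eqF.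
    by rewrite ln_div ?posrE// opprB.
  rewrite -[leLHS]opprK lerN2 le_ln1Dx// ltrN2 invf_lt1// ltr1n ltnS.
  by [].
have -> : ln n.+1%:R - ln n%:R = ln (1 + n%:R^-1) :> R.
  rewrite -ln_div ?posrE//; congr ln; rewrite e1; field.
  by rewrite gt_eqF.
by rewrite le_ln1Dx// (lt_trans (ltrN10 _))// invr_gt0.
Qed.

Lemma harmonic_sum_ge n : ln n.+1%:R <= harmonic_sum n.
Proof.
rewrite /harmonic_sum; elim: n => [|n ih]; first by rewrite big_ord0 ln1.
have [_ h] := @ln_succ_bounds n.+1 isT.
by rewrite big_ord_recr/= -(subrK (ln n.+1%:R) (ln n.+2%:R)) addrC lerD.
Qed.

Lemma harmonic_sum_le n : (0 < n)%N -> harmonic_sum n <= 1 + ln n%:R.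
Proof.
case: n => // n _; rewrite /harmonic_sum.
elim: n => [|n ih]; first by rewrite big_ord1 invr1 ln1 addr0.
have [h _] := @ln_succ_bounds n.+1 isT.
rewrite big_ord_recr/=; apply: le_trans (lerD ih h) _.
by rewrite -addrA lerD2l addrC subrK.
Qed.

Lemma harmonic_sum_dist n : (0 < n)%N -> `|harmonic_sum n - ln n%:R| <= 1.
Proof.
move=> n0; rewrite ler_norml; apply/andP; split; last by rewrite lerBlDr harmonic_sum_le.
apply: (@le_trans _ _ 0) => //.
by rewrite subr_ge0 (le_trans _ (harmonic_sum_ge n))// ler_ln ?posrE ?ltr0n// ler_nat.
Qed.

Lemma prod_growth (a : R) n0 n : (n0 <= n)%N -> (0 < n)%N -> - n0.+1%:R <= a ->
  \prod_(n0 <= j < n) (1 + a / j.+1%:R) <=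
    expR (`|a| * (1 + harmonic_sum n0)) * expR (a * ln n%:R).
Proof.
move=> n0n ngt0 an0.
apply: (@le_trans _ _ (expR (a * (harmonic_sum n - harmonic_sum n0)))).
  have -> : harmonic_sum n - harmonic_sum n0 = \sum_(n0 <= j < n) j.+1%:R^-1.
    rewrite /harmonic_sum -!(big_mkord xpredT (fun j => j.+1%:R^-1)).
    by rewrite (big_cat_nat (n := n0))//= addrAC subrr add0r.
  rewrite mulr_sumr expR_sum big_nat [leRHS]big_nat; apply: ler_prod => j /andP[n0j _].
  rewrite expR_ge1Dx andbT.
  have jR : 0 < j.+1%:R :> R by rewrite ltr0n.
  rewrite -lerBlDl sub0r ler_pdivlMr// mulN1r (le_trans _ an0)// lerN2 ler_nat.
  by rewrite ltnS.
rewrite -expRD ler_expR.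
have H0 : 0 <= harmonic_sum n0 by apply: sumr_ge0.
have h1 : a * (harmonic_sum n - ln n%:R) <= `|a|.
  rewrite (le_trans (ler_norm _))// normrM ler_piMr//; exact: harmonic_sum_dist.
have h2 : - (a * harmonic_sum n0) <= `|a| * harmonic_sum n0.
  by rewrite -mulNr ler_wpM2r// -normrN ler_norm.
by rewrite mulrBr in h1; rewrite mulrBr [`|a| * _]mulrDr mulr1; lra.
Qed.

Lemma expected_rSn_le n t : (0 < n)%N -> expected n (fun h => rSn (ext h) t) [::] <=
  expR (2 * expR t + 1) * expR ((2 * expR t - 1) * ln n%:R).
Proof.
move=> n0; rewrite expected_rSn.
have a1 : -1 <= 2 * expR t - 1 by rewrite lerBrDl subrr mulr_ge0 ?expR_ge0.
have := @prod_growth (2 * expR t - 1) 0 n isT n0 a1; rewrite big_mkord => /le_trans; apply.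
rewrite ler_wpM2r ?expR_ge0// ler_expR /harmonic_sum big_ord0 addr0 mulr1.
have := expR_gt0 t; rewrite ler_norml => *; apply/andP; split; lra.
Qed.

Definition rect (b1 b2 c d : R) z := (b1 <= Re z <= b2) && (c <= Im z <= d).

Definition grid (b1 : R) (g m : nat) : seq R[i] :=
  [seq (b1 + i%:R / 2 ^+ m) +i* (j%:R / 2 ^+ m) | i <- iota 0 (g * 2 ^ m).+1, j <- iota 0 (g * 2 ^ m).+1].

Lemma size_grid b1 g m : (size (grid b1 g m))%:R <= 4 * (g.+1%:R ^+ 2) * 4 ^+ m :> R.
Proof.
rewrite size_allpairs !size_iota.
have -> : 4 * g.+1%:R ^+ 2 * 4 ^+ m = ((2 * (g.+1 * 2 ^ m)) * (2 * (g.+1 * 2 ^ m)))%N%:R :> R.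
  by rewrite !natrM !natrX (_ : 4 = 2 * 2 :> R) ?exprMn -?natrM//; ring.
rewrite ler_nat leq_mul//.
all: have : (0 < 2 ^ m)%N by rewrite expn_gt0.
all: by rewrite mulSn; lia.
Qed.

(** Rounding down, not to the nearest point: [rSn] is monotone in the real part, and
    only the lower side of the rectangle can be crossed. *)
Lemma grid_round b1 b2 c d g m z : rect b1 b2 c d z -> 0 <= c -> b2 - b1 <= g%:R -> d <= g%:R ->
  exists2 z', z' \in grid b1 g m &
    [/\ rect b1 b2 (c - 2 ^- m) d z', Re z' <= Re z, 0 <= Im z' & normc (z - z') <= 2 * 2 ^- m].
Proof.
move=> /andP[/andP[b1z zb2] /andP[cz zd]] c0 bg dg.
have p0 : 0 < 2 ^+ m :> R by rewrite exprn_gt0.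
have tr (y : R) : 0 <= y -> y <= g%:R -> exists2 i, i \in iota 0 (g * 2 ^ m).+1 &
    i%:R / 2 ^+ m <= y /\ y - 2 ^- m <= i%:R / 2 ^+ m.
  move=> y0 yg; pose i := Num.truncn (y * 2 ^+ m).
  have y2 : 0 <= y * 2 ^+ m by rewrite mulr_ge0// ltW.
  have /andP[i1 i2] := truncn_itv y2.
  exists i; last first.
    split; first by rewrite ler_pdivrMr.
    rewrite lerBlDr -[X in _ + X]mul1r -mulrDl natr1 ler_pdivlMr//; exact: ltW.
  rewrite mem_iota/= add0n ltnS -(ler_nat R); apply: le_trans i1 _.
  by rewrite natrM natrX ler_wpM2r// ltW.
have zb0 : 0 <= Re z - b1 by rewrite subr_ge0.
have zbg : Re z - b1 <= g%:R by apply: le_trans bg; rewrite lerD2r.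
have [i ig [i1 i2]] := tr _ zb0 zbg.
have [j jg [j1 j2]] := tr _ (le_trans c0 cz) (le_trans zd dg).
exists ((b1 + i%:R / 2 ^+ m) +i* (j%:R / 2 ^+ m)).
  by apply/allpairsP; exists (i, j).
have i0 : 0 <= i%:R / 2 ^+ m :> R by rewrite divr_ge0 ?(ltW p0).
have j0 : 0 <= j%:R / 2 ^+ m :> R by rewrite divr_ge0 ?(ltW p0).
split => //=.
- by apply/andP; split; apply/andP; split => /=; lra.
- by rewrite addrC -lerBrDr.
apply: le_trans (nc_le_ReIm _) _; rewrite ReD ImD ReN ImN/=.
by rewrite mulr2n mulrDl mul1r lerD// ger0_norm; lra.
Qed.

Definition growth z N n : R[i] := \prod_(N <= j < n) (1 + alpha z / j.+1%:R).

Lemma growthS z N n : (N <= n)%N -> growth z N n.+1 = growth z N n * (1 + alpha z / n.+1%:R).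
Proof. by move=> Nn; rewrite /growth big_nat_recr. Qed.

Lemma growth_id z N : growth z N N = 1.
Proof. by rewrite /growth big_geq. Qed.

Lemma nc_div_nat z n : normc (z / n%:R) = normc z / n%:R.
Proof. by rewrite normcM normcV nc_nat. Qed.

Lemma Re_div_nat z n : Re (z / n%:R) = Re z / n%:R.
Proof. by rewrite real_natc -fmorphV mulrC ReZ mulrC. Qed.

Lemma nc_1D_gt0 z n : normc (alpha z) < n.+1%:R -> 0 < normc (1 + alpha z / n.+1%:R).
Proof.
move=> an; have := ler_nc_sub 1 (- (alpha z / n.+1%:R)); rewrite opprK normc1 normcN nc_div_nat.
have : normc (alpha z) / n.+1%:R < 1 by rewrite ltr_pdivrMr// mul1r.
set q := _ / _; lra.
Qed.

Lemma growth_gt0 z N n : normc (alpha z) < N.+1%:R -> 0 < normc (growth z N n).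
Proof.
move=> aN; have [Nn|/ltnW nN] := leqP N n; last by rewrite /growth big_geq// normc1.
elim: n Nn => [|n ih]; first by rewrite leqn0 => /eqP ->; rewrite growth_id normc1.
rewrite leq_eqVlt => /predU1P[<-|Nn]; first by rewrite growth_id normc1.
rewrite growthS// normcM mulr_gt0 ?ih// nc_1D_gt0// (lt_le_trans aN)// ler_nat ltnS.
exact: Nn.
Qed.
End Supermartingales.

Section GridEstimates.
Context d (T : measurableType d) (R : realType) (P : probability T R).
Variables (V : nat -> T -> seq bool) (hV : is_bst_process P V).
Variables (b1 b2 p M : R).
Hypothesis p12 : 1 < p <= 2.
Let p12' : 1 <= p <= 2. Proof. by case/andP: p12 => /ltW -> ->. Qed.
Let p0 : 0 < p. Proof. by case/andP: p12 => /(lt_trans ltr01). Qed.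
Hypothesis M1 : 1 <= M.

Let powR_2m (m : nat) : (2 ^+ m : R) `^ p <= 4 ^+ m.
Proof.
have -> : 4 ^+ m = (2 ^+ m : R) `^ 2.
  by rewrite powR_mulrn ?exprn_ge0// -exprM mulnC exprM; congr (_ ^+ _); rewrite -natrX.
by rewrite ler_powR ?exprn_ege1 ?ler1n//; case/andP: p12.
Qed.

(** At scale [m] the mesh is [2 ^- m] and the starting time [Q ^ m.+1]. A union bound
    over about [4 ^ m] grid points costs [4 ^ m], the required precision costs another
    [4 ^ m] in p-th mean, and the noise at the starting time contributes
    [Q ^ (- eta * m)]. Since 32 = 4 * 4 * 2, the condition on [Q] leaves a summable
    factor [2 ^- m]. *)
Lemma inner_grid (a eta : R) (g Q : nat) : 0 < eta -> M <= Q%:R -> 32 <= Q%:R `^ eta ->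
  (forall z, rect b1 b2 0 a z -> normc (alpha z) <= M /\
     eta <= p * Re (alpha z) - (2 * expR (p * Re z) - 1)) ->
  (forall z, rect b1 b2 0 a z -> 2 * expR (p * Re z) + 1 <= M) ->
  {ae P, forall w, exists m0, forall m, (m0 <= m)%N -> forall z, z \in grid b1 g m ->
    rect b1 b2 0 a z -> forall n, (Q ^ m.+1 <= n)%N ->
    normc (Sn (external (V^~ w) n) z - growth z (Q ^ m.+1) n * Sn (external (V^~ w) (Q ^ m.+1)) z)
    <= normc (growth z (Q ^ m.+1) n) * expR (Re (alpha z) * ln (Q ^ m.+1)%:R) / 2 ^+ m}.
Proof.
move=> eta0 MQ Qeta za zM.
have Q1R : 1 <= Q%:R :> R by exact: le_trans MQ.
have Q1 : (1 <= Q)%N by rewrite -(ler_nat R).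
pose N m := (Q ^ m.+1)%N.
have N0 m : (0 < N m)%N by rewrite expn_gt0 Q1.
have QN m : Q%:R <= (N m)%:R :> R by rewrite ler_nat /N expnS leq_pmulr// expn_gt0 Q1.
pose A := 48 * M `^ p / eta.
have A0 : 0 <= A by rewrite divr_ge0 ?mulr_ge0 ?powR_ge0// ltW.
pose Y m (z : R[i]) h := Sn (ext h) z - growth z (N m) (size h) * Sn (ext (take (N m) h)) z.
pose c m z := (2 ^+ m : R) `^ p * expR (- (p * (Re (alpha z) * ln (N m)%:R))).
have c0 m z : 0 < c m z by rewrite mulr_gt0 ?expR_gt0// powR_gt0// exprn_gt0.
pose Uz m z h := (normc (Y m z h) `^ p + A * rSn (ext h) (p * Re z)) / (normc (growth z (N m) (size h)) `^ p).
pose U m h := \sum_(z <- grid b1 g m | rect b1 b2 0 a z) c m z * Uz m z h.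
have Uz0 m z h : 0 <= Uz m z h.
  by rewrite divr_ge0 ?powR_ge0// addr_ge0 ?powR_ge0// mulr_ge0// rSn_ge0.
have aN m z : rect b1 b2 0 a z -> normc (alpha z) < (N m).+1%:R.
  move=> /za[zM' _]; rewrite (le_lt_trans zM')// (le_lt_trans MQ)// (le_lt_trans (QN m))//.
  by rewrite ltr_nat.
have Uzsuper m z h : rect b1 b2 0 a z -> valid h -> (N m <= size h)%N -> step (Uz m z) h <= Uz m z h.
  move=> rz vh Nh; have [zM' zeta] := za z rz.
  apply: (@moment_supermartingale _ z p A (fun n => normc (growth z (N m) n) `^ p) (Y m z) (N m)) => //.
  - by move=> n _; rewrite powR_gt0// growth_gt0// aN.
  - move=> h' x vh' Nh' xh'; rewrite /Y Sn_rcons// size_rcons growthS//.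
    have -> : take (N m) (rcons h' x) = take (N m) h' by rewrite -cats1 takel_cat.
    by ring.
  move=> n Nn; rewrite growthS// normcM powRM ?nc_ge0//; split; first by rewrite mulrC.
  set k := normc (growth _ _ _) `^ p; have k0 : 0 <= k by exact: powR_ge0.
  suff h2 : (48 * normc (alpha z) `^ p + A * (2 * expR (p * Re z) - 1)) / n.+1%:R + A <=
      A * normc (1 + alpha z / n.+1%:R) `^ p.
    by rewrite -mulrDl [k * _]mulrC mulrA; exact: ler_wpM2r.
  have nR : 0 < n.+1%:R :> R by rewrite ltr0n.
  have h3 : 1 + p * (Re (alpha z) / n.+1%:R) <= normc (1 + alpha z / n.+1%:R) `^ p.
    have r0 : 0 <= 1 + Re (alpha z) / n.+1%:R.
      have := Re_le_nc (alpha z); rewrite ler_norml => /andP[rl _].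
      have := aN m z rz => az.
      have nN : (N m).+1%:R <= n.+1%:R :> R by rewrite ler_nat ltnS.
      rewrite -(@pmulr_lge0 _ n.+1%:R)// mulrDl divfK ?gt_eqF// mul1r; lra.
    apply: (@le_trans _ _ ((1 + Re (alpha z) / n.+1%:R) `^ p)).
      have := @bernoulli_convex _ _ p _ r0; rewrite addrAC subrr add0r; apply.
      by case/andP: p12'.
    rewrite ge0_ler_powR ?nnegrE ?nc_ge0 ?(ltW p0)//.
    apply: le_trans (ler_norm _) _; apply: le_trans (Re_le_nc _).
    by rewrite [in leRHS]ReD [in leRHS]Re_div_nat.
  have h4 : 48 * normc (alpha z) `^ p + A * (2 * expR (p * Re z) - 1) <= A * (p * Re (alpha z)).
    rewrite -lerBrDr -mulrBr; apply: (@le_trans _ _ (A * eta)); last by rewrite ler_wpM2l.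
    rewrite /A divfK ?gt_eqF// ler_pM2l// ge0_ler_powR ?nnegrE ?nc_ge0 ?(ltW p0)//.
    exact: le_trans M1.
  apply: le_trans (ler_wpM2l A0 h3); rewrite [leRHS]mulrDr mulr1 [leLHS]addrC lerD2l.
  by rewrite [p * (_ / _)]mulrA [A * (_ / _)]mulrA ler_wpM2r ?invr_ge0 ?(ltW nR).
have : {ae P, forall w, exists m0, forall m, (m0 <= m)%N -> forall j, (N m <= j)%N ->
    U m (path V w j) < 1}.
  apply: (@maximal_borel_cantelli _ _ _ P V hV U N (A * expR M * (4 * g.+1%:R ^+ 2))).
- move=> m h; apply: sumr_ge0 => z _; rewrite mulr_ge0// ltW//.
- move=> m h vh Nh; rewrite /U (step_weighted_sum _ _ (c m) (Uz m)).
  by apply: ler_sum => z rz; rewrite ler_wpM2l ?(ltW (c0 _ _))// Uzsuper.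
- move=> m.
  have UE h : size h = N m -> U m h = \sum_(z <- [seq z <- grid b1 g m | rect b1 b2 0 a z]) (c m z * A) * rSn (ext h) (p * Re z).
    move=> sh; rewrite /U big_filter; apply: eq_bigr => z _.
    by rewrite /Uz /Y sh growth_id mul1r -sh take_size subrr normc0 powR0 ?gt_eqF// add0r normc1 powR1 divr1 mulrA.
  apply: (@le_trans _ _ (expected (N m) (fun h => \sum_(z <- [seq z <- grid b1 g m | rect b1 b2 0 a z]) (c m z * A) * rSn (ext h) (p * Re z)) [::])).
    by apply: expected_le valid_nil _ => h _ sh; rewrite UE.
  rewrite expected_sum.
  apply: (@le_trans _ _ (\sum_(z <- [seq z <- grid b1 g m | rect b1 b2 0 a z]) A * expR M * (4 ^+ m * 32 ^- m))).
    rewrite big_filter [leRHS]big_filter; apply: ler_sum => z rz; rewrite expectedZ.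
    have [zM' zeta] := za z rz.
    apply: le_trans (ler_wpM2l _ (@expected_rSn_le _ (N m) (p * Re z) (N0 m))) _.
      by rewrite mulr_ge0// ltW.
    have l0 : 0 <= ln (N m)%:R :> R by rewrite ln_ge0// ler1n.
    have e1 : expR (2 * expR (p * Re z) + 1) <= expR M by rewrite ler_expR zM.
    have e2 : expR (- (p * (Re (alpha z) * ln (N m)%:R))) * expR ((2 * expR (p * Re z) - 1) * ln (N m)%:R) <= 32 ^- m.
      rewrite -expRD; apply: (@le_trans _ _ (expR (- (eta * ln (N m)%:R)))).
        rewrite ler_expR; have := ler_wpM2r l0 zeta; rewrite mulrBl; lra.
      rewrite expRN lef_pV2 ?posrE ?expR_gt0 ?exprn_gt0//.
      have -> : expR (eta * ln (N m)%:R) = (Q%:R `^ eta) ^+ m.+1.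
        rewrite /N natrX lnXn ?ltr0n// /powR ifF; last by rewrite gt_eqF ?ltr0n.
        rewrite mulrnAr; elim: (m.+1) => [|k ik]; first by rewrite mulr0n expR0 expr0.
        by rewrite mulrSr expRD ik exprSr.
      apply: (@le_trans _ _ ((Q%:R `^ eta) ^+ m)).
        by rewrite lerXn2r ?nnegrE ?powR_ge0.
      by rewrite ler_weXn2l// (le_trans _ Qeta)// ler1n.
    rewrite /c; set x := expR _ in e1 *; set y := expR (- _) in e2 *; set u := expR (_ * _) in e2 *.
    have -> : (2 ^+ m) `^ p * y * A * (x * u) = A * (x * ((2 ^+ m) `^ p * (y * u))) by ring.
    have -> : A * expR M * (4 ^+ m * 32 ^- m) = A * (expR M * (4 ^+ m * 32 ^- m)) by ring.
    rewrite ler_wpM2l// ler_pM ?expR_ge0// ?mulr_ge0 ?powR_ge0 ?expR_ge0//.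
    by rewrite ler_pM ?mulr_ge0 ?powR_ge0 ?expR_ge0// powR_2m.
  rewrite sumr_const_seq size_filter [leLHS]mulrC.
  apply: (@le_trans _ _ (A * expR M * (4 ^+ m / 32 ^+ m) * (4 * g.+1%:R ^+ 2 * 4 ^+ m))).
    have AX : 0 <= A * expR M * (4 ^+ m / 32 ^+ m).
      by apply: mulr_ge0; [exact: mulr_ge0 A0 (expR_ge0 _)|rewrite divr_ge0 ?exprn_ge0].
    apply: ler_wpM2l => //.
    apply: le_trans (size_grid b1 g m); rewrite ler_nat; exact: count_size.
  have -> : 32 ^+ m = 4 ^+ m * 4 ^+ m * 2 ^+ m :> R by rewrite -!exprMn; congr (_ ^+ _); ring.
  have f0 : 4 ^+ m != 0 :> R by rewrite expf_neq0.
  have f1 : 2 ^+ m != 0 :> R by rewrite expf_neq0.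
  by rewrite le_eqVlt; apply/orP; left; apply/eqP; field; rewrite f0 f1.
apply: filterS => w [m0 hm0]; exists m0 => m mm0 z zg rz n Nn.
have := hm0 m mm0 n Nn; rewrite /U (big_rem z)//= rz => Ulow.
have {}Ulow : c m z * Uz m z (path V w n) < 1.
  apply: le_lt_trans Ulow; rewrite lerDl; apply: sumr_ge0 => y _.
  by rewrite mulr_ge0// ltW.
rewrite !external_hist -(take_hist (fun i => V i w) Nn) -/(path V w n).
have -> : Sn (ext (path V w n)) z - growth z (N m) n * Sn (ext (take (N m) (path V w n))) z =
    Y m z (path V w n) by rewrite /Y size_hist.
set K := normc (growth z (N m) n); have K0 : 0 < K by rewrite growth_gt0// aN.
have L0 : 0 <= K * expR (Re (alpha z) * ln (N m)%:R) / 2 ^+ m.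
  by rewrite divr_ge0 ?mulr_ge0 ?expR_ge0 ?exprn_ge0 ?(ltW K0).
rewrite leNgt; apply/negP => /(gt0_ltr_powR p0 L0 (nc_ge0 _)) YL.
move: Ulow; apply/negP; rewrite -leNgt.
have cE : c m z * (K * expR (Re (alpha z) * ln (N m)%:R) / 2 ^+ m) `^ p = K `^ p.
  rewrite /c mulrAC -powRM ?exprn_ge0// mulrC.
  have -> : expR (- (p * (Re (alpha z) * ln (N m)%:R))) = expR (- (Re (alpha z) * ln (N m)%:R)) `^ p.
    by rewrite /powR gt_eqF ?expR_gt0// expRK mulrN.
  set y := Re (alpha z) * _; rewrite -(@powRM _ (expR (- y))) ?mulr_ge0 ?expR_ge0 ?invr_ge0 ?exprn_ge0 ?(ltW K0)//.
  congr powR; rewrite [2 ^+ m * _]mulrC divfK ?expf_neq0// mulrCA -expRD addNr expR0 mulr1//.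
have Kp : 0 < K `^ p by exact: powR_gt0.
rewrite /Uz size_hist -/K mulrA ler_pdivlMr// mul1r -cE ler_wpM2l ?(ltW (c0 _ _))//.
apply: le_trans (ltW YL) _; rewrite lerDl mulr_ge0// rSn_ge0.
by [].
Qed.
(** Away from the real axis the multiplier of [Sn] has modulus less than the growth
    rate of the total mass, so that [Sn] is negligible there. The starting time does not
    depend on the scale [m]; the price for the number of grid points is the factor
    [8 ^ m], which a scale growing slowly with [n] makes harmless. *)
Lemma outer_grid (c delta : R) (g : nat) : 0 < delta ->
  (forall z, rect b1 b2 c pi z -> [/\ normc (alpha z) <= M,
     p * Re (alpha z) + 2 * delta <= p * (2 * expR (Re z) - 1),
     2 * expR (p * Re z) - 1 + 2 * delta <= p * (2 * expR (Re z) - 1),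
     2 * expR (Re z) + 1 <= M & 2 * expR (p * Re z) + 1 <= M]) ->
  exists (n0 : nat) (C : R), 0 < C /\
  {ae P, forall w, exists m0, forall m, (m0 <= m)%N -> forall z, z \in grid b1 g m ->
    rect b1 b2 c pi z -> forall n, (n0 <= n)%N ->
    normc (Sn (external (V^~ w) n) z) <=
    8 ^+ m * C * expR ((2 * expR (Re z) - 1 - delta / p) * ln n%:R)}.
Proof.
move=> d0 za; have /andP[p1 p2] := p12.
pose n0 := (Num.truncn (M ^+ 2 / delta)).+1.
have n0E (n : nat) : (n0 <= n)%N -> M ^+ 2 / n.+1%:R <= delta.
  move=> n0n; rewrite ler_pdivrMr ?ltr0n// mulrC -ler_pdivrMr//.
  apply: le_trans (ltW (truncnS_gt _)) _; rewrite ler_nat.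
  by apply: leq_trans n0n _.
pose B := 2 * M * (1 + harmonic_sum R n0).
pose C := expR B.
exists n0, C; split; first exact: expR_gt0.
pose A := 48 * M `^ p / delta.
have M0 : 0 <= M by exact: le_trans M1.
have A0 : 0 <= A by rewrite divr_ge0 ?mulr_ge0 ?powR_ge0// ltW.
pose th z := p * (2 * expR (Re z) - 1) - delta.
pose K z n := \prod_(n0 <= j < n) (1 + th z / j.+1%:R).
have thE z : rect b1 b2 c pi z -> [/\ -1 < th z, `|th z| <= 2 * M,
    p * Re (alpha z) + delta <= th z & 2 * expR (p * Re z) - 1 + delta <= th z].
  move=> /za[h1 h2 h3 h4 h5]; rewrite /th.
  have e1 := expR_gt0 (p * Re z); have e2 := expR_gt0 (Re z).
  have q : p * (2 * expR (Re z) - 1) <= 2 * M by nra.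
  by split; rewrite ?ler_norml; try (apply/andP; split); lra.
have fac z n : rect b1 b2 c pi z -> 0 < 1 + th z / n.+1%:R.
  move=> /thE[t1 _ _ _]; have nR : 0 < n.+1%:R :> R by rewrite ltr0n.
  have n1 : 1 <= n.+1%:R :> R by rewrite ler1n.
  rewrite -(@pmulr_lgt0 _ n.+1%:R)// mulrDl divfK ?gt_eqF// mul1r; lra.
have K0 z n : rect b1 b2 c pi z -> 0 < K z n.
  by move=> rz; rewrite /K; apply: prodr_gt0 => j _; exact: fac.
have KS z n : (n0 <= n)%N -> K z n.+1 = K z n * (1 + th z / n.+1%:R).
  by move=> n0n; rewrite /K big_nat_recr.
pose Uz z h := (normc (Sn (ext h) z) `^ p + A * rSn (ext h) (p * Re z)) / K z (size h).
pose k8 (m : nat) (z : R[i]) : R := (8 ^+ m)^-1.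
pose U m h := \sum_(z <- grid b1 g m | rect b1 b2 c pi z) k8 m z * Uz z h.
have k80 m z : 0 <= k8 m z by rewrite invr_ge0 exprn_ge0.
have Uz0 z h : rect b1 b2 c pi z -> 0 <= Uz z h.
  move=> rz; rewrite divr_ge0 ?(ltW (K0 _ _ rz))// addr_ge0 ?powR_ge0// mulr_ge0// rSn_ge0.
  by [].
have Uzsuper z h : rect b1 b2 c pi z -> valid h -> (n0 <= size h)%N -> step (Uz z) h <= Uz z h.
  move=> rz vh Nh; have [zM' zd1 zd2 _ _] := za z rz; have [t1 t2 t3 t4] := thE z rz.
  apply: (@moment_supermartingale _ z p A (K z) (fun h => Sn (ext h) z) n0) => //.
  - by move=> n _; exact: K0.
  - by move=> h' x vh' Nh' xh'; rewrite Sn_rcons//; ring.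
  move=> n Nn; rewrite KS//.
  have nR : 0 < n.+1%:R :> R by rewrite ltr0n.
  split.
    rewrite [leRHS]mulrC; apply: ler_wpM2r; first exact: ltW (K0 _ _ rz).
    pose y := 2 * (Re (alpha z) / n.+1%:R) + (normc (alpha z) / n.+1%:R) ^+ 2.
    have sq : normc (1 + alpha z / n.+1%:R) ^+ 2 = 1 + y.
      rewrite nc_sqr ReD ImD Re_div_nat.
      have -> : Im (alpha z / n.+1%:R) = Im (alpha z) / n.+1%:R.
        by rewrite real_natc -fmorphV mulrC ImZ mulrC.
      by rewrite /y expr_div_n nc_sqr [Re 1]/= [Im 1]/=; set u := Re (alpha z);
        set v := Im (alpha z); set q := n.+1%:R; field; rewrite gt_eqF.
    have y0 : 0 <= 1 + y by rewrite -sq sqr_ge0.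
    have -> : normc (1 + alpha z / n.+1%:R) `^ p = (1 + y) `^ (p / 2).
      by rewrite -sq -powR_mulrn ?nc_ge0// -powRrM mulrCA mulfV ?mulr1.
    have ph : 0 <= p / 2 <= 1 by apply/andP; split; lra.
    apply: le_trans (bernoulli_concave ph y0) _.
    rewrite addrAC subrr add0r lerD2l.
    apply: (@le_trans _ _ ((p * Re (alpha z) + delta) / n.+1%:R)); last first.
      by rewrite ler_wpM2r// invr_ge0 ltW.
    have : (normc (alpha z) / n.+1%:R) ^+ 2 <= delta / n.+1%:R.
      rewrite expr2 mulrA ler_wpM2r ?invr_ge0 ?(ltW nR)//.
      apply: le_trans (n0E n Nn); rewrite mulrAC -expr2.
      by rewrite ler_wpM2r ?invr_ge0 ?(ltW nR)// lerXn2r ?nnegrE ?nc_ge0.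
    rewrite /y; set u := Re _; set v := _ ^+ 2; set q := n.+1%:R^-1 => vq.
    have vq0 : 0 <= v by exact: sqr_ge0.
    nra.
  set k := K z n; have k0 : 0 < k by exact: K0.
  suff h2 : (48 * normc (alpha z) `^ p + A * (2 * expR (p * Re z) - 1)) / n.+1%:R <=
      A * (th z / n.+1%:R).
    have h3 := ler_wpM2r (ltW k0) h2.
    have -> : A * (k * (1 + th z / n.+1%:R)) = A * (th z / n.+1%:R) * k + A * k by ring.
    by rewrite lerD2r.
  rewrite mulrA ler_wpM2r ?invr_ge0 ?(ltW nR)//.
  rewrite -lerBrDr -mulrBr; apply: (@le_trans _ _ (A * delta)).
    rewrite /A divfK ?gt_eqF// ler_pM2l// ge0_ler_powR ?nnegrE ?nc_ge0 ?(ltW p0)//.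
  by rewrite ler_wpM2l// lerBrDr addrC.
pose E0 := (n0.+1%:R ^+ 2 + A) * expR M * expR (M * ln n0%:R).
have n00 : (0 < n0)%N by [].
have E00 : 0 <= E0.
  by rewrite !mulr_ge0 ?expR_ge0// addr_ge0 ?sqr_ge0.
have : {ae P, forall w, exists m0, forall m, (m0 <= m)%N -> forall j, (n0 <= j)%N ->
    U m (path V w j) < 1}.
  apply: (@maximal_borel_cantelli _ _ _ P V hV U (fun=> n0) (E0 * (4 * g.+1%:R ^+ 2))).
  - by move=> m h; apply: sumr_ge0 => z rz; rewrite mulr_ge0// Uz0.
  - move=> m h vh Nh; rewrite /U (step_weighted_sum _ _ (k8 m) Uz).
    by apply: ler_sum => z rz; rewrite ler_wpM2l// Uzsuper.
  move=> m.
  pose q := n0.+1%:R ^+ 2 + A.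
  apply: (@le_trans _ _ (expected n0 (fun h => \sum_(z <- [seq z <- grid b1 g m | rect b1 b2 c pi z]) (8 ^- m * q) * rSn (ext h) (p * Re z)) [::])).
    apply: expected_le valid_nil _ => h vh sh; rewrite /U big_filter.
    apply: ler_sum => z rz; rewrite /k8 -[leRHS]mulrA ler_wpM2l ?invr_ge0 ?exprn_ge0//.
    have {}sh : size h = n0 by rewrite sh.
    rewrite /Uz sh /K big_geq// divr1 mulrDl lerD2r.
    apply: (@le_trans _ _ (rSn (ext h) (Re z) `^ p)).
      by rewrite ge0_ler_powR ?nnegrE ?nc_ge0 ?rSn_ge0 ?(ltW p0)// nc_Sn_le.
    have nR : 0 < n0.+1%:R :> R by rewrite ltr0n.
    have -> : rSn (ext h) (Re z) = n0.+1%:R * (rSn (ext h) (Re z) / n0.+1%:R).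
      by rewrite mulrC divfK ?gt_eqF.
    rewrite powRM ?(ltW nR)// ?divr_ge0 ?rSn_ge0 ?(ltW nR)//.
    have n1 : 1 <= n0.+1%:R :> R by rewrite ler1n.
    apply: ler_pM; rewrite ?powR_ge0//.
      by rewrite -powR_mulrn ?(ltW nR)// ler_powR.
    have := @power_mean _ _ (ext h) (fun x => expR (Re z * (size x)%:R)) p (ltW p1).
    rewrite size_ext// sh => /(_ isT (fun x => expR_ge0 _)) /le_trans; apply.
    have -> : \sum_(x <- ext h) expR (Re z * (size x)%:R) `^ p = rSn (ext h) (p * Re z).
      by apply: eq_bigr => x _; rewrite /powR gt_eqF ?expR_gt0// expRK mulrA.
    by rewrite ler_pdivrMr// ler_peMr// rSn_ge0.
  rewrite expected_sum.
  apply: (@le_trans _ _ (\sum_(z <- [seq z <- grid b1 g m | rect b1 b2 c pi z]) 8 ^- m * E0)).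
    rewrite big_filter [leRHS]big_filter; apply: ler_sum => z rz; rewrite expectedZ.
    rewrite -mulrA ler_wpM2l ?invr_ge0 ?exprn_ge0// /E0 -mulrA ler_wpM2l ?addr_ge0 ?sqr_ge0//.
    have [_ _ _ h4 h5] := za z rz.
    apply: le_trans (@expected_rSn_le _ n0 (p * Re z) n00) _.
    by rewrite ler_pM ?expR_ge0// ler_expR// ler_wpM2r ?ln_ge0 ?ler1n//; lra.
  rewrite sumr_const_seq size_filter [leLHS]mulrC.
  apply: (@le_trans _ _ (8 ^- m * E0 * (4 * g.+1%:R ^+ 2 * 4 ^+ m))).
    apply: ler_wpM2l; first by rewrite mulr_ge0// invr_ge0 exprn_ge0.
    apply: le_trans (size_grid b1 g m); rewrite ler_nat; exact: count_size.
  have -> : 8 ^+ m = 4 ^+ m * 2 ^+ m :> R by rewrite -!exprMn; congr (_ ^+ _); ring.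
  have f0 : 4 ^+ m != 0 :> R by rewrite expf_neq0.
  have f1 : 2 ^+ m != 0 :> R by rewrite expf_neq0.
  by rewrite le_eqVlt; apply/orP; left; apply/eqP; field; rewrite f0 f1.
apply: filterS => w [m0 hm0]; exists m0 => m mm0 z zg rz n Nn.
have [t1 t2 t3 t4] := thE z rz.
have := hm0 m mm0 n Nn; rewrite /U (big_rem z)//= rz => Ulow.
have {}Ulow : k8 m z * Uz z (path V w n) < 1.
  apply: le_lt_trans Ulow; rewrite lerDl; apply: sumr_ge0 => y ry.
  by rewrite mulr_ge0// Uz0.
rewrite !external_hist -/(path V w n).
set bd := 8 ^+ m * C * expR _.
have C1 : 1 <= C by rewrite -expR0 ler_expR mulr_ge0 ?addr_ge0 ?mulr_ge0 ?sumr_ge0.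
have e8 : 1 <= 8 ^+ m :> R by rewrite exprn_ege1 ?ler1n.
have bd0 : 0 <= bd by rewrite mulr_ge0 ?expR_ge0// mulr_ge0 ?exprn_ge0 ?expR_ge0.
rewrite leNgt; apply/negP => /(gt0_ltr_powR p0 bd0 (nc_ge0 _)) YL.
move: Ulow; apply/negP; rewrite -leNgt /k8 /Uz size_hist mulrC ler_pdivlMr ?exprn_gt0// mul1r.
rewrite ler_pdivlMr ?K0//.
apply: (@le_trans _ _ (bd `^ p)); last first.
  by apply: le_trans (ltW YL) _; rewrite lerDl mulr_ge0// rSn_ge0.
have C0 : 0 <= C by exact: le_trans C1.
rewrite /bd powRM ?expR_ge0 ?mulr_ge0 ?exprn_ge0 ?C0//.
have -> : expR ((2 * expR (Re z) - 1 - delta / p) * ln n%:R) `^ p = expR (th z * ln n%:R).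
  rewrite /powR gt_eqF ?expR_gt0// expRK; congr expR; rewrite /th.
  by field; rewrite gt_eqF.
have KC : K z n <= C * expR (th z * ln n%:R).
  apply: le_trans (prod_growth Nn (leq_trans n00 Nn) _) _.
    by rewrite (le_trans _ (ltW t1))// lerN2 ler1n.
  rewrite ler_wpM2r ?expR_ge0// ler_expR ler_wpM2r// addr_ge0// sumr_ge0//.
apply: (@le_trans _ _ (8 ^+ m * (C * expR (th z * ln n%:R)))).
  by rewrite ler_wpM2l ?exprn_ge0.
rewrite mulrA ler_wpM2r ?expR_ge0// -[leLHS]powRr1 ?mulr_ge0 ?exprn_ge0 ?expR_ge0//.
by rewrite ler_powR// ?(ltW p1)// mulr_ege1.
Qed.
End GridEstimates.

(** * From grid estimates to rates of convergence *)

Section Rates.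
Variable R : realType.
Implicit Types (z w : R[i]) (W : R[i] -> R[i]) (v : nat -> seq bool) (r B M : R).

(** The exact growth of [Sn] from time [N] to time [n], compared with the power of
    [n / N] by which [Wn] is normalised. *)
Definition rho z N n : R[i] :=
  cexp (- (alpha z * (ln (n%:R : R) - ln N%:R)%:C)) * growth z N n.

(** The error is of order [n ^- 2], written as a difference so that the errors of all the
    factors of [rho] add up to a telescoping sum. *)
Lemma rho_step z M n : (0 < n)%N -> 1 <= M -> normc (alpha z) <= M ->
  normc (cexp (- (alpha z * (ln (n.+1%:R : R) - ln n%:R)%:C)) * (1 + alpha z / n.+1%:R) - 1)
  <= expR M * (M + M ^+ 2 * expR M) * (n%:R^-1 - n.+1%:R^-1).
Proof.
move=> n0 M1 zM; have [l1 l2] := @ln_succ_bounds R n n0.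
set l := ln _ - ln _ in l1 l2 *; set a := alpha z in zM *.
have nR : 0 < n%:R :> R by rewrite ltr0n.
have nR1 : 1 <= n%:R :> R by rewrite ler1n.
have mR : 0 < n.+1%:R :> R by rewrite ltr0n.
have mE : n.+1%:R = n%:R + 1 :> R by rewrite natr1.
set u := (n%:R : R)^-1 in l2 *; set u' := (n.+1%:R : R)^-1 in l1 *.
have u'0 : 0 < u' by rewrite invr_gt0.
have u0 : 0 < u by rewrite invr_gt0.
have u1 : u <= 1 by rewrite invf_le1.
have uu : u - u' = u * u' by rewrite /u /u' mE; field; rewrite -mE !gt_eqF.
have u2 : u <= 2 * u'.
  rewrite /u /u' ler_pdivlMr// mulrC ler_pdivrMr// mE; lra.
have l0 : 0 <= l by rewrite (le_trans (ltW u'0)).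
have M0 : 0 <= M by exact: le_trans M1.
have y1 : normc (a * l%:C) <= M * u.
  by rewrite mulrC ncZ ger0_norm// mulrC ler_pM ?nc_ge0.
have yM : normc (a * l%:C) <= M by rewrite (le_trans y1)// ler_piMr.
have e1 : cexp (- (a * l%:C)) * (1 + a / n.+1%:R) - 1 =
    cexp (- (a * l%:C)) * ((a * u'%:C - a * l%:C) - (cexp (a * l%:C) - exp_trunc 2 (a * l%:C))).
  rewrite cexpN /u' real_natc -fmorphV; set y := a * l%:C; set x := a * _.
  rewrite /exp_trunc !big_ord_recl big_ord0/= expr0 expr1 fact0 !invr1 !mul1r addr0.
  by field; rewrite cexp_neq0.
have -> : expR M * (M + M ^+ 2 * expR M) * (u - u') =
    expR M * (M * (u * u') + M ^+ 2 * expR M * (u * u')) by rewrite uu; ring.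
rewrite e1 normcM nc_cexp ReN; apply: ler_pM; rewrite ?expR_ge0 ?nc_ge0//.
  rewrite ler_expR; have := Re_le_nc (a * l%:C); rewrite ler_norml => /andP[h _]; lra.
apply: le_trans (ler_ncB _ _) _; apply: lerD.
  rewrite -mulrBr -rmorphB mulrC ncZ mulrC; apply: ler_pM; rewrite ?nc_ge0//.
  rewrite distrC ger0_norm ?subr_ge0// -uu; lra.
apply: le_trans (cexp_taylor _ _) _.
have -> : 2`!%:R = 2 :> R by [].
have : normc (a * l%:C) ^+ 2 <= M ^+ 2 * (2 * (u * u')).
  apply: (@le_trans _ _ ((M * u) ^+ 2)).
    by rewrite lerXn2r ?nnegrE ?nc_ge0// mulr_ge0 ?(ltW u0).
  by rewrite exprMn ler_wpM2l ?sqr_ge0//; nra.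
have : expR (normc (a * l%:C)) <= expR M by rewrite ler_expR.
set p := expR _; set q := _ ^+ 2; have q0 : 0 <= q by exact: sqr_ge0.
have p0 : 0 <= p by exact: expR_ge0.
move=> h1 h2; have := ler_pM q0 p0 h2 h1; lra.
Qed.

Lemma rho_cvg z M : 1 <= M -> normc (alpha z) <= M ->
  forall N n, (0 < N)%N -> (N <= n)%N -> 2 * (expR M * (M + M ^+ 2 * expR M)) <= N%:R ->
  normc (rho z N n - 1) <= 2 * (expR M * (M + M ^+ 2 * expR M)) * (N%:R^-1 - n%:R^-1).
Proof.
move=> M1 zM N n N0; set C := expR M * _ => Nn CN.
have C0 : 0 <= C by rewrite mulr_ge0 ?expR_ge0// addr_ge0 ?mulr_ge0 ?expR_ge0 ?sqr_ge0//; lra.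
have NR : 0 < N%:R :> R by rewrite ltr0n.
elim: n Nn => [|n ih]; first by rewrite leqNgt N0.
rewrite leq_eqVlt => /predU1P[<-|Nn].
  by rewrite /rho growth_id !subrr mulr0 oppr0 cexp0 mulr1 subrr normc0 mulr0.
have {}ih := ih Nn; have n0 : (0 < n)%N by exact: (leq_trans N0 Nn).
have nR : 0 < n%:R :> R by rewrite ltr0n.
have -> : rho z N n.+1 - 1 = (rho z N n - 1) + rho z N n *
    (cexp (- (alpha z * (ln (n.+1%:R : R) - ln n%:R)%:C)) * (1 + alpha z / n.+1%:R) - 1).
  rewrite {1}/rho growthS//.
  have -> : - (alpha z * (ln n.+1%:R - ln N%:R)%:C) =
    - (alpha z * (ln n%:R - ln N%:R)%:C) + - (alpha z * (ln n.+1%:R - ln n%:R)%:C).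
    by rewrite -opprD -mulrDr -rmorphD; congr (- (_ * _%:C)); ring.
  by rewrite cexpD /rho; ring.
have r2 : normc (rho z N n) <= 2.
  apply: le_trans (ler_nc_sub _ 1) _; rewrite normc1.
  have : 2 * C * (N%:R^-1 - n%:R^-1) <= 1.
    apply: (@le_trans _ _ (2 * C * N%:R^-1)); last by rewrite ler_pdivrMr// mul1r.
    by apply: ler_wpM2l; [exact: mulr_ge0|rewrite lerBlDr lerDl invr_ge0 ltW].
  lra.
apply: le_trans (le_normcD _ _) _; rewrite normcM.
have h := rho_step n0 M1 zM; rewrite -/C in h.
apply: le_trans (lerD ih (ler_pM (nc_ge0 _) (nc_ge0 _) r2 h)) _.
by rewrite (mulrA 2 C) -(mulrDr (2 * C)) addrA subrK.
Qed.

Lemma Wn_rho v z N n : Wn v n z - Wn v N z =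
  cexp (- (alpha z * (ln (n%:R : R))%:C)) *
    (Sn (external v n) z - growth z N n * Sn (external v N) z) +
  (rho z N n - 1) * Wn v N z.
Proof.
rewrite !WnE /rho.
have -> : cexp (- (alpha z * (ln (n%:R : R) - ln N%:R)%:C)) =
    cexp (- (alpha z * (ln (n%:R : R))%:C)) / cexp (- (alpha z * (ln (N%:R : R))%:C)).
  by rewrite -cexpN -cexpD opprK rmorphB mulrBr opprB addrC.
by field; rewrite cexp_neq0.
Qed.

Lemma nc_rho z N n : normc (rho z N n) =
  expR (- (Re (alpha z) * ln n%:R)) * (expR (Re (alpha z) * ln N%:R) * normc (growth z N n)).
Proof.
rewrite /rho normcM nc_cexp mulrA -expRD; congr (expR _ * _).
by rewrite ReN [in LHS]mulrC ReZ; ring.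
Qed.

(** The scale is the integer part of the logarithm of [n] in base [Q], less one. *)
Lemma time_scale (Q k n : nat) : (1 < Q)%N -> (Q ^ k.+1 <= n)%N ->
  exists m, [/\ (k <= m)%N, (Q ^ m.+1 <= n)%N,
    2 ^- m <= 4 * expR (- (ln 2 / ln Q%:R * ln (n%:R : R))) &
    8 ^+ m <= expR (3 * (ln 2 / ln Q%:R) * ln (n%:R : R))].
Proof.
move=> Q1 Qkn; have Q0 : (0 < Q)%N by exact: ltnW.
have n0 : (0 < n)%N by apply: leq_trans Qkn; rewrite expn_gt0 Q0.
have lQ : 0 < ln Q%:R :> R by rewrite ln_gt0// ltr1n.
have l2 : 0 < ln 2 :> R by rewrite ln_gt0// ltr1n.
have nR : 0 < n%:R :> R by rewrite ltr0n.
have kt := trunc_log_max Q1 Qkn.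
case tE : (trunc_log Q n) kt => [//|m] km; exists m.
have Qm : (Q ^ m.+1 <= n)%N by rewrite -tE trunc_logP.
have Qm2 : (n < Q ^ m.+2)%N by rewrite -tE trunc_log_ltn.
have lQX j : ln (Q ^ j)%:R = ln Q%:R * j%:R :> R.
  by rewrite natrX lnXn ?ltr0n// mulr_natr.
have h1 : ln Q%:R * m.+1%:R <= ln n%:R :> R.
  by rewrite -lQX ler_ln ?posrE ?ltr0n ?expn_gt0 ?Q0// ler_nat.
have h2 : ln n%:R <= ln Q%:R * m.+2%:R :> R.
  by rewrite -lQX ler_ln ?posrE ?ltr0n ?expn_gt0 ?Q0// ler_nat ltnW.
have p2 (c : R) : 0 < c -> c = expR (ln c) by move=> c0; rewrite lnK.
have pX (c : R) j : 0 < c -> c ^+ j = expR (ln c * j%:R).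
  by move=> c0; rewrite {1}(p2 _ c0) -expRM_natr.
have e4 : ln 4 = 2 * ln 2 :> R.
  by rewrite (_ : 4 = 2 ^+ 2) ?lnXn// ?mulr_natl// -natrX.
have e8 : ln 8 = 3 * ln 2 :> R.
  by rewrite (_ : 8 = 2 ^+ 3) ?lnXn// ?mulr_natl// -natrX.
split => //.
  rewrite pX// -expRN {1}(p2 4)// -expRD ler_expR e4.
  have : ln 2 / ln Q%:R * ln n%:R <= ln 2 * m.+2%:R :> R.
    by rewrite mulrAC ler_pdivrMr// -mulrA [_ * ln Q%:R]mulrC ler_pM2l.
  rewrite -[m.+2]addn2 natrD mulrDr; lra.
rewrite pX// ler_expR e8 -!mulrA ler_pM2l// ler_pM2l// mulrC ler_pdivlMr//.
by apply: le_trans h1; rewrite mulrC ler_wpM2l ?(ltW lQ)// ler_nat.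
Qed.

(** From the time [Q ^ m.+1] on, the grid estimate moves [Wn] by [O (2 ^- m)], and
    the Lipschitz bound carries this from the grid to all points. For [m] of the order of
    the logarithm of [n] this is a power of [n]. *)
Lemma inner_rate v W b1 b2 r a M (g Q : nat) :
  1 <= M -> M <= Q%:R -> (1 < Q)%N -> 0 < r -> b2 - b1 <= g%:R -> a <= g%:R -> a <= r / 8 ->
  (forall z, rect b1 b2 0 a z -> normc (alpha z) <= M) ->
  disc_cvg v W b1 b2 r ->
  (exists m0, forall m, (m0 <= m)%N -> forall z, z \in grid b1 g m ->
    rect b1 b2 0 a z -> forall n, (Q ^ m.+1 <= n)%N ->
    normc (Sn (external v n) z - growth z (Q ^ m.+1) n * Sn (external v (Q ^ m.+1)) z)
    <= normc (growth z (Q ^ m.+1) n) * expR (Re (alpha z) * ln (Q ^ m.+1)%:R) / 2 ^+ m) ->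
  exists (C : R) (N : nat), forall n, (N <= n)%N -> forall z, rect b1 b2 0 a z ->
    normc (Wn v n z - W z) <= C * expR (- (ln 2 / ln Q%:R * ln n%:R)).
Proof.
move=> M1 MQ Q1 r0 bg ag ar zM vW [m0 hm0].
have [B B0 [N1 hN1]] := disc_cvg_bounded vW.
pose C1 := 2 * (expR M * (M + M ^+ 2 * expR M)).
have M0 : 0 <= M by exact: le_trans M1.
have C10 : 0 <= C1 by rewrite !mulr_ge0 ?expR_ge0// addr_ge0// mulr_ge0 ?expR_ge0 ?sqr_ge0.
have Q0 : (0 < Q)%N by exact: ltnW.
have QR : 1 < Q%:R :> R by rewrite ltr1n.
have lQ : 0 < ln Q%:R :> R by rewrite ln_gt0.
pose m1 := maxn m0 (maxn N1 (maxn (Num.truncn C1).+1 (Num.truncn (16 / r)).+1)).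
have pow2 m : (m < 2 ^ m)%N by exact: ltn_expl.
have powQ m : (2 ^ m <= Q ^ m.+1)%N.
  by rewrite (leq_trans (leq_pexp2l _ (leqnSn m)))// leq_exp2r.
have Qm m : (m <= Q ^ m.+1)%N by apply: ltnW; exact: leq_trans (pow2 m) (powQ m).
pose D := 2 + C1 * B + 16 * B / r.
have grid_step m z n : (m1 <= m)%N -> z \in grid b1 g m -> rect b1 b2 0 a z ->
    (Q ^ m.+1 <= n)%N ->
    normc (Wn v n z - Wn v (Q ^ m.+1) z) <= (2 + C1 * B) / 2 ^+ m.
  move=> mm zg rz Nn; have zM' := zM z rz.
  have mm0 : (m0 <= m)%N by apply: leq_trans mm; exact: leq_maxl.
  have mN1 : (N1 <= m)%N by apply: leq_trans mm; rewrite /m1 !leq_max leqnn orbT.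
  have mC : ((Num.truncn C1).+1 <= m)%N by apply: leq_trans mm; rewrite /m1 !leq_max leqnn !orbT.
  set N := (Q ^ m.+1)%N in Nn *.
  have N0 : (0 < N)%N by rewrite expn_gt0 Q0.
  have NR : 0 < N%:R :> R by rewrite ltr0n.
  have CN : C1 <= N%:R.
    apply: le_trans (ltW (truncnS_gt _)) _; rewrite ler_nat; exact: leq_trans (Qm m).
  have nR : 0 <= n%:R^-1 :> R by rewrite invr_ge0.
  have rh := rho_cvg M1 zM' N0 Nn CN; rewrite -/C1 in rh.
  have rh1 : normc (rho z N n - 1) <= C1 / N%:R.
    by apply: le_trans rh _; rewrite ler_wpM2l// gerBl.
  have rh2 : normc (rho z N n) <= 2.
    apply: le_trans (ler_nc_sub _ 1) _; rewrite normc1.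
    have : C1 / N%:R <= 1 by rewrite ler_pdivrMr// mul1r.
    lra.
  have p2 : 0 < 2 ^+ m :> R by exact: exprn_gt0.
  rewrite Wn_rho; apply: le_trans (le_normcD _ _) _; rewrite [leRHS]mulrDl; apply: lerD.
    rewrite normcM nc_cexp ReN [alpha z * _]mulrC ReZ [ln _ * _]mulrC.
    apply: (@le_trans _ _ (expR (- (Re (alpha z) * ln n%:R)) *
      (normc (growth z N n) * expR (Re (alpha z) * ln N%:R) / 2 ^+ m))).
      by rewrite ler_wpM2l ?expR_ge0// hm0.
    by rewrite mulrA ler_wpM2r ?invr_ge0 ?(ltW p2)// mulrA mulrAC -mulrA -nc_rho.
  rewrite normcM mulrAC; apply: ler_pM; rewrite ?nc_ge0//.
    apply: le_trans rh1 _; rewrite ler_wpM2l// lef_pV2 ?posrE//.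
    by rewrite -natrX ler_nat.
  have Wz : z = (Re z)%:C + (0 +i* Im z) by case: (z) => x y /=; rewrite /GRing.add/= addr0 add0r.
  rewrite Wz; case/andP: rz => zb /andP[za1 za2].
  have nz : normc (0 +i* Im z) <= r.
    apply: le_trans (nc_le_ReIm _) _; rewrite /= normr0 add0r ger0_norm//; lra.
  by have [_ h] := hN1 _ _ zb nz; apply: h; exact: leq_trans (Qm m).
have mid m z n : (m1 <= m)%N -> rect b1 b2 0 a z -> (Q ^ m.+1 <= n)%N ->
    normc (Wn v n z - Wn v (Q ^ m.+1) z) <= D / 2 ^+ m.
  move=> mm rz Nn.
  have a0 : 0 <= a by case/andP: rz => _ /andP[]; exact: le_trans.
  have mN1 : (N1 <= m)%N by apply: leq_trans mm; rewrite /m1 !leq_max leqnn !orbT.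
  have mr : ((Num.truncn (16 / r)).+1 <= m)%N by apply: leq_trans mm; rewrite /m1 !leq_max leqnn !orbT.
  have p2 : 0 < 2 ^+ m :> R by exact: exprn_gt0.
  have pr : 2 * 2 ^- m <= r / 8.
    have : 16 / r <= 2 ^+ m.
      apply: le_trans (ltW (truncnS_gt _)) _; rewrite -natrX ler_nat.
      exact: leq_trans mr (ltnW (pow2 m)).
    rewrite ler_pdivrMr// ler_pdivrMr// => h; rewrite mulrAC ler_pdivlMr//; lra.
  have [z' zg [rz' zz1 zz2 dz]] := grid_round m rz (lexx 0) bg ag.
  have {}rz' : rect b1 b2 0 a z'.
    by case/andP: rz' => h1 /andP[_ h2]; rewrite /rect h1 zz2.
  have [zb /andP[za1 za2]] := andP rz.
  have zE y : y = (Re z)%:C + (y - (Re z)%:C) by rewrite addrC subrK.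
  have zs : normc (z - (Re z)%:C) <= r / 8.
    apply: le_trans (nc_le_ReIm _) _; rewrite ReD ImD ReN ImN/= subrr normr0 add0r subr0.
    by rewrite ger0_norm//; lra.
  have zs' : normc (z' - (Re z)%:C) <= r / 4.
    apply: le_trans (ler_nc_dist z _ _) _; rewrite ncB; lra.
  have lip k : (N1 <= k)%N -> normc (Wn v k z - Wn v k z') <= 8 * B / r / 2 ^+ m.
    move=> Nk; rewrite (zE z) (zE z').
    have bB y : normc y <= r -> normc (Wn v k ((Re z)%:C + y)) <= B.
      by move=> yr; have [_] := hN1 _ _ zb yr; exact.
    have zs2 : normc (z - (Re z)%:C) <= r / 4 by lra.
    apply: le_trans (approx_lipschitz r0 (Wn_approx v k (Re z) r) bB zs2 zs') _.
    rewrite opprB addrA subrK.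
    have -> : 8 * B / r / 2 ^+ m = 4 * B / r * (2 * 2 ^- m) by ring.
    by rewrite ler_wpM2l// divr_ge0 ?mulr_ge0 ?(ltW B0) ?(ltW r0).
  have g1 := grid_step m z' n mm zg rz' Nn.
  have QmN : (N1 <= Q ^ m.+1)%N by exact: leq_trans (Qm m).
  have g2 := lip n (leq_trans QmN Nn); have g3 := lip _ QmN.
  apply: le_trans (ler_nc_dist (Wn v n z') _ _) _.
  have := ler_nc_dist (Wn v (Q ^ m.+1) z') (Wn v n z') (Wn v (Q ^ m.+1) z).
  rewrite [normc (Wn v _ z' - Wn v _ z)]ncB => h.
  have -> : D / 2 ^+ m = 8 * B / r / 2 ^+ m + ((2 + C1 * B) / 2 ^+ m + 8 * B / r / 2 ^+ m).
    by rewrite /D; ring.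
  by rewrite lerD// (le_trans h)// lerD// ncB.
have D0 : 0 <= D.
  have h1 := mulr_ge0 C10 (ltW B0); have h2 : 0 <= 16 * B / r.
    by rewrite divr_ge0 ?(ltW r0)// mulr_ge0 ?(ltW B0).
  rewrite /D; lra.
exists (8 * D), (Q ^ m1.+1)%N => n nN z rz.
have [m [mm Qn e2 _]] := time_scale Q1 nN.
have Winf : normc (W z - Wn v (Q ^ m.+1) z) <= D / 2 ^+ m.
  apply/ler_addgt0Pr => e e0; have [N WN] := vW e e0.
  pose k := maxn N (Q ^ m.+1).
  have Nk : (N <= k)%N by exact: leq_maxl.
  have Qk : (Q ^ m.+1 <= k)%N by exact: leq_maxr.
  apply: le_trans (ler_nc_dist (Wn v k z) _ _) _; rewrite addrC; apply: lerD; first exact: mid.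
  have [zb /andP[za1 za2]] := andP rz.
  have zE : z = (Re z)%:C + (z - (Re z)%:C) by rewrite addrC subrK.
  rewrite ncB ltW// {1 2}zE; apply: WN => //.
  apply: le_trans (nc_le_ReIm _) _; rewrite ReD ImD ReN ImN/= subrr normr0 add0r subr0.
  by rewrite ger0_norm//; lra.
apply: le_trans (ler_nc_dist (Wn v (Q ^ m.+1) z) _ _) _.
apply: (@le_trans _ _ (2 * D * 2 ^- m)).
  by rewrite -mulrA mulr2n mulrDl mul1r [X in _ + X]ncB lerD// mid.
by have := ler_wpM2l D0 e2; lra.
Qed.

(** The factor [size x] brought down by differentiation is absorbed by raising the
    argument by [h]. *)
Lemma Sn_lipschitz (s : seq (seq bool)) z w h : Re w <= Re z -> 0 < h ->
  normc (z - w) <= h / 2 ->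
  normc (Sn s z - Sn s w) <= 2 * normc (z - w) / h * rSn s (Re z + h).
Proof.
move=> wz h0 zwh; rewrite /Sn -sumrB; apply: le_trans (nc_sum _ _ _) _.
rewrite /rSn mulr_sumr; apply: ler_sum => x _.
set k := (size x)%:R; set d := normc (z - w) in zwh *; have d0 : 0 <= d by exact: nc_ge0.
have k0 : 0 <= (size x)%:R :> R by [].
apply: le_trans (cexpB_le _ _) _; rewrite -mulrBl normcM nc_nat -/d Re_mul_nat.
have e1 : expR (d * (size x)%:R) <= expR (h * (size x)%:R / 2).
  by rewrite ler_expR mulrAC ler_wpM2r.
have e2 : h * (size x)%:R / 2 <= expR (h * (size x)%:R / 2).
  by apply: le_trans (expR_ge1Dx _); rewrite lerDr.
have e3 : expR (Re w * (size x)%:R) <= expR (Re z * (size x)%:R).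
  by rewrite ler_expR ler_wpM2r.
have -> : expR ((Re z + h) * (size x)%:R) = expR (h * (size x)%:R / 2) *
    expR (h * (size x)%:R / 2) * expR (Re z * (size x)%:R).
  by rewrite -!expRD; congr expR; field.
rewrite mulrA; apply: ler_pM; rewrite ?mulr_ge0 ?expR_ge0//.
have -> : 2 * d / h * (expR (h * (size x)%:R / 2) * expR (h * (size x)%:R / 2)) =
  (2 * d / h * expR (h * (size x)%:R / 2)) * expR (h * (size x)%:R / 2) by ring.
apply: ler_pM; rewrite ?mulr_ge0 ?expR_ge0//.
have -> : d * (size x)%:R = 2 * d / h * (h * (size x)%:R / 2) by field; rewrite gt_eqF.
by rewrite ler_wpM2l// divr_ge0 ?mulr_ge0 ?(ltW h0).
Qed.

(** With the scale of [time_scale], the factor [8 ^ m] is a small power of [n], absorbed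
    by [kappa]. Leaving the grid costs [rSn] at a slightly larger height, which is
    another small power of [n], absorbed by the mesh. *)
Lemma outer_rate v W b1 b2 r a c C kappa (g Q n0 : nat) :
  (1 < Q)%N -> 0 < r -> b2 - b1 <= g%:R -> pi <= g%:R :> R -> 0 <= c -> c < a -> 0 < C ->
  4 * (ln 2 / ln Q%:R) <= kappa ->
  disc_cvg v W b1 b2 r ->
  (exists m0, forall m, (m0 <= m)%N -> forall z, z \in grid b1 g m ->
    rect b1 b2 c pi z -> forall n, (n0 <= n)%N ->
    normc (Sn (external v n) z) <=
    8 ^+ m * C * expR ((2 * expR (Re z) - 1 - kappa) * ln n%:R)) ->
  exists (C' : R) (N : nat), forall n, (N <= n)%N -> forall z, rect b1 b2 a pi z ->
    normc (Sn (external v n) z) <=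
      C' * expR ((2 * expR (Re z) - 1 - ln 2 / ln Q%:R / 2) * ln n%:R).
Proof.
move=> Q1 r0 bg pig c0 ca C0 Qk vW [m0 hm0].
have [B B0 [N1 hN1]] := disc_cvg_bounded vW.
set k := ln 2 / ln Q%:R in Qk *.
have k0 : 0 < k by rewrite divr_gt0// ln_gt0// ltr1n.
pose h := Order.min r (Order.min 1 (k / (4 * expR (b2 + 1)))).
have h0 : 0 < h by rewrite !lt_min r0 ltr01 divr_gt0// mulr_gt0 ?expR_gt0.
have hr : h <= r by rewrite ge_min lexx.
have h1 : h <= 1 by rewrite !ge_min lexx orbT.
have hk : 4 * expR (b2 + 1) * h <= k.
  by rewrite mulrC -ler_pdivlMr ?mulr_gt0 ?expR_gt0// !ge_min lexx !orbT.
pose m1 := maxn m0 (maxn (Num.truncn (4 / h)).+1 (Num.truncn (1 / (a - c))).+1).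
exists (C + 16 * B / h), (maxn (maxn n0 N1) (Q ^ m1.+1))%N => n.
rewrite !geq_max => /andP[/andP[n0n N1n] Qn] z rz.
have [m [mm Qmn e2 e8]] := time_scale Q1 Qn.
have mm0 : (m0 <= m)%N by apply: leq_trans mm; exact: leq_maxl.
have big (t : R) : ((Num.truncn t).+1 <= m)%N -> t <= 2 ^+ m.
  move=> tm; apply: le_trans (ltW (truncnS_gt _)) _; rewrite -natrX ler_nat.
  by rewrite (leq_trans tm)// ltnW// ltn_expl.
have mh : 4 / h <= 2 ^+ m.
  by apply: big; apply: leq_trans mm; rewrite /m1 !leq_max leqnn !orbT.
have mc : 1 / (a - c) <= 2 ^+ m.
  by apply: big; apply: leq_trans mm; rewrite /m1 !leq_max leqnn !orbT.
have p2 : 0 < 2 ^+ m :> R by exact: exprn_gt0.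
have ac0 : 0 < a - c by rewrite subr_gt0.
have mc' : 2 ^- m <= a - c by rewrite invf_ple ?posrE// -div1r.
have mh' : 2 * 2 ^- m <= h / 2.
  have : 2 ^- m <= h / 4 by rewrite invf_ple ?posrE ?divr_gt0// invf_div.
  by set q := 2 ^- m; lra.
have [z' zg [rz' zz1 zz2 dz]] := grid_round m rz (ltW (le_lt_trans c0 ca)) bg pig.
have [/andP[zb1 zb2] _] := andP rz.
have {}rz' : rect b1 b2 c pi z'.
  case/andP: rz' => h2 /andP[h3 h4]; rewrite /rect h2 h4 andbT/=.
  by move: h3 mc'; set q := 2 ^- m; lra.
have l0 : 0 <= ln n%:R :> R.
  by rewrite ln_ge0// ler1n (leq_trans _ Qmn)// expn_gt0 (ltnW Q1).
set L := ln n%:R in l0 e2 e8 *.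
set al := 2 * expR (Re z) - 1.
have A1 : normc (Sn (external v n) z') <= C * expR ((al - k / 2) * L).
  apply: le_trans (hm0 m mm0 z' zg rz' n n0n) _.
  rewrite [8 ^+ m * C]mulrC -mulrA ler_pM2l//.
  apply: (@le_trans _ _ (expR (3 * k * L) * expR ((2 * expR (Re z') - 1 - kappa) * L))).
    by rewrite ler_wpM2r ?expR_ge0.
  rewrite -expRD -mulrDl ler_expR ler_wpM2r//.
  have : expR (Re z') <= expR (Re z) by rewrite ler_expR.
  by rewrite /al; lra.
have A2 : rSn (external v n) (Re z + h) <= B * expR ((al + k / 2) * L).
  have zb : b1 <= Re z <= b2 by rewrite zb1.
  have hh : normc (h%:C : R[i]) <= r by rewrite nc_real gtr0_norm.
  have [_ /(_ n N1n)] := hN1 (Re z) h%:C zb hh.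
  rewrite -rmorphD Wn_real nc_real ger0_norm ?mulr_ge0 ?expR_ge0 ?rSn_ge0//.
  rewrite expRN mulrC ler_pdivrMr ?expR_gt0// => /le_trans; apply.
  rewrite ler_pM2l// ler_expR ler_wpM2r// /al expRD.
  have e1 : expR h <= 1 + h * expR 1.
    have := expR_ge1Dx (- h) ; rewrite expRN -(ler_pM2l (expR_gt0 h)) mulfV ?gt_eqF ?expR_gt0//.
    have : expR h <= expR 1 by rewrite ler_expR.
    have := h0; set u := expR h; set u1 := expR 1; nra.
  have e3 : expR (Re z) * (h * expR 1) <= k / 4.
    have : expR (Re z) <= expR b2 by rewrite ler_expR.
    move: hk; rewrite expRD => hk zb2'.
    have := ler_wpM2r (mulr_ge0 (ltW h0) (expR_ge0 1)) zb2'; lra.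
  have := ler_wpM2l (expR_ge0 (Re z)) e1; lra.
have A3 : normc (Sn (external v n) z - Sn (external v n) z') <=
    16 * B / h * expR ((al - k / 2) * L).
  apply: le_trans (Sn_lipschitz _ zz1 h0 (le_trans dz mh')) _.
  have -> : 16 * B / h * expR ((al - k / 2) * L) =
      (2 * (2 * (4 * expR (- (k * L)))) / h) * (B * expR ((al + k / 2) * L)).
    have -> : (al - k / 2) * L = - (k * L) + (al + k / 2) * L by field.
    by rewrite expRD; ring.
  apply: ler_pM; rewrite ?rSn_ge0 ?divr_ge0 ?mulr_ge0 ?nc_ge0 ?(ltW h0)//.
  rewrite ler_pM2r ?invr_gt0// ler_pM2l//; apply: le_trans dz _.
  by rewrite ler_pM2l.
rewrite [leRHS]mulrDl; apply: le_trans (ler_nc_sub _ (Sn (external v n) z')) _.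
exact: lerD A1 A3.
Qed.
End Rates.

(** * The range of the saddle point *)

Section Rate.
Variable R : realType.
Implicit Types (b x y p : R) (z : R[i]).

(** The condition [1 < psi b] says that the p-th mean of the martingale at [b] can be
    controlled for some p > 1; the boundary case [psi b = 1] is the equation that
    defines the range of the theorem. *)
Definition psi b : R := 2 * expR b * (1 - b).

Lemma psi_lt_neg x y : x < y -> y <= 0 -> psi x < psi y.
Proof.
move=> xy y0; rewrite /psi -!mulrA ltr_pM2l//.
rewrite -(subrK x y) expRD [_ * expR x]mulrC -mulrA ltr_pM2l ?expR_gt0// subrK.
have d0 : y - x != 0 by rewrite subr_eq0 gt_eqF.
have y1 : 0 < 1 - y by lra.
have := expR_gt1Dx d0; rewrite -(ltr_pM2r y1); nra.
Qed.

Lemma psi_lt_pos x y : 0 < x -> x < y -> 0 < psi y -> psi y < psi x.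
Proof.
move=> x0 xy; rewrite /psi pmulr_rgt0 ?mulr_gt0 ?expR_gt0// => y1.
rewrite -!mulrA ltr_pM2l//.
rewrite -(subrK y x) expRD [_ * expR y]mulrC -mulrA ltr_pM2l ?expR_gt0// subrK.
have := expR_ge1Dx (x - y).
have x1 : 0 < 1 - x by lra.
rewrite -(ler_pM2r x1); nra.
Qed.

Lemma psi_gt1 bm bp b : psi bm = 1 -> psi bp = 1 -> bm < b < bp -> 1 < psi b.
Proof.
move=> m1 p1 /andP[mb bb]; have [b0|b0] := leP b 0.
  by rewrite -m1; exact: psi_lt_neg.
by rewrite -p1; apply: psi_lt_pos => //; rewrite p1.
Qed.

Lemma psi_ge_min b1 b2 b : 0 < psi b2 -> b1 <= b <= b2 ->
  Order.min (psi b1) (psi b2) <= psi b.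
Proof.
move=> p0 /andP[]; rewrite le_eqVlt => /predU1P[-> _|b1b]; first by rewrite ge_min lexx.
rewrite le_eqVlt => /predU1P[->|bb2]; first by rewrite ge_min lexx !orbT.
 have [b0|b0] := leP b 0.
  by rewrite ge_min (ltW (psi_lt_neg b1b b0)).
by rewrite ge_min (ltW (psi_lt_pos b0 bb2 p0)) orbT.
Qed.

Lemma expR_le_quad x : `|x| <= 2^-1 -> expR x <= 1 + x + 2 * x ^+ 2.
Proof.
rewrite ler_norml => /andP[x1 x2].
have x0 : 0 < 1 - x by lra.
have : expR x <= (1 - x)^-1.
  by rewrite -[leLHS]invrK -expRN lef_pV2 ?posrE ?expR_gt0// expR_ge1Dx.
move=> /le_trans; apply; rewrite -div1r ler_pdivrMr//; nra.
Qed.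

(** At [p = 1] the last difference vanishes and its derivative in [p] is
    [psi b - 1], bounded below on the segment; a second order expansion makes this
    uniform in [b]. *)
Lemma exists_moment_exponent b1 b2 : 1 < psi b1 -> 1 < psi b2 ->
  exists2 p, 1 < p <= 2 & exists2 eta : R, 0 < eta & forall b, b1 <= b <= b2 ->
    eta <= p * (2 * expR b - 1) - (2 * expR (p * b) - 1).
Proof.
move=> p1 p2; pose mu := Order.min (psi b1) (psi b2) - 1.
have mu0 : 0 < mu by rewrite subr_gt0 lt_min p1 p2.
pose X := 1 + `|b1| + `|b2|.
have X1 : 1 <= X by rewrite /X -addrA lerDl addr_ge0.
pose s := Order.min (2 * X)^-1 (mu / (8 * expR X * X ^+ 2)).
have E0 := expR_gt0 X.
have s0 : 0 < s.
  rewrite lt_min invr_gt0 divr_gt0 ?andbT ?mulr_gt0 ?exprn_gt0//; lra.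
have sX : s * X <= 2^-1.
  have : s <= (2 * X)^-1 by rewrite ge_min lexx.
  rewrite -div1r ler_pdivlMr; lra.
have smu : s * (8 * expR X * X ^+ 2) <= mu.
  have c0 : 0 < 8 * expR X * X ^+ 2 by rewrite mulr_gt0 ?mulr_gt0 ?exprn_gt0// (lt_le_trans ltr01).
  by rewrite -ler_pdivlMr// ge_min lexx orbT.
exists (1 + s); first by apply/andP; split; nra.
exists (s * mu / 2) => [|b bb]; first by rewrite divr_gt0// mulr_gt0.
have hpsi : mu + 1 <= psi b by rewrite subrK psi_ge_min// (lt_trans _ p2).
have bX : `|b| <= X.
  case/andP: bb => h1 h2; rewrite ler_norml /X.
  have := ler_norm b2; have := ler_norm (- b1); have := normr_ge0 b1; have := normr_ge0 b2.
  by rewrite normrN => *; apply/andP; split; lra.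
have sb : `|s * b| <= 2^-1.
  by rewrite normrM gtr0_norm// (le_trans _ sX)// ler_wpM2l// ltW.
have h := expR_le_quad sb.
have b2X : b ^+ 2 <= X ^+ 2.
  by rewrite -(real_normK (num_real b)) lerXn2r ?nnegrE//; lra.
have eX : expR b <= expR X by rewrite ler_expR (le_trans (ler_norm _)).
have eb := expR_gt0 b.
have -> : (1 + s) * b = b + s * b by ring.
rewrite expRD.
have h2 : s * (4 * expR b * b ^+ 2) <= mu / 2.
  have := ler_pM (ltW eb) (sqr_ge0 b) eX b2X => h3.
  have := ler_wpM2l (ltW s0) h3; lra.
have h3 := ler_wpM2l (ltW eb) h.
have h4 := ler_wpM2l (ltW s0) h2; have h5 := ler_wpM2l (ltW s0) hpsi.
rewrite /psi in h5; move: h3 h4 h5; rewrite exprMn.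
set x := expR b; set y := expR (s * b); move=> h3 h4 h5; lra.
Qed.
End Rate.

Section AlmostSureRates.
Context d (T : measurableType d) (R : realType) (P : probability T R).
Variables (V : nat -> T -> seq bool) (hV : is_bst_process P V).
Implicit Types (z : R[i]) (W : R[i] -> R[i]).

Lemma one_sub_cos_le (u : R) : 0 <= u -> 1 - cos u <= u * expR u.
Proof.
move=> u0; have := cexp_sub1_le (0 +i* u).
have -> : normc (0 +i* u) = u by rewrite ncE/= expr0n add0r sqrtr_sqr ger0_norm.
move=> /(le_trans (Re_le_nc _)); rewrite [Re (_ - _)]ReD ReN Re_cexp/= expR0 mul1r.
by apply: le_trans; rewrite -normrN opprB ler_norm.
Qed.

Let tilt_le (x x1 y y1 p delta : R) : 1 <= p -> 0 < x1 -> x1 <= x -> y <= y1 -> y1 < 1 ->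
  delta <= x1 * (1 - y1) -> p * (2 * (x * y) - 1) + 2 * delta <= p * (2 * x - 1).
Proof.
move=> p1 x0 xx yy y1' h.
have h1 : delta <= x * (1 - y).
  by apply: le_trans h _; apply: ler_pM => //; lra.
have h2 : delta <= p * (x * (1 - y)).
  by apply: le_trans h1 _; rewrite ler_peMl// mulr_ge0; lra.
have -> : p * (2 * x - 1) = p * (2 * (x * y) - 1) + 2 * (p * (x * (1 - y))) by ring.
by rewrite lerD2l ler_pM2l.
Qed.

Let tilt_ge (x y p eta t : R) : 1 < p <= 2 -> 0 <= x * (1 - y) -> x * (1 - y) <= eta / 8 ->
  eta <= p * (2 * x - 1) - t -> eta / 2 <= p * (2 * (x * y) - 1) - t.
Proof.
move=> /andP[p1 p2] h0 h1.
have -> : p * (2 * x - 1) = p * (2 * (x * y) - 1) + 2 * (p * (x * (1 - y))) by ring.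
have h2 : p * (x * (1 - y)) <= 2 * (eta / 8) by apply: ler_pM => //; lra.
lra.
Qed.

(** The height [a] at which the two regions meet is taken so small that the moment
    condition on the real segment survives up to [a]. The gain [delta] of the outer
    region then comes from the cosine at [a / 2], and the ratio [Q] of successive time
    scales is taken large in terms of both gains. *)
Theorem profile_rates (b1 b2 r a0 : R) : b1 <= b2 -> 1 < psi b1 -> 1 < psi b2 -> 0 < r -> 0 < a0 ->
  exists (a eps : R), [/\ 0 < a <= a0, a <= pi, 0 < eps &
  {ae P, forall w, forall W, disc_cvg (V^~ w) W b1 b2 r ->
    exists (C : R) (N : nat), forall n, (N <= n)%N ->
      (forall z, rect b1 b2 0 a z -> normc (Wn (V^~ w) n z - W z) <= C * expR (- (eps * ln n%:R))) /\
      (forall z, rect b1 b2 a pi z -> normc (Sn (external (V^~ w) n) z) <=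
         C * expR ((2 * expR (Re z) - 1 - eps) * ln n%:R))}].
Proof.
move=> b12 p1 p2 r0 a00.
have [p p12 [eta eta0 heta]] := exists_moment_exponent p1 p2.
have [p1' p2'] := andP p12.
have p0 : 0 < p by exact: lt_trans p1'.
pose X := `|b1| + `|b2|.
pose M := 2 * expR (2 * X) + 1.
have X0 : 0 <= X by exact: addr_ge0.
have bX b : b1 <= b <= b2 -> b <= X /\ p * b <= 2 * X.
  move=> /andP[h1 h2]; have := ler_norm b2; have := normr_ge0 b1 => ? ?.
  have bX : b <= X by rewrite /X; lra.
  by split => //; nra.
have M1 : 1 <= M by rewrite /M lerDr mulr_ge0 ?expR_ge0.
pose g := (Num.truncn (Order.max (b2 - b1) 4)).+1.
have gE : Order.max (b2 - b1) 4 <= g%:R by exact: ltW (truncnS_gt _).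
have bg : b2 - b1 <= g%:R by rewrite (le_trans _ gE)// le_max lexx.
have g4 : 4 <= g%:R :> R by rewrite (le_trans _ gE)// le_max lexx orbT.
have pi4 : (pi : R) <= 4 by have := @pihalf_lt2 R; rewrite ltr_pdivrMr// => /ltW; lra.
pose a := Order.min (Order.min a0 1) (Order.min (r / 8) (eta / (8 * expR (X + 1)))).
have E0 := expR_gt0 (X + 1).
have a_gt0 : 0 < a by rewrite !lt_min a00 ltr01 !divr_gt0// mulr_gt0.
have aa0 : a <= a0 by rewrite !ge_min lexx.
have a1 : a <= 1 by rewrite !ge_min lexx !orbT.
have ar : a <= r / 8 by rewrite !ge_min lexx !orbT.
have aeta : 8 * expR (X + 1) * a <= eta.
  by rewrite mulrC -ler_pdivlMr ?mulr_gt0// !ge_min lexx !orbT.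
have api : a <= pi by apply: le_trans a1 _; have := @pi_ge2 R; lra.
pose c := a / 2.
have c0 : 0 < c by rewrite divr_gt0.
have ca : c < a by rewrite /c; lra.
have cosc : cos c < 1 by apply: cos_lt1; apply/andP; split; lra.
pose delta := Order.min (eta / 2) (expR b1 * (1 - cos c)).
have delta0 : 0 < delta by rewrite lt_min divr_gt0// mulr_gt0 ?expR_gt0// subr_gt0.
have deta : 2 * delta <= eta.
  have : delta <= eta / 2 by rewrite ge_min lexx.
  lra.
have dcos : delta <= expR b1 * (1 - cos c) by rewrite ge_min lexx orbT.
pose Y := Order.max (Order.max (ln M) (ln 2)) (Order.max (ln 32 / (eta / 2)) (4 * ln 2 / (delta / p))).
pose Q := (Num.truncn (expR Y)).+1.
have QE : expR Y <= Q%:R by exact: ltW (truncnS_gt _).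
have QR : 0 < Q%:R :> R by rewrite ltr0n.
have lnQ : Y <= ln Q%:R by rewrite -ler_expR lnK.
have YY t : t <= Y -> t <= ln Q%:R by move=> /le_trans; exact.
have MQ : M <= Q%:R.
  rewrite -ler_ln ?posrE//; last lra.
  by apply: YY; rewrite !le_max lexx.
have l2 : 0 < ln 2 :> R by rewrite ln_gt0// ltr1n.
have Q2 : 2 <= Q%:R :> R.
  rewrite -ler_ln ?posrE//.
  by apply: YY; rewrite !le_max lexx !orbT.
have Q1 : (1 < Q)%N by rewrite -(ler_nat R).
have lQ0 : 0 < ln Q%:R :> R by rewrite ln_gt0// ltr1n.
have Q32 : 32 <= Q%:R `^ (eta / 2).
  rewrite /powR gt_eqF// -[leLHS]lnK ?posrE// ler_expR.
  have : ln 32 / (eta / 2) <= ln Q%:R by apply: YY; rewrite !le_max lexx !orbT.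
  by rewrite ler_pdivrMr ?divr_gt0// mulrC.
have Qk : 4 * (ln 2 / ln Q%:R) <= delta / p.
  have : 4 * ln 2 / (delta / p) <= ln Q%:R by apply: YY; rewrite !le_max lexx !orbT.
  have dp : 0 < delta / p by rewrite divr_gt0.
  by rewrite ler_pdivrMr// (mulrA 4) ler_pdivrMr// [ln Q%:R * _]mulrC.
have aM z : b1 <= Re z <= b2 -> normc (alpha z) <= M.
  move=> /bX[zX _]; apply: le_trans (nc_alpha_le _) _; rewrite /M lerD2r ler_pM2l// ler_expR.
  lra.
have pM z : b1 <= Re z <= b2 -> 2 * expR (p * Re z) + 1 <= M.
  by move=> /bX[_ zX]; rewrite /M lerD2r ler_pM2l// ler_expR.
have zM1 z : b1 <= Re z <= b2 -> 2 * expR (Re z) + 1 <= M.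
  by move=> /bX[zX _]; rewrite /M lerD2r ler_pM2l// ler_expR; lra.
have in1 z : rect b1 b2 0 a z -> normc (alpha z) <= M /\
     eta / 2 <= p * Re (alpha z) - (2 * expR (p * Re z) - 1).
  move=> /andP[zb /andP[z0 za]]; split; first exact: aM.
  have := heta _ zb; rewrite [in X in _ -> X]Re_alpha => he.
  have hc := one_sub_cos_le z0.
  have h1 : expR (Re z) * (Im z * expR (Im z)) <= expR (X + 1) * a.
    have [zX _] := bX _ zb.
    have -> : expR (X + 1) * a = expR X * (a * expR 1) by rewrite expRD; ring.
    apply: ler_pM; rewrite ?expR_ge0 ?mulr_ge0 ?expR_ge0// ?ler_expR//.
    by apply: ler_pM; rewrite ?expR_ge0// ler_expR (le_trans za).
  have h2 : expR (Re z) * (1 - cos (Im z)) <= eta / 8.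
    have := ler_wpM2l (expR_ge0 (Re z)) hc; lra.
  apply: tilt_ge p12 _ h2 he.
  by rewrite mulr_ge0 ?expR_ge0// subr_ge0 cos_le1.
have out1 z : rect b1 b2 c pi z -> [/\ normc (alpha z) <= M,
     p * Re (alpha z) + 2 * delta <= p * (2 * expR (Re z) - 1),
     2 * expR (p * Re z) - 1 + 2 * delta <= p * (2 * expR (Re z) - 1),
     2 * expR (Re z) + 1 <= M & 2 * expR (p * Re z) + 1 <= M].
  move=> /andP[zb /andP[zc zpi]]; split; [exact: aM| | |exact: zM1|exact: pM].
    rewrite Re_alpha; have : cos (Im z) <= cos c.
      have [<-|cz] := eqVneq c (Im z); first exact: lexx.
      rewrite ltW// ltr_cos ?in_itv/= ?(ltW c0) ?(ltW (lt_le_trans ca api)) ?zpi ?andbT//.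
        by rewrite lt_neqAle cz.
      exact: le_trans (ltW c0) zc.
    move=> cc; have zx : expR b1 <= expR (Re z) by rewrite ler_expR; case/andP: zb.
    exact: tilt_le (ltW p1') (expR_gt0 b1) zx cc cosc dcos.
  by have := heta _ zb; lra.
have inM z : rect b1 b2 0 a z -> 2 * expR (p * Re z) + 1 <= M by move=> /andP[/pM].
have iae := inner_grid hV p12 M1 g (divr_gt0 eta0 (ltr0n _ 2)) MQ Q32 in1 inM.
have [n0 [C [C0 oae]]] := outer_grid hV p12 M1 g delta0 out1.
have k0 : 0 < ln 2 / ln Q%:R :> R by rewrite divr_gt0.
exists a, (ln 2 / ln Q%:R / 2); split; rewrite ?a_gt0// ?divr_gt0//.
apply: filterS2 iae oae => w hi ho W vW.
have in2 z : rect b1 b2 0 a z -> normc (alpha z) <= M by move=> /in1[].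
have ag : a <= g%:R by lra.
have [C1 [N1 h1]] := inner_rate M1 MQ Q1 r0 bg ag ar in2 vW hi.
have pig : pi <= g%:R :> R by exact: le_trans pi4 g4.
have [C2 [N2 h2]] := outer_rate Q1 r0 bg pig (ltW c0) ca C0 Qk vW ho.
exists (`|C1| + `|C2|), (maxn 1 (maxn N1 N2)) => n; rewrite !geq_max => /and3P[n1 n1n n2n].
have l0 : 0 <= ln n%:R :> R by rewrite ln_ge0// ler1n.
split=> z rz.
  apply: le_trans (h1 n n1n z rz) _; apply: le_trans (ler_wpM2r (expR_ge0 _) (ler_norm C1)) _.
  apply: ler_pM; rewrite ?expR_ge0 ?lerDl// ler_expR lerN2 ler_wpM2r//; lra.
apply: le_trans (h2 n n2n z rz) _; rewrite ler_wpM2r ?expR_ge0//.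
by rewrite (le_trans (ler_norm _))// lerDr.
Qed.
End AlmostSureRates.

(** * Primitives of oscillating and Gaussian functions *)

Section Primitives.
Variable R : realType.
Implicit Types (a b k t u x y : R) (z : R[i]).
Local Notation mu := (@lebesgue_measure R).

Lemma mean_value_le (f h f' h' : R -> R) a b : a <= b ->
  (forall t, a <= t <= b -> is_derive t 1 f (f' t)) ->
  (forall t, a <= t <= b -> is_derive t 1 h (h' t)) ->
  (forall t, a <= t <= b -> `|f' t| <= h' t) ->
  `|f b - f a| <= h b - h a.
Proof.
move=> ab df dh fh.
have key (c : R) : (c == 1) || (c == -1) -> c * (f b - f a) <= h b - h a.
  move=> c1; pose phi t := c * f t - h t.
  have dphi t : a <= t <= b -> is_derive t 1 phi (c * f' t - h' t).
    by move=> tab; have := df t tab; have := dh t tab => *; apply: is_deriveB; apply: is_deriveZ.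
  have [] := @MVT_segment _ phi (fun t => c * f' t - h' t) a b ab.
  - by move=> t /[!in_itv]/= /andP[t0 t1]; apply: dphi; rewrite !ltW.
  - apply/continuous_in_subspaceT => t; rewrite inE/= in_itv/= => tab.
    by apply: differentiable_continuous; apply/derivable1_diffP; have [] := dphi t tab.
  move=> t; rewrite in_itv/= => tab.
  have cle : c * f' t - h' t <= 0.
    have := fh t tab; rewrite ler_norml => /andP[? ?].
    by case/orP: c1 => /eqP ->; lra.
  have := mulr_le0_ge0 cle (_ : 0 <= b - a); rewrite subr_ge0 => /(_ ab) + e.
  by rewrite -e /phi; lra.
rewrite ler_norml; apply/andP; split; last by rewrite -[leLHS]mul1r key ?eqxx.
by rewrite lerNl -mulN1r key ?eqxx ?orbT.
Qed.

Lemma gauss_primitive : exists2 E : R -> R,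
  forall x, is_derive x 1 E (expR (- x ^+ 2)) &
  E x - E 0 @[x --> +oo] --> Num.sqrt pi / 2.
Proof.
pose E x := (\int[mu]_(t in [set` Interval -oo%O (BRight x)]) gauss_fun t)%R.
have iE x : mu.-integrable [set` Interval -oo%O (BRight x)] (EFin \o (@gauss_fun R)).
  by apply: integrableS integrableT_gauss.
exists E => [x|].
  have xx : x < x + 1 by rewrite ltrDl.
  have h := @continuous_FTC1 R gauss_fun -oo%O x (x + 1) xx (iE _).
  cbv zeta in h.
  have [|dE Ex] := h _ (@continuous_gauss_fun R x); first by rewrite ltNyr.
  by apply: DeriveDef; [exact: dE|rewrite -derive1E; exact: Ex].
have EE x : 0 <= x -> E x - E 0 = gauss_integral_proof.integral0_gauss x.
  move=> x0; rewrite /E Rintegral_itvB ?bnd_simp//.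
  rewrite Rintegral_itv_obnd_cbnd; first by [].
  by apply: integrableS integrableT_gauss.
have : Num.sqrt (@gauss_integral_proof.integral0_gauss R x ^+ 2) @[x --> +oo]
    --> Num.sqrt (pi / 4).
  apply: continuous_cvg => //;
    [exact: sqrt_continuous|exact: gauss_integral_proof.cvg_integral0_gauss_sqr].
rewrite sqrtrM ?pi_ge0// sqrtrV// (_ : 4 = 2 ^+ 2); last by rewrite expr2 -natrM.
rewrite sqrtr_sqr ger0_norm//; apply: cvg_trans.
apply: near_eq_cvg; near=> x.
rewrite sqrtr_sqr ger0_norm ?gauss_integral_proof.integral0_gauss_ge0// EE//.
Unshelve. all: by end_near.
Qed.

(** Beyond [x], the function [expR (- t ^+ 2)] is at most [expR (- (x * t))], which has
    an explicit primitive. *)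
Lemma gauss_primitive_tail (E : R -> R) : (forall x, is_derive x 1 E (expR (- x ^+ 2))) ->
  E x - E 0 @[x --> +oo] --> Num.sqrt pi / 2 ->
  forall x, 1 <= x -> `|E x - E 0 - Num.sqrt pi / 2| <= expR (- x ^+ 2).
Proof.
move=> dE cE x x1; apply/ler_addgt0Pr => e e0.
have x0 : 0 < x by exact: lt_le_trans x1.
move/cvgrPdist_le : cE => /(_ e e0) cE.
near +oo_R => y.
have xy : x <= y by near: y; apply: nbhs_pinfty_ge; exact: num_real.
have h1 : `|E y - E x| <= expR (- x ^+ 2).
  pose h t := - (expR (- (x * t)) / x).
  have dh t : is_derive t 1 h (expR (- (x * t))).
    by rewrite /h; pointwise_derivative; rewrite /=; field; rewrite gt_eqF.
  have fh t : x <= t <= y -> `|expR (- t ^+ 2)| <= expR (- (x * t)).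
    move=> /andP[xt _]; rewrite ger0_norm ?expR_ge0// ler_expR lerN2 expr2.
    by rewrite ler_wpM2r// (le_trans (ltW x0)).
  have := mean_value_le xy (fun t _ => dE t) (fun t _ => dh t) fh.
  move=> /le_trans; apply; rewrite /h opprK addrC -expr2.
  apply: (@le_trans _ _ (expR (- x ^+ 2) / x)).
    by rewrite lerBlDr lerDl divr_ge0 ?expR_ge0 ?ltW.
  by rewrite ler_pdivrMr// ler_peMr// expR_ge0.
have h2 : `|Num.sqrt pi / 2 - (E y - E 0)| <= e.
  by near: y; exact: cE.
have -> : E x - E 0 - Num.sqrt pi / 2 = - (E y - E x) - (Num.sqrt pi / 2 - (E y - E 0)) by ring.
by rewrite (le_trans (ler_normB _ _))// normrN lerD.
Unshelve. all: by end_near.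
Qed.

(** The derivatives at 0 of [expR (- x ^+ 2 / 2)], which are also the Gaussian moments
    with the power [i ^ q] of the imaginary unit included. *)
Fixpoint gm (q : nat) : R :=
  match q with 0 => 1 | 1 => 0 | q'.+2 => - q'.+1%:R * gm q' end.

Definition rq (q : nat) : R := Re ((0 +i* 1 : R[i]) ^+ q).

Lemma rqSS q : rq q.+2 = - rq q.
Proof.
rewrite /rq -addn2 exprD (_ : (0 +i* 1 : R[i]) ^+ 2 = -1) ?mulrN1 ?ReN//.
by rewrite expr2; apply: complexP => /=; ring.
Qed.

Lemma normr_rq q : `|rq q| <= 1.
Proof.
apply: le_trans (Re_le_nc _) _; rewrite ncX ncE/= expr0n expr1n add0r sqrtr1 expr1n.
exact: lexx.
Qed.

(** By parts, from order [q] to order [q.+2]; odd orders contribute nothing, as the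
    odd powers of [0 +i* u] are imaginary. *)
Lemma gauss_moment_primitive q : exists2 C, 0 <= C & forall k a,
  1 <= k -> 0 < a <= 1 -> 2 <= k * a ^+ 2 ->
  exists2 H : R -> R,
    forall u, is_derive u 1 H (expR (- (k * u ^+ 2 / 2)) * (rq q * u ^+ q)) &
    `|H a - H 0 - Num.sqrt (pi / 2) * (Num.sqrt k)^-1 ^+ q.+1 * gm q| <=
      C * expR (- (k * a ^+ 2 / 2)).
Proof.
suff : (exists2 C, 0 <= C & forall k a,
  1 <= k -> 0 < a <= 1 -> 2 <= k * a ^+ 2 ->
  exists2 H : R -> R,
    forall u, is_derive u 1 H (expR (- (k * u ^+ 2 / 2)) * (rq q * u ^+ q)) &
    `|H a - H 0 - Num.sqrt (pi / 2) * (Num.sqrt k)^-1 ^+ q.+1 * gm q| <=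
      C * expR (- (k * a ^+ 2 / 2))) /\
  (exists2 C, 0 <= C & forall k a,
  1 <= k -> 0 < a <= 1 -> 2 <= k * a ^+ 2 ->
  exists2 H : R -> R,
    forall u, is_derive u 1 H (expR (- (k * u ^+ 2 / 2)) * (rq q.+1 * u ^+ q.+1)) &
    `|H a - H 0 - Num.sqrt (pi / 2) * (Num.sqrt k)^-1 ^+ q.+2 * gm q.+1| <=
      C * expR (- (k * a ^+ 2 / 2))) by case.
elim: q => [|q [ih0 ih1]]; split => //; last first.
- have [C C0 hC] := ih0; exists (1 + q.+1%:R * C) => [|k a k1 a01 ka].
    by rewrite addr_ge0// mulr_ge0.
  have [H dH Ha] := hC k a k1 a01 ka.
  have k0 : 0 < k by exact: lt_le_trans k1.
  pose H2 u := k^-1 * (rq q * (u ^+ q.+1 * expR (- (k * u ^+ 2 / 2))) + (- q.+1%:R) * H u).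
  exists H2 => [u|].
    have := dH u => dHu; rewrite /H2; pointwise_derivative.
    rewrite /= rqSS !exprS; set e := expR _; set n := q.+1%:R; set r := rq q.
    set v := u ^+ q; field; rewrite gt_eqF//.
  set e := expR (- (k * a ^+ 2 / 2)) in Ha *.
  rewrite /H2 expr0n/= mul0r mulr0 add0r -/e.
  set t := (Num.sqrt k)^-1 in Ha *; set m := Num.sqrt (pi / 2) in Ha *.
  have tk : t ^+ 2 = k^-1 by rewrite /t exprVn sqr_sqrtr ?ltW.
  have gmE : gm q.+2 = - q.+1%:R * gm q by [].
  have -> : t ^+ q.+3 = t ^+ q.+1 * k^-1 by rewrite -tk -exprD addn2.
  set n := q.+1%:R in gmE *.
  have -> : k^-1 * (rq q * (a ^+ q.+1 * e) + - n * H a) - k^-1 * (- n * H 0) -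
      m * (t ^+ q.+1 * k^-1) * gm q.+2 =
      k^-1 * (rq q * a ^+ q.+1 * e - n * (H a - H 0 - m * t ^+ q.+1 * gm q)).
    by rewrite gmE; ring.
  have e0 : 0 <= e by exact: expR_ge0.
  have n0 : 0 <= n by [].
  have ki : k^-1 <= 1 by rewrite invf_le1.
  have ki0 : 0 <= k^-1 by rewrite invr_ge0 ltW.
  have b1 : `|rq q * a ^+ q.+1| <= 1.
    rewrite normrM mulr_ile1//; first exact: normr_rq.
    by rewrite normrX; case/andP: a01 => /ltW ? ?; rewrite exprn_ile1// ger0_norm.
  rewrite normrM ger0_norm//; apply: (@le_trans _ _ (1 * ((1 + n * C) * e))); last by rewrite mul1r.
  apply: ler_pM => //; rewrite (le_trans (ler_normB _ _))// mulrDl; apply: lerD.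
    by rewrite normrM (ger0_norm e0) ler_wpM2r.
  by rewrite normrM (ger0_norm n0) -(mulrA n) ler_wpM2l.
- exists 0 => // k a k1 a01 ka; exists (fun=> 0) => [u|].
    by pointwise_derivative; rewrite /rq expr1/= mul0r mulr0.
  by rewrite /= mulr0 !subr0 normr0 mul0r.
- have [E dE cE] := gauss_primitive; have tE := gauss_primitive_tail dE cE.
  exists 2 => // k a k1 /andP[a0 a1] ka.
  have k0 : 0 < k by exact: lt_le_trans k1.
  pose c := Num.sqrt (k / 2).
  have c2 : c ^+ 2 = k / 2 by rewrite sqr_sqrtr// divr_ge0// ltW.
  have c0 : 0 < c by rewrite sqrtr_gt0 divr_gt0.
  exists (fun u => c^-1 * E (c * u)) => [u|].
    have dEc : is_derive u 1 (fun u => E (c * u)) (expR (- (c * u) ^+ 2) * c).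
      have := @is_derive1_comp R E (fun u => c * u) u (expR (- (c * u) ^+ 2)) c (dE _).
      by apply; pointwise_derivative; rewrite /=; ring.
    pointwise_derivative; rewrite /= mul0r add0r mulrCA mulVf ?gt_eqF// mulr1.
    by rewrite /rq !expr0 !mulr1; congr expR; rewrite exprMn c2; ring.
  have ca : 1 <= c * a.
    rewrite -(@expr_ge1 _ 2)// ?mulr_ge0 ?(ltW c0) ?(ltW a0)//.
    by rewrite exprMn c2; lra.
  have := tE _ ca; rewrite exprMn c2 -mulrBr mulr0 => h.
  have e1 : Num.sqrt (pi / 2) * (Num.sqrt k)^-1 = c^-1 * (Num.sqrt pi / 2).
    rewrite /c !sqrtrM ?pi_ge0 ?(ltW k0)// sqrtrV//.
    have := sqr_sqrtr (ler0n R 2).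
    set s := Num.sqrt 2.
    have s2 : s != 0 :> R by rewrite gt_eqF ?sqrtr_gt0.
    have sk : Num.sqrt k != 0 by rewrite gt_eqF ?sqrtr_gt0.
    by move=> e2; rewrite -e2; field; rewrite s2 sk.
  rewrite expr1 mulr1 e1 -mulrBr normrM gtr0_norm ?invr_gt0//.
  have c2' : c^-1 <= 2.
    rewrite invf_ple ?posrE// -(@ler_pXn2r _ 2)// ?nnegrE ?(ltW c0)// c2 expr2.
    lra.
  apply: ler_pM; rewrite ?invr_ge0 ?(ltW c0)//.
  apply: le_trans h _; rewrite ler_expR; lra.
Qed.

Lemma sin_nat_pi n : sin (n%:R * pi) = 0 :> R.
Proof.
elim: n => [|n ih]; first by rewrite mul0r sin0.
by rewrite -natr1 mulrDl mul1r sinDpi ih oppr0.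
Qed.

Lemma cos_primitive (m : int) : exists2 H : R -> R,
  forall u, is_derive u 1 H (cos (m%:~R * u)) & H pi - H 0 = if m == 0 then pi else 0.
Proof.
have [->|m0] := eqVneq m 0.
  exists id; last by rewrite subr0.
  by move=> u; rewrite mul0r cos0; exact: is_derive_id.
have mR : m%:~R != 0 :> R by rewrite intr_eq0.
exists (fun u => sin (m%:~R * u) / m%:~R) => [u|].
  by pointwise_derivative; rewrite /=; field.
rewrite mulr0 sin0 mul0r subr0.
suff -> : sin (m%:~R * pi) = 0 :> R by rewrite mul0r.
case: m {m0 mR} => n; first exact: sin_nat_pi.
by rewrite NegzE rmorphN mulNr sinN sin_nat_pi oppr0.
Qed.

(** Fourier inversion: only the nodes at depth [k] survive the integration over the
    imaginary direction. The integral is expressed as the increment of a primitive, so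
    that integrals can be compared by the mean value inequality. *)
Lemma profile_primitive (s : seq (seq bool)) b (k : nat) : exists2 H : R -> R,
  forall u, is_derive u 1 H (Re (cexp (- (k%:R * (0 +i* u))) * Sn s (b +i* u))) &
  H pi - H 0 = pi * expR (b * k%:R) * (count (fun v : seq bool => size v == k) s)%:R.
Proof.
elim: s => [|x s [H dH H01]].
  exists (fun=> 0) => [u|]; last by rewrite /= mulr0 subrr.
  by pointwise_derivative; rewrite /Sn big_nil mulr0.
have [I dI I01] := cos_primitive ((size x)%:Z - k%:Z).
exists (fun u => expR (b * (size x)%:R) * I u + H u) => [u|].
  have dHu := dH u; have dIu := dI u.
  pointwise_derivative; rewrite /Sn big_cons mulrDr [in RHS]ReD -/(Sn s _) mul0r add0r; congr (_ + _).
  rewrite -cexpD Re_cexp !(ReD, ImD, ReN, ImN) !real_natc ReZ ImZ.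
  have eR (y y' c : R) : Re ((y +i* y') * c%:C) = y * c by rewrite ReM/= mulr0 subr0.
  have eI (y y' c : R) : Im ((y +i* y') * c%:C) = y' * c by rewrite ImM/= mulr0 add0r.
  rewrite eR eI [Re _]/= [Im _]/= mulr0 oppr0 add0r.
  by congr (_ * cos _); rewrite rmorphB/= -!pmulrn; ring.
rewrite opprD addrACA -mulrBr I01 H01 /= natrD mulrDr; congr (_ + _).
rewrite subr_eq0 eqz_nat; case: eqP => [->|_]; last by rewrite !mulr0.
by rewrite mulr1 mulrC.
Qed.
End Primitives.

(** * Bell polynomials *)

Section BellRecursion.
Variables (K : numFieldType) (A : comAlgType K).
Implicit Types (x y z : nat -> A) (n N : nat).

(** The truncated exponent and the truncated exponential in the definition of
    the Bell polynomials. *)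
Definition bser z N : {poly A} := \sum_(1 <= i < N.+1) ((i`!%:R^-1 : K) *: z i)%:P * 'X^i.
Definition bsum z N : {poly A} := \sum_(m < N.+1) ((m`!%:R^-1 : K)%:A)%:P * bser z N ^+ m.

Lemma coef_bser z N i : (i <= N)%N -> (bser z N)`_i = if i is 0 then 0 else (i`!%:R^-1 : K) *: z i.
Proof.
move=> iN; rewrite /bser coef_sum.
under eq_bigr do rewrite coefCM coefXn.
case: i iN => [_|i iN].
  by rewrite big_nat big1// => -[|j]// _; rewrite mulr0.
rewrite (bigD1_seq i.+1) ?mem_index_iota ?iota_uniq//= eqxx mulr1 big1 ?addr0// => j ji.
by rewrite eq_sym (negPf ji) mulr0.
Qed.

Lemma bserD x y N : bser (fun i => x i + y i) N = bser x N + bser y N.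
Proof. by rewrite -big_split; apply: eq_bigr => i _; rewrite scalerDr polyCD mulrDl. Qed.

Lemma coef_mulX_exp (p : {poly A}) N n : p`_0 = 0 -> (n < N)%N -> (p ^+ N)`_n = 0.
Proof.
move=> p0; elim: N n => [//|N ih] n nN; rewrite exprS coefM big1// => -[i iN] _ /=.
case: i iN => [|i] iN; first by rewrite p0 mul0r.
by rewrite ih ?mulr0//; lia.
Qed.

Lemma scale_invfactS (a : A) m : ((m.+1`!%:R^-1 : K) *: a) *+ m.+1 = (m`!%:R^-1 : K) *: a.
Proof.
rewrite scalerMnl; congr (_ *: _).
by rewrite factS natrM invfM -[LHS]mulr_natr mulrAC mulVf ?mul1r// pnatr_eq0.
Qed.

(** The exponent has no constant term, so truncating the exponential series at [N]
    affects its differential equation only from degree [N] on. *)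
Lemma coef_deriv_bsum z N n : (n < N)%N -> ((bsum z N)^`())`_n = (bsum z N * (bser z N)^`())`_n.
Proof.
move=> nN; set p := bser z N.
have p0 : p`_0 = 0 by rewrite coef_bser.
have -> : (bsum z N)^`() = bsum z N * p^`() - ((N`!%:R^-1 : K)%:A)%:P * p ^+ N * p^`().
  rewrite -mulrBl /bsum -/p [X in (X - _) * _]big_ord_recr/= addrK raddf_sum/=.
  rewrite big_ord_recl/= expr0 mulr1 derivC add0r mulr_suml; apply: eq_bigr => m _.
  rewrite derivM derivC mul0r add0r deriv_exp/= mulrnAr -mulrnAl -[RHS]mulrA.
  rewrite -polyCMn scale_invfactS; congr (_ * _); exact: mulrC.
by rewrite coefB [X in _ - X]coefM big1 ?subr0// => -[i iN] _ /=; rewrite coefCM coef_mulX_exp ?mulr0 ?mul0r//; lia.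
Qed.

Lemma coef0_bsum z N : (bsum z N)`_0 = 1.
Proof.
have p0 : (bser z N)`_0 = 0 by rewrite coef_bser.
rewrite /bsum big_ord_recl/= expr0 mulr1 fact0 invr1 scale1r coefD coefC/= coef_sum.
rewrite big1 ?addr0// => m _; rewrite coefCM -horner_coef0 horner_exp horner_coef0 p0.
by rewrite expr0n/= mulr0.
Qed.

(** The coefficients of a solution of [b' = b * z'], where [z] is the exponential
    generating series of the variables. *)
Definition bell_rec z N (b : nat -> A) := b 0%N = 1 /\ forall n, (n < N)%N ->
  b n.+1 *+ n.+1 = \sum_(l < n.+1) b l * ((((n - l)`!)%:R^-1 : K) *: z (n - l).+1).

Lemma bell_rec_unique z N b b' : bell_rec z N b -> bell_rec z N b' ->
  forall n, (n <= N)%N -> b n = b' n.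
Proof.
move=> [b0 br] [b'0 b'r]; elim/ltn_ind => -[|n] ih nN; first by rewrite b0 b'0.
have inj (x x' : A) : x *+ n.+1 = x' *+ n.+1 -> x = x'.
  move=> /(congr1 (fun w => (n.+1%:R^-1 : K) *: w)).
  by rewrite -!scalerMnr !scalerMnl -[_ *+ _]mulr_natr mulVf ?pnatr_eq0// !scale1r.
apply: inj; rewrite br// b'r//; apply: eq_bigr => -[l lN] _ /=.
by rewrite ih//; lia.
Qed.

Lemma coef_deriv_bser z N i : (i < N)%N -> ((bser z N)^`())`_i = ((i`!)%:R^-1 : K) *: z i.+1.
Proof.
by move=> iN; rewrite coef_deriv coef_bser//= scale_invfactS.
Qed.

Lemma bsum_rec z N : bell_rec z N (fun n => (bsum z N)`_n).
Proof.
split=> [|n nN]; first exact: coef0_bsum.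
rewrite -coef_deriv coef_deriv_bsum// coefM; apply: eq_bigr => -[l lN] _ /=.
by rewrite coef_deriv_bser//; lia.
Qed.

(** Both sides solve the same recursion. *)
Lemma coef_bsumD x y N n : (n <= N)%N ->
  (bsum (fun i => x i + y i) N)`_n = (bsum x N * bsum y N)`_n.
Proof.
move=> nN; apply: (@bell_rec_unique (fun i => x i + y i) N _ _ _ _ n) => //.
  exact: bsum_rec.
split=> [|k kN]; first by rewrite coefM big_ord1 !coef0_bsum mulr1.
have -> : \sum_(l < k.+1) (bsum x N * bsum y N)`_l * (((k - l)`!%:R^-1 : K) *: (x (k - l).+1 + y (k - l).+1)) =
    (bsum x N * bsum y N * (bser (fun i => x i + y i) N)^`())`_k.
  rewrite coefM; apply: eq_bigr => -[l lN] _ /=.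
  by rewrite coef_deriv_bser//; lia.
have low (p q r : {poly A}) : (forall i, (i < N)%N -> p`_i = q`_i) -> (p * r)`_k = (q * r)`_k.
  by move=> pq; rewrite !coefM; apply: eq_bigr => -[l lN] _ /=; rewrite pq//; lia.
rewrite -coef_deriv derivM coefD bserD derivD.
rewrite (low _ _ _ (fun i iN => coef_deriv_bsum x iN)).
rewrite [bsum x N * (bsum y N)^`()]mulrC (low _ _ _ (fun i iN => coef_deriv_bsum y iN)).
by rewrite -coefD mulrDr mulrAC [bsum y N * _ * _]mulrAC [bsum y N * bsum x N]mulrC.
Qed.

Lemma bellE z n : bell z n = (n`!%:R : K) *: (bsum z n)`_n.
Proof. by []. Qed.
End BellRecursion.

Section Homogeneity.
Variables (K : numFieldType) (A : comAlgType K) (Y : A).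

Definition scaled_by k (p : {poly A}) (d : {poly K}) := forall i, p`_i = d`_i *: Y ^+ (i + k).

Lemma scaled_by1 : scaled_by 0 1 1.
Proof. by move=> [|i]; rewrite !coefC//= ?scale1r ?scale0r// addn0 expr0. Qed.

Lemma scaled_byM k l p q d e : scaled_by k p d -> scaled_by l q e -> scaled_by (k + l) (p * q) (d * e).
Proof.
move=> pd qe i; rewrite !coefM scaler_suml; apply: eq_bigr => -[j ji] _ /=.
rewrite pd qe -scalerAl -scalerAr scalerA -exprD; congr (_ *: Y ^+ _); lia.
Qed.

Lemma scaled_byX k m p d : scaled_by k p d -> scaled_by (m * k) (p ^+ m) (d ^+ m).
Proof.
move=> pd; elim: m => [|m ih]; first exact: scaled_by1.
by rewrite !exprS mulSn; exact: scaled_byM.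
Qed.

(** Bell polynomials are homogeneous when the i-th variable has weight i. *)
Lemma scaled_by_bsum (x : nat -> A) (a : nat -> K) N :
  (forall i, (0 < i <= N)%N -> x i = a i *: Y ^+ i) ->
  forall i, (bsum x N)`_i = (bsum (a : nat -> K^o) N)`_i *: Y ^+ i.
Proof.
move=> xa i.
have sb : scaled_by 0 (bser x N) (bser (a : nat -> K^o) N).
  move=> j; have [jN|Nj] := leqP j N; last first.
    have big0 (B : comAlgType K) (u : nat -> B) : (bser u N)`_j = 0.
      rewrite /bser coef_sum big_nat big1// => l /andP[_ lN].
      rewrite coefCM coefXn; case: eqP => [jl|_]; last by rewrite mulr0.
      by move: lN; rewrite -jl ltnS leqNgt Nj.
    by rewrite !big0 scale0r.
  rewrite !coef_bser//; case: j jN => [|j] jN; first by rewrite scale0r.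
  by rewrite xa// addn0 scalerA.
rewrite /bsum !coef_sum scaler_suml; apply: eq_bigr => m _.
rewrite !coefCM (scaled_byX m sb) muln0 addn0.
by rewrite -[X in _ = X *: _]/((m`!%:R^-1 *: (1 : K^o)) * _) mulr_algl scalerA; congr (_ *: _); rewrite /GRing.scale/= mulr1.
Qed.
End Homogeneity.


(** * The Edgeworth coefficients *)

Section Hermite.
Variable R : realType.
Implicit Types (p : {poly R}) (q : nat) (x : R).

(** The derivatives of [expR (- x ^+ 2 / 2)] are its products by these (signed
    Hermite) polynomials. *)
Fixpoint hermite (q : nat) : {poly R} :=
  if q is q'.+1 then (hermite q')^`() - 'X * hermite q' else 1.

Local Notation gauss := (fun y : R => expR (- (y ^+ 2 / 2))).

Lemma is_derive_horner p x : is_derive x 1 (fun y => p.[y]) p^`().[x].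
Proof.
elim/poly_ind: p => [|p c ih].
  by rewrite (_ : (fun _ => _) = fun=> 0) ?deriv0 ?horner0; [exact: der_cst|apply/funext => y; rewrite horner0].
rewrite (_ : (fun _ => _) = fun y => p.[y] * y + c); last by apply/funext => y; rewrite hornerMXaddC.
by pointwise_derivative; rewrite derivMXaddC !hornerE; ring.
Qed.

Lemma derive1n_gauss q x : derive1n q gauss x = (hermite q).[x] * gauss x.
Proof.
elim: q x => [|q ih] x; first by rewrite /= hornerC mul1r.
rewrite derive1nS (_ : derive1n q gauss = fun x => (hermite q).[x] * gauss x); last exact/funext.
rewrite derive1E; apply: derive_val.
have dp := is_derive_horner (hermite q) x.
have -> : hermite q.+1 = (hermite q)^`() - 'X * hermite q by [].
pointwise_derivative; rewrite /= hornerD hornerN hornerM hornerX.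
by set u := _.[x]; set v := _.[x]; set e := expR _; field.
Qed.

Lemma deriv_hermite q : (hermite q.+1)^`() = - (hermite q *+ q.+1).
Proof.
elim: q => [|q ih].
  by rewrite /= derivC sub0r derivN derivM derivX derivC mulr0 addr0 mul1r.
have -> : hermite q.+2 = (hermite q.+1)^`() - 'X * hermite q.+1 by [].
rewrite derivB derivM derivX mul1r ih derivN derivMn.
have -> : hermite q.+1 = (hermite q)^`() - 'X * hermite q by [].
rewrite mulrN mulrnAr [in RHS]mulrS mulrnBl; set a := _^`(); set w := 'X * _.
by move: a w (a *+ _) (w *+ _) => a w u v; ring.
Qed.

Lemma hermite0 q : (hermite q).[0] = gm R q.
Proof.
elim/ltn_ind: q => -[|[|q]] ih; [by rewrite hornerC|by rewrite /= derivC mulr1 sub0r hornerN hornerX oppr0|].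
rewrite [hermite q.+2]/= -/(hermite q.+1) hornerD hornerN hornerM hornerX mul0r subr0.
have -> : gm R q.+2 = - q.+1%:R * gm R q by [].
by rewrite deriv_hermite hornerN hornerMn ih// mulNr mulr_natl.
Qed.

Lemma G_polynomial (W : R -> R) j b : exists p : {poly R}, forall x, G W j x b = p.[x].
Proof.
exists (((-1) ^+ j / j`!%:R) *: \sum_(i < size (bell (Dop W b) j)) (bell (Dop W b) j)`_i *: hermite i).
move=> x; rewrite /G /diffop hornerZ horner_sum -mulrA; congr (_ * _).
rewrite mulr_sumr; apply: eq_bigr => i _.
rewrite derive1n_gauss hornerZ mulrCA; congr (_ * _).
by rewrite mulrCA -expRD subrr expR0 mulr1.
Qed.

Definition gauss_form p := \sum_(i < size p) p`_i * gm R i.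

Lemma gauss_formE p n : (size p <= n)%N -> gauss_form p = \sum_(i < n) p`_i * gm R i.
Proof.
move=> pn; rewrite /gauss_form (big_ord_widen n (fun i => p`_i * gm R i))// big_mkcond/=.
apply: eq_bigr => i _; case: ltnP => // /leq_sizeP/(_ _ (leqnn _)) ->.
by rewrite mul0r.
Qed.

Lemma gauss_formD p p' : gauss_form (p + p') = gauss_form p + gauss_form p'.
Proof.
pose n := maxn (size p) (size p').
rewrite (@gauss_formE _ n) ?(leq_trans (size_polyD _ _))// (@gauss_formE p n) ?leq_maxl//.
rewrite (@gauss_formE p' n) ?leq_maxr// -big_split; apply: eq_bigr => i _.
by rewrite coefD mulrDl.
Qed.

Lemma gauss_form_sum (I : Type) (r : seq I) (f : I -> {poly R}) :
  gauss_form (\sum_(i <- r) f i) = \sum_(i <- r) gauss_form (f i).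
Proof.
elim: r => [|i r ih]; last by rewrite !big_cons gauss_formD ih.
by rewrite !big_nil /gauss_form size_poly0 big_ord0.
Qed.

Lemma gauss_formX (c t : R) q : gauss_form (c *: (t *: 'X) ^+ q) = c * t ^+ q * gm R q.
Proof.
rewrite exprZn scalerA (@gauss_formE _ q.+1).
  rewrite big_ord_recr/= coefZ coefXn eqxx mulr1 big1 ?add0r// => i _.
  by rewrite coefZ coefXn ltn_eqF// mulr0 mul0r.
by rewrite (leq_trans (size_scale_leq _ _))// size_polyXn.
Qed.

Lemma diffop_gauss p : diffop p (fun y : R => expR (- (y ^+ 2 / 2))) 0 = gauss_form p.
Proof.
apply: eq_bigr => i _.
by rewrite derive1n_gauss hermite0 expr0n mul0r oppr0 expR0 mulr1.
Qed.

(** The truncation of [(exp z - 1 - z - z ^ 2 / 2) / z ^ 2], which is the part of the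
    exponent at the saddle point that is not Gaussian. *)
Definition cpoly N : {poly R} := \poly_(i < N.+1) (if i == 0%N then 0 else (i.+2)`!%:R^-1).

Lemma coef_cpoly N i : (i <= N)%N -> (cpoly N)`_i = if i == 0%N then 0 else (i.+2)`!%:R^-1.
Proof. by move=> iN; rewrite coef_poly ltnS iN. Qed.

(** The [i]-th Taylor term of [W], times the exponential of [k * z ^ 2 * cpoly (z)], is
    integrated against the Gaussian of variance [1 / k]: the coefficients [kappa N i l]
    with [i + l] fixed make up the order [(i + l) / 2] in [1 / k]. *)
Definition kappa N i l : R := \sum_(m < N.+1) m`!%:R^-1 * (cpoly N ^+ m)`_l * gm R (i + l + m.*2).

Lemma coef_poly_exp_congr p p' m l : (forall i, (i <= l)%N -> p`_i = p'`_i) ->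
  forall i, (i <= l)%N -> (p ^+ m)`_i = (p' ^+ m)`_i.
Proof.
move=> pp'; elim: m => [//|m ih] i il; rewrite !exprS !coefM.
apply: eq_bigr => -[k ki] _ /=; rewrite pp' ?ih//; first by rewrite (leq_trans (leq_subr _ _)).
exact: leq_trans il.
Qed.

Lemma kappa_trunc N M i l : (l <= N)%N -> (N <= M)%N -> kappa N i l = kappa M i l.
Proof.
move=> lN NM; rewrite /kappa (big_ord_widen M.+1 (fun m => m`!%:R^-1 * (cpoly N ^+ m)`_l * gm R (i + l + m.*2)))//.
rewrite big_mkcond/=; apply: eq_bigr => m _.
have cc k : (k <= l)%N -> (cpoly N)`_k = (cpoly M)`_k.
  by move=> kl; rewrite !coef_cpoly//; lia.
rewrite (coef_poly_exp_congr m cc)//; case: ltnP => // Nm.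
by rewrite coef_mulX_exp ?mulr0 ?mul0r ?coef_cpoly//; lia.
Qed.

(** The Bell polynomials of a sum are a convolution. The variables [chi] generate the
    Taylor coefficients of [W] divided by [W b], since they are its logarithmic
    derivatives; the other summand of [Dop] is universal and generates the powers of
    [cpoly]. At 0 the powers of d/dx turn into the numbers [gm]. *)
Lemma F_expansion (W : R -> R) b j : W b != 0 ->
  (forall n, derive1n n.+1 W b =
    \sum_(l < n.+1) 'C(n, l)%:R * (derive1n l W b * chi W (n - l).+1 b)) ->
  F W j.*2 0 b = (2 * expR b) ^- j *
    \sum_(i < j.*2.+1) derive1n i W b / i`!%:R * kappa j.*2 i (j.*2 - i).
Proof.
move=> W0 Wrec; set s := 2 * expR b; set n := j.*2.
have s0 : 0 < s by rewrite mulr_gt0 ?expR_gt0.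
pose a i := derive1n i W b / i`!%:R.
pose t := (Num.sqrt s)^-1; have t2 : t ^+ 2 = s^-1 by rewrite exprVn sqr_sqrtr// ltW.
pose Y : {poly R} := t *: 'X.
pose y i : {poly R} := (s / (i.+1 * i.+2)%:R) *: Y ^+ i.+2.
pose x i : {poly R} := chi W i b *: Y ^+ i.
(* the recursion of the logarithmic derivatives is the Bell recursion in the [chi] *)
have xE i : (i <= n)%N -> (bsum x n)`_i = (a i / W b) *: Y ^+ i.
  move=> iN; rewrite (@scaled_by_bsum _ _ Y x (fun i => chi W i b))//; congr (_ *: _).
  apply: (@bell_rec_unique _ _ (fun i => chi W i b : R^o) n _ (fun i => a i / W b : R^o) _ _ i iN).
    exact: bsum_rec.
  split=> [|k kn]; first by rewrite /a/= divr1 divff.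
  rewrite -[RHS]/(\sum_(l < k.+1) a l / W b * ((k - l)`!%:R^-1 * chi W (k - l).+1 b)).
  rewrite -[LHS]mulr_natr /a Wrec factS natrM invfM.
  have k0 : k.+1%:R != 0 :> R by rewrite pnatr_eq0.
  have -> (u v : R) : u * (k.+1%:R^-1 * v) / W b * k.+1%:R = u * v / W b.
    by move: (k.+1%:R : R) k0 => q q0; field; rewrite W0 q0.
  rewrite !mulr_suml; apply: eq_bigr => -[l lk] _ /=.
  rewrite -(bin_fact (_ : l <= k)%N)// !natrM !invfM.
  have c0 : 'C(k, l)%:R != 0 :> R by rewrite pnatr_eq0 -lt0n bin_gt0.
  have f1 : l`!%:R != 0 :> R by rewrite pnatr_eq0 -lt0n fact_gt0.
  have f2 : (k - l)`!%:R != 0 :> R by rewrite pnatr_eq0 -lt0n fact_gt0.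
  move: ('C(k, l)%:R : R) (l`!%:R : R) ((k - l)`!%:R : R) c0 f1 f2 => q1 q2 q3 c0 f1 f2.
  by field; rewrite W0 c0 f1 f2.
(* the i-th variable [y i] is of order [i + 2] in [Y], whence the shift by 2 *)
have yE l : (l <= n)%N -> (bsum y n)`_l =
    \sum_(m < n.+1) (m`!%:R^-1 * s ^+ m * (cpoly n ^+ m)`_l) *: Y ^+ (l + m.*2).
  move=> ln; rewrite /bsum coef_sum; apply: eq_bigr => m _.
  have sb : scaled_by Y 2 (bser y n) (s *: cpoly n).
    move=> i; have [iN|Ni] := leqP i n; last first.
      rewrite coefZ coef_poly ltnS leqNgt Ni/= mulr0 scale0r.
      rewrite /bser coef_sum big_nat big1// => k /andP[_ kn].
      rewrite coefCM coefXn; case: eqP => [jl|_]; last by rewrite mulr0.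
      by move: kn; rewrite -jl ltnS leqNgt Ni.
    rewrite coef_bser// coefZ coef_cpoly//; case: i iN => [|i] iN; first by rewrite mulr0 scale0r.
    rewrite /y scalerA addn2; congr (_ *: _) => /=.
    have -> : i.+3`!%:R = i.+3%:R * i.+2%:R * i.+1`!%:R :> R by rewrite factS [i.+2`!]factS !natrM mulrA.
    rewrite natrM.
    have f1 : i.+1`!%:R != 0 :> R by rewrite pnatr_eq0 -lt0n fact_gt0.
    have f2 : i.+2%:R != 0 :> R by rewrite pnatr_eq0.
    have f3 : i.+3%:R != 0 :> R by rewrite pnatr_eq0.
    move: (i.+1`!%:R : R) (i.+2%:R : R) (i.+3%:R : R) f1 f2 f3 => q1 q2 q3 f1 f2 f3.
    by field; rewrite f1 f2 f3.
  rewrite coefCM (scaled_byX m sb) mulr_algl scalerA muln2; congr (_ *: _).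
  by rewrite exprZn coefZ; ring.
have FE : F W n 0 b = W b * gauss_form (bsum (Dop W b) n)`_n.
  rewrite /F /G -signr_odd odd_double expr0 mul1r diffop_gauss bellE expr0n mul0r expR0 mulr1.
  have gZ c p : gauss_form (c *: p) = c * gauss_form p.
    rewrite (@gauss_formE _ (size p)) ?size_scale_leq// mulr_sumr.
    by apply: eq_bigr => i _; rewrite coefZ mulrA.
  by rewrite gZ mulKf// pnatr_eq0 -lt0n fact_gt0.
have -> : F W n 0 b = W b * \sum_(i < n.+1) \sum_(m < n.+1)
    (a i / W b * (m`!%:R^-1 * s ^+ m * (cpoly n ^+ m)`_(n - i))) * t ^+ (n + m.*2) * gm R (n + m.*2).
  rewrite FE; congr (_ * _).
  have -> : (bsum (Dop W b) n)`_n = (bsum y n * bsum x n)`_n by exact: (@coef_bsumD _ _ y x n n).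
  rewrite mulrC coefM gauss_form_sum; apply: eq_bigr => -[i iN] _ /=.
  rewrite xE// yE ?leq_subr// mulr_sumr gauss_form_sum; apply: eq_bigr => m _.
  rewrite -scalerAl -scalerAr scalerA -exprD gauss_formX.
  by rewrite addnA subnKC.
rewrite !mulr_sumr; apply: eq_bigr => -[i iN] _ /=.
rewrite !mulr_sumr; apply: eq_bigr => m _.
have -> : t ^+ (n + m.*2) = s ^- j * s ^- m.
  by rewrite -doubleD -mul2n exprM t2 exprVn exprD invfM.
rewrite subnKC// -/(a i).
have sm : s ^+ m != 0 by rewrite expf_neq0 ?gt_eqF.
have f1 : m`!%:R != 0 :> R by rewrite pnatr_eq0 -lt0n fact_gt0.
have sj : s ^+ j != 0 by rewrite expf_neq0 ?gt_eqF.
by move: (s ^+ m) (s ^+ j) (m`!%:R : R) sm sj f1 => q1 q2 q3 f1 f2 f3; field; rewrite W0 f1 f2 f3.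
Qed.
End Hermite.

(** * Expansion at the saddle point *)

Section Saddle.
Variable R : realType.
Implicit Types (k u x y c : R) (z : R[i]) (m q : nat).

Lemma exp_decay m c : 0 < c ->
  exists2 C, 0 <= C & forall y, 0 <= y -> y ^+ m * expR (- (c * y)) <= C.
Proof.
move=> c0; case: m => [|m].
  by exists 1 => // y y0; rewrite mul1r -expR0 ler_expR oppr_le0 mulr_ge0// ltW.
exists ((m.+1%:R / c) ^+ m.+1) => [|y y0]; first by rewrite exprn_ge0// divr_ge0// ltW.
have mR : 0 < m.+1%:R :> R by rewrite ltr0n.
rewrite expRN ler_pdivrMr ?expR_gt0//.
have -> : c * y = m.+1%:R * (c * y / m.+1%:R) by rewrite [RHS]mulrC divfK ?gt_eqF.
have mc0 : 0 <= m.+1%:R / c by rewrite divr_ge0 ?(ltW c0).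
rewrite expRM_natl -exprMn; apply: lerXn2r; rewrite ?nnegrE//; first exact: mulr_ge0 mc0 (expR_ge0 _).
have : c * y / m.+1%:R <= expR (c * y / m.+1%:R) by apply: le_trans (expR_ge1Dx _); rewrite lerDr.
move=> /(ler_wpM2l mc0); apply: le_trans.
have -> // : m.+1%:R / c * (c * y / m.+1%:R) = y.
by move: (m.+1%:R : R) mR => b b0; field; rewrite !gt_eqF.
Qed.

Lemma nc_exp_trunc_le m z : normc (exp_trunc m z) <= expR (normc z).
Proof.
apply: (@le_trans _ _ (series (exp_coeff (normc z)) m)).
  rewrite /exp_trunc /series/= big_mkord; apply: le_trans (nc_sum _ _ _) _.
  apply: ler_sum => i _; rewrite ncZ ncX ger0_norm ?invr_ge0//.
  by rewrite /exp_coeff/= mulrC.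
have nd : {homo series (exp_coeff (normc z)) : n m / (n <= m)%N >-> n <= m}.
  by apply: nondecreasing_series => n _ _; rewrite exp_coeff_ge0 ?nc_ge0.
have /(_ m) := nondecreasing_cvgn_le nd (is_cvg_series_exp_coeff _).
by rewrite /expR.
Qed.

Lemma normc_imag u : 0 <= u -> normc (0 +i* u : R[i]) = u.
Proof. by move=> u0; rewrite ncE/= expr0n add0r sqrtr_sqr ger0_norm. Qed.

Lemma exp_trunc3 z : exp_trunc 3 z = 1 + z + (2^-1)%:C * z ^+ 2.
Proof.
rewrite /exp_trunc !big_ord_recr big_ord0/= add0r expr0 expr1 mulr1.
rewrite -[0`!]/1%N -[1`!]/1%N -[2`!]/2%N invr1.
by rewrite -[1%:C]/(1 : R[i]) mul1r.
Qed.

(** The exponent at the saddle point beyond its quadratic part, truncated. *)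
Definition saddle_exponent k J z : R[i] := k%:C * (exp_trunc J.+3 z - exp_trunc 3 z).

Lemma saddle_exponentE k J z : saddle_exponent k J z = k%:C * (z ^+ 2 * cev (cpoly R J) z).
Proof.
rewrite /saddle_exponent; congr (_ * _).
rewrite (@cevE _ _ _ J.+1) ?size_poly// big_ord_recl coef_cpoly//= mul0r add0r.
have -> : exp_trunc J.+3 z = exp_trunc 3 z + \sum_(i < J) (((3 + i)`!%:R)^-1)%:C * z ^+ (3 + i).
  by rewrite /exp_trunc -[J.+3]/(3 + J)%N big_split_ord.
rewrite addrC addKr mulr_sumr.
apply: eq_bigr => i _; rewrite /bump/= add1n coef_cpoly//= [RHS]mulrCA -exprD.
by [].
Qed.

Lemma saddle_exponent_le k J u : (0 < J)%N -> 0 <= k -> 0 <= u <= 4^-1 ->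
  normc (saddle_exponent k J (0 +i* u)) <= k * u ^+ 3 / 2.
Proof.
move=> J0 k0 /andP[u0 u4]; rewrite /saddle_exponent ncZ ger0_norm// -mulrA ler_wpM2l//.
have nz : normc (0 +i* u : R[i]) = u by exact: normc_imag.
have eu : expR u <= 2.
  have : `|u| <= 2^-1 by rewrite ger0_norm//; lra.
  by move=> /expR_le_quad; nra.
have h3 := cexp_taylor 3 (0 +i* u); have hJ := cexp_taylor J.+3 (0 +i* u).
rewrite nz in h3 hJ.
have f3 : 3`!%:R = 6 :> R by [].
have h3' : normc (cexp (0 +i* u) - exp_trunc 3 (0 +i* u)) <= u ^+ 3 / 3.
  apply: le_trans h3 _; rewrite f3.
  have : u ^+ 3 * expR u <= u ^+ 3 * 2 by rewrite ler_wpM2l ?exprn_ge0.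
  lra.
have hJ' : normc (cexp (0 +i* u) - exp_trunc J.+3 (0 +i* u)) <= u ^+ 3 / 6.
  apply: le_trans hJ _.
  have F : 12 <= J.+3`!%:R :> R.
    rewrite ler_nat; case: (J) J0 => // j _; rewrite factS [j.+3`!]factS.
    by apply: (@leq_mul 4 3) => //; apply: (@leq_mul 3 1) => //; exact: fact_gt0.
  have F0 : 0 < J.+3`!%:R :> R by apply: lt_le_trans F.
  rewrite ler_pdivrMr//.
  have : u ^+ J.+3 <= u ^+ 3 by rewrite ler_wiXn2l//; lra.
  have : 0 <= u ^+ 3 by rewrite exprn_ge0.
  have : 0 <= u ^+ J.+3 by rewrite exprn_ge0.
  have := expR_ge0 u.
  set p := u ^+ J.+3; set p3 := u ^+ 3; set e := expR u in eu *; set f := J.+3`!%:R in F F0 *.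
  nra.
apply: le_trans (ler_nc_dist (cexp (0 +i* u)) _ _) _.
by rewrite ncB; lra.
Qed.

(** The rest of the exponent has size [k * u ^ 3]. In terms of [y = k * u ^ 2], each error
    is a power of [1 / k] times a power of [y], and half of the Gaussian factor is enough
    to absorb the powers of [y]. *)
Lemma saddle_expansion q : exists2 C, 0 <= C & forall k u, 1 <= k -> 0 <= u <= 4^-1 ->
  let z : R[i] := 0 +i* u in
  normc (cexp (k%:C * (cexp z - 1 - z)) - (expR (- (k * u ^+ 2 / 2)))%:C *
     exp_trunc q.+1.*2 (saddle_exponent k q.*2.+1 z)) <= C / k ^+ q.+1.
Proof.
have c4 : 0 < 4^-1 :> R by rewrite invr_gt0.
have [C1 C10 hC1] := exp_decay q.+2 c4; have [C2 C20 hC2] := exp_decay (3 * q.+1) c4.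
exists (C1 + C2); first exact: addr_ge0.
move=> k u k1 u4 /=; have /andP[u0 u4'] := u4; set z := 0 +i* u.
have k0 : 0 < k by exact: lt_le_trans k1.
have nz : normc z = u by exact: normc_imag.
set J := q.*2.+1; have J0 : (0 < J)%N by [].
have JE : J.+1 = q.+1.*2 by rewrite doubleS.
rewrite -JE; set X := saddle_exponent k J z; set y := k * u ^+ 2.
have y0 : 0 <= y by rewrite mulr_ge0 ?sqr_ge0 ?(ltW k0).
have XE : normc X <= k * u ^+ 3 / 2 by exact: saddle_exponent_le (ltW k0) u4.
have Xy : normc X <= y / 8.
  apply: le_trans XE _; rewrite /y; have : k * u ^+ 3 <= k * u ^+ 2 / 4.
    by rewrite -mulrA ler_wpM2l ?(ltW k0)// exprSr ler_wpM2l ?sqr_ge0.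
  lra.
pose X' := k%:C * (cexp z - exp_trunc 3 z).
have z2 : z ^+ 2 = (- u ^+ 2)%:C.
  by rewrite expr2; apply: complexP => /=; ring.
have eE : cexp (k%:C * (cexp z - 1 - z)) = (expR (- (y / 2)))%:C * cexp X'.
  rewrite -cexp_real -cexpD; congr cexp; rewrite /X' exp_trunc3 z2 /y.
  set w := cexp z; apply: complexP; first by rewrite !(ReM, ReD, ReN, ImD, ImN)/=; field.
  by rewrite !(ImM, ReM, ReD, ReN, ImD, ImN)/=; field.
have eu : expR u <= 2.
  have : `|u| <= 2^-1 by rewrite ger0_norm//; lra.
  by move=> /expR_le_quad; nra.
have E1 : normc (X' - X) <= k * u ^+ J.+3.
  have -> : X' - X = k%:C * (cexp z - exp_trunc J.+3 z).
    rewrite /X' /X /saddle_exponent -mulrBr; congr (_ * _).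
    by rewrite opprB addrA subrK.
  rewrite ncZ gtr0_norm// ler_pM2l//; apply: le_trans (cexp_taylor _ _) _; rewrite nz.
  have F : 2 <= J.+3`!%:R :> R.
    by rewrite ler_nat factS; apply: (@leq_mul 2 1) => //; exact: fact_gt0.
  rewrite ler_pdivrMr ?ltr0n ?fact_gt0// ler_wpM2l ?exprn_ge0//; exact: le_trans eu F.
have E1y : normc (X' - X) <= y / 16.
  apply: le_trans E1 _; rewrite /y -mulrA ler_pM2l//.
  have -> : J.+3 = (2 + J.+1)%N by [].
  rewrite exprD ler_wpM2l ?sqr_ge0//; apply: (@le_trans _ _ (u ^+ 2)).
    by rewrite ler_wiXn2l//; lra.
  nra.
have d1 : normc (cexp X' - cexp X) <= k * u ^+ J.+3 * expR (y / 4).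
  apply: le_trans (cexpB_le _ _) _; rewrite -mulrA -expRD; apply: ler_pM; rewrite ?nc_ge0 ?expR_ge0//.
  by rewrite ler_expR; have := Re_le_nc X; rewrite ler_norml => /andP[_ h]; lra.
have d2 : normc (cexp X - exp_trunc J.+1 X) <= (k * u ^+ 3) ^+ J.+1 * expR (y / 4).
  apply: le_trans (cexp_taylor _ _) _.
  apply: (@le_trans _ _ (normc X ^+ J.+1 * expR (normc X))).
    have x0 : 0 <= normc X ^+ J.+1 * expR (normc X) by rewrite mulr_ge0 ?exprn_ge0 ?nc_ge0 ?expR_ge0.
    by rewrite ler_pdivrMr ?ltr0n ?fact_gt0// ler_peMr// ler1n fact_gt0.
  have ku : 0 <= k * u ^+ 3 by rewrite mulr_ge0 ?exprn_ge0 ?(ltW k0).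
  apply: ler_pM; rewrite ?exprn_ge0 ?nc_ge0 ?expR_ge0// ?ler_expR; last lra.
  by rewrite lerXn2r ?nnegrE ?nc_ge0//; lra.
rewrite eE -/y -mulrBr ncZ ger0_norm ?expR_ge0//.
have d3 : normc (cexp X' - exp_trunc J.+1 X) <= (k * u ^+ J.+3 + (k * u ^+ 3) ^+ J.+1) * expR (y / 4).
  by rewrite mulrDl (le_trans (ler_nc_dist (cexp X) _ _))// lerD.
apply: le_trans (ler_wpM2l (expR_ge0 _) d3) _.
have -> : expR (- (y / 2)) * ((k * u ^+ J.+3 + (k * u ^+ 3) ^+ J.+1) * expR (y / 4)) =
    (k * u ^+ J.+3 + (k * u ^+ 3) ^+ J.+1) * expR (- (4^-1 * y)).
  by rewrite mulrCA -expRD; congr (_ * expR _); field.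
have kq : k ^+ q.+1 != 0 by rewrite expf_neq0 ?gt_eqF.
have -> : k * u ^+ J.+3 = y ^+ q.+2 / k ^+ q.+1.
  have -> : J.+3 = (2 * q.+2)%N by rewrite mul2n !doubleS.
  by rewrite /y exprMn exprM [k ^+ q.+2]exprS [RHS]mulrAC mulfK.
have -> : (k * u ^+ 3) ^+ J.+1 = y ^+ (3 * q.+1) / k ^+ q.+1.
  rewrite JE /y (exprMn _ k (u ^+ 3)) (exprMn _ k (u ^+ 2)) -!(exprM u) -mul2n mulnCA.
  have e3 : (3 * q.+1 = 2 * q.+1 + q.+1)%N by rewrite [LHS]mulSn addnC.
  by rewrite e3 (exprD k) [RHS]mulrAC mulfK.
rewrite -mulrDl mulrAC ler_wpM2r ?invr_ge0 ?exprn_ge0 ?(ltW k0)// mulrDl.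
by apply: lerD; [exact: hC1|exact: hC2].
Qed.
End Saddle.

Section Pointwise.
Variable R : realType.
Implicit Types (k u x y c : R) (z : R[i]) (m q : nat).

Lemma gauss_sum_primitive : exists2 Cf : nat -> R, forall q, 0 <= Cf q &
  forall (I : Type) (s : seq I) (A : I -> R) (e : I -> nat) k a,
  1 <= k -> 0 < a <= 1 -> 2 <= k * a ^+ 2 ->
  exists2 H : R -> R,
    forall u, is_derive u 1 H
      (expR (- (k * u ^+ 2 / 2)) * \sum_(i <- s) A i * (rq R (e i) * u ^+ e i)) &
    `|H a - H 0 - Num.sqrt (pi / 2) *
       \sum_(i <- s) A i * ((Num.sqrt k)^-1 ^+ (e i).+1 * gm R (e i))| <=
      (\sum_(i <- s) `|A i| * Cf (e i)) * expR (- (k * a ^+ 2 / 2)).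
Proof.
have ex q : exists C : R, 0 <= C /\ forall k a,
  1 <= k -> 0 < a <= 1 -> 2 <= k * a ^+ 2 ->
  exists2 H : R -> R,
    forall u, is_derive u 1 H (expR (- (k * u ^+ 2 / 2)) * (rq R q * u ^+ q)) &
    `|H a - H 0 - Num.sqrt (pi / 2) * (Num.sqrt k)^-1 ^+ q.+1 * gm R q| <=
      C * expR (- (k * a ^+ 2 / 2)).
  by have [C C0 hC] := gauss_moment_primitive R q; exists C.
have [Cf hCf] := choice ex; exists Cf => [q|I s A e k a k1 a01 ka]; first by have [] := hCf q.
elim: s => [|i s [H dH hH]].
  exists (fun=> 0) => [u|]; last by rewrite !big_nil mulr0 mul0r !subr0 normr0.
  by rewrite big_nil mulr0; exact: der_cst.
have [_ /(_ k a k1 a01 ka)[I1 dI hI]] := hCf (e i).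
exists (fun u => A i * I1 u + H u) => [u|].
  have dHu := dH u; have dIu := dI u; pointwise_derivative.
  by rewrite big_cons mul0r add0r mulrDr mulrCA.
rewrite !big_cons [(_ + _) * expR _]mulrDl.
have -> : A i * I1 a + H a - (A i * I1 0 + H 0) - Num.sqrt (pi / 2) *
    (A i * ((Num.sqrt k)^-1 ^+ (e i).+1 * gm R (e i)) +
     \sum_(j <- s) A j * ((Num.sqrt k)^-1 ^+ (e j).+1 * gm R (e j))) =
  A i * (I1 a - I1 0 - Num.sqrt (pi / 2) * (Num.sqrt k)^-1 ^+ (e i).+1 * gm R (e i)) +
  (H a - H 0 - Num.sqrt (pi / 2) * \sum_(j <- s) A j * ((Num.sqrt k)^-1 ^+ (e j).+1 * gm R (e j))).
  by ring.
rewrite (le_trans (ler_normD _ _))//; apply: lerD; last exact: hH.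
by rewrite [leLHS]normrM -[leRHS]mulrA ler_wpM2l.
Qed.

(** The equation [2 * expR b * ln n%:R = k] is what cancels the terms of first order in
    [u], that is, makes 0 a saddle point. *)
Lemma saddle_phase b k n u : (0 < n)%N -> 2 * expR b * ln n%:R = k ->
  forall v, cexp (k%:C * (cexp (0 +i* u) - 1 - (0 +i* u))) * Wn v n (b +i* u) =
  (n%:R * expR (- k))%:C * (cexp (- (k%:C * (0 +i* u))) * Sn (external v n) (b +i* u)).
Proof.
move=> n0 kE v; rewrite WnE.
have nR : 0 < n%:R :> R by rewrite ltr0n.
have -> : alpha (b +i* u) * (ln (n%:R : R))%:C = k%:C * cexp (0 +i* u) - (ln n%:R)%:C.
  rewrite /alpha mulrBl mul1r; congr (_ - _).
  have -> : b +i* u = b%:C + (0 +i* u) by apply: complexP => /=; rewrite ?addr0 ?add0r.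
  by rewrite cexpD cexp_real -kE real_natc !rmorphM/= rmorph_nat; ring.
have -> : (n%:R * expR (- k))%:C = cexp (ln n%:R - k)%:C.
  by rewrite cexp_real expRD lnK.
by rewrite [LHS]mulrA [RHS]mulrA -!cexpD; congr (cexp _ * _); rewrite rmorphB/=; ring.
Qed.

(** The powers of [cpoly R J] up to the [J]-th have degree at most [J * J], which sets the
    range of the last index. *)
Lemma Re_saddle_poly q k (a : nat -> R) u :
  let J := q.*2.+1 in
  Re ((\sum_(i < J.+1) (a i)%:C * (0 +i* u) ^+ i) * exp_trunc J.+1 (saddle_exponent k J (0 +i* u))) =
  \sum_(p : 'I_J.+1 * ('I_J.+1 * 'I_(J.+1 * J.+1).+1))
    (a p.1 * (p.2.1`!%:R^-1 * (cpoly R J ^+ p.2.1)`_p.2.2) * k ^+ p.2.1) *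
    (rq R (p.1 + p.2.2 + p.2.1.*2) * u ^+ (p.1 + p.2.2 + p.2.1.*2)).
Proof.
move=> J; set z : R[i] := 0 +i* u; set L := (J.+1 * J.+1).+1.
rewrite saddle_exponentE.
have cE m : (m <= J)%N -> cev (cpoly R J) z ^+ m = \sum_(l < L) ((cpoly R J ^+ m)`_l)%:C * z ^+ l.
  move=> mJ; rewrite -(@cevE _ (cpoly R J ^+ m)); last first.
    have sp : (size (cpoly R J) <= J.+1)%N by exact: size_poly.
    apply: leq_trans (size_poly_exp_leq _ _) _; rewrite ltnS.
    by apply: leq_mul; [rewrite (leq_trans (leq_pred _))|exact: leqW].
  elim: m {mJ} => [|m ih]; first by rewrite !expr0 /cev rmorph1 hornerC.
  by rewrite !exprS ih cevM.
rewrite -(pair_bigA _ (fun (i : 'I_J.+1) (q : 'I_J.+1 * 'I_L) =>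
  (a i * (q.1`!%:R^-1 * (cpoly R J ^+ q.1)`_q.2) * k ^+ q.1) *
    (rq R (i + q.2 + q.1.*2) * u ^+ (i + q.2 + q.1.*2))))/=.
rewrite mulr_suml Re_sum; apply: eq_bigr => i _.
rewrite -(pair_bigA _ (fun (m : 'I_J.+1) (l : 'I_L) =>
  (a i * (m`!%:R^-1 * (cpoly R J ^+ m)`_l) * k ^+ m) *
    (rq R (i + l + m.*2) * u ^+ (i + l + m.*2))))/=.
rewrite /exp_trunc mulr_sumr Re_sum; apply: eq_bigr => m _.
rewrite !exprMn cE -1?ltnS// !mulr_sumr Re_sum; apply: eq_bigr => l _.
have zE e : Re (z ^+ e) = rq R e * u ^+ e.
  have -> : z = u%:C * (0 +i* 1) by apply: complexP => /=; ring.
  by rewrite Re_scaleX mulrC.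
rewrite -zE -ReZ; congr Re.
have -> : (i + l + m.*2 = i + (m.*2 + l))%N by rewrite -addnA [(l + _)%N]addnC.
rewrite (exprD z i) (exprD z m.*2) -mul2n (exprM z 2 m) !rmorphM/= !rmorphXn/=.
by rewrite [(z ^+ 2) ^+ m]exprMn; ring.
Qed.

(** The Fourier integral for the profile is split at [alf]. Below [alf] the generating
    function is replaced by [W], and both [W] and the exponential are expanded; above
    [alf] the integrand is negligible. The Gaussian moments are incomplete, which costs
    an exponentially small term. *)
Lemma saddle_point_integral q B r alf : 0 < r -> 0 < alf -> alf <= 4^-1 -> alf <= r / 2 ->
  let J := q.*2.+1 in let L := (J.+1 * J.+1).+1 in
  exists2 C, 0 <= C & forall v (W : R[i] -> R[i]) b E (a : nat -> R) (n k : nat),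
    (0 < n)%N -> (0 < k)%N -> 2 <= k%:R * alf ^+ 2 -> 2 * expR b * ln n%:R = k%:R ->
    (forall z, normc z <= r -> normc (W (b%:C + z)) <= B) ->
    (forall i, `|a i| * r ^+ i <= B) ->
    (forall N z, normc z <= r / 2 ->
      normc (W (b%:C + z) - \sum_(i < N) (a i)%:C * z ^+ i) <= 2 * B * (normc z / r) ^+ N) ->
    (forall u, 0 <= u <= alf -> normc (Wn v n (b +i* u) - W (b +i* u)) <= E) ->
    (forall u, alf <= u <= pi -> normc (Sn (external v n) (b +i* u)) <=
      E * expR ((2 * expR b - 1) * ln n%:R)) ->
    `|n%:R * expR (- k%:R) * expR (b * k%:R) * (count (fun w => size w == k) (external v n))%:R -
      (Num.sqrt (2 * pi * k%:R))^-1 * \sum_(i < J.+1) \sum_(l < L)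
        (Num.sqrt k%:R)^-1 ^+ (i + l) * (a i * kappa R J i l)| <= C / k%:R ^+ q.+1 + E.
Proof.
move=> r0 a0 a4 ar J L.
have [C1 C10 hC1] := saddle_expansion R q.
have c4 : 0 < 4^-1 :> R by rewrite invr_gt0.
have [C3 C30 hC3] := exp_decay q.+1 c4.
have al2 : 0 < alf ^+ 2 / 2 by rewrite divr_gt0// exprn_gt0.
have [C4 C40 hC4] := exp_decay (J + q.+1) al2.
have [Cf Cf0 hCf] := gauss_sum_primitive.
pose D := \sum_(p : 'I_J.+1 * ('I_J.+1 * 'I_L)) r ^- p.1 * `|p.2.1`!%:R^-1 * (cpoly R J ^+ p.2.1)`_p.2.2| * Cf (p.1 + p.2.2 + p.2.1.*2)%N.
have D0 : 0 <= D.
  by apply: sumr_ge0 => p _; rewrite !mulr_ge0// invr_ge0 exprn_ge0// ltW.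
pose Cw := C1 + 2 * r ^- J.+1 * C3.
have Cw0 : 0 <= Cw by rewrite addr_ge0// !mulr_ge0// invr_ge0 exprn_ge0// ltW.
exists ((Cw + D * C4) * `|B|) => [|v W b E a n k n0 k0 ka kE WB aB aW WE SE].
  by rewrite mulr_ge0// addr_ge0// mulr_ge0.
have B0 : 0 <= B by apply: le_trans (nc_ge0 (W (b%:C + 0))) _; apply: WB; rewrite normc0 ltW.
rewrite (ger0_norm B0).
have k1 : 1 <= k%:R :> R by rewrite ler1n.
have kR : 0 < k%:R :> R by rewrite ltr0n.
have [Phi dPhi Phi01] := profile_primitive (external v n) b k.
pose A (p : 'I_J.+1 * ('I_J.+1 * 'I_L)) : R := a p.1 * (p.2.1`!%:R^-1 * (cpoly R J ^+ p.2.1)`_p.2.2) * k%:R ^+ p.2.1.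
pose e (p : 'I_J.+1 * ('I_J.+1 * 'I_L)) := (p.1 + p.2.2 + p.2.1.*2)%N.
have a01 : 0 < alf <= 1 by rewrite a0 (le_trans a4)// invf_le1// ler1n.
have [H dH hH] := hCf _ (index_enum _) A e k%:R alf k1 a01 ka.
set cst := n%:R * expR (- k%:R).
have cst0 : 0 <= cst by rewrite mulr_ge0 ?expR_ge0.
have E0 : 0 <= E by apply: le_trans (WE 0 _); rewrite ?nc_ge0// lexx ltW.
have pi4 : pi <= 4 :> R by have := @pihalf_lt2 R; rewrite ltr_pdivrMr// => /ltW; lra.
have pi1 : 1 <= pi :> R by have := @pi_ge2 R; lra.
have apos : alf <= pi by case/andP: a01 => _ /le_trans; apply.
have zE u : b +i* u = b%:C + (0 +i* u) by apply: complexP => /=; rewrite ?addr0 ?add0r.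
(* above [alf] only the size of [Sn] matters *)
have out : `|cst * (Phi pi - Phi alf)| <= E * (pi - alf).
  have dcP u : is_derive u 1 (fun u => cst * Phi u) (cst * Re (cexp (- (k%:R * (0 +i* u))) * Sn (external v n) (b +i* u))).
    by have := dPhi u => dPu; pointwise_derivative; rewrite mul0r add0r.
  have dEu (u : R) : is_derive u 1 (fun u => E * u) E.
    by pointwise_derivative; rewrite mul0r add0r mulr1.
  rewrite mulrBr [E * _]mulrBr; apply: (mean_value_le apos (fun u _ => dcP u) (fun u _ => dEu u)) => u uap.
  rewrite normrM ger0_norm//; apply: (@le_trans _ _ (cst * (E * expR ((2 * expR b - 1) * ln n%:R)))).
    rewrite ler_wpM2l//; apply: le_trans (Re_le_nc _) _; rewrite normcM nc_cexp ReN.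
    by rewrite real_natc ReZ mulr0 oppr0 expR0 mul1r SE.
  rewrite mulrBl mul1r kE expRD expRN lnK ?posrE ?ltr0n// /cst expRN.
  have e0 : expR k%:R != 0 :> R by rewrite gt_eqF ?expR_gt0.
  have nn : n%:R != 0 :> R by rewrite gt_eqF ?ltr0n.
  move: (expR k%:R : R) (n%:R : R) e0 nn => x y x0 y0.
  by rewrite le_eqVlt; apply/orP; left; apply/eqP; field; rewrite x0 y0.
(* below [alf]: error of [Wn], error of the expansion of the exponential, and error of
   the Taylor expansion of [W] *)
have pw u : 0 <= u <= alf ->
    `|cst * Re (cexp (- (k%:R * (0 +i* u))) * Sn (external v n) (b +i* u)) -
      expR (- (k%:R * u ^+ 2 / 2)) * \sum_p A p * (rq R (e p) * u ^+ e p)| <=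
    Cw * B / k%:R ^+ q.+1 + E.
  move=> u0a; have [u0 ua] := andP u0a.
  set z : R[i] := 0 +i* u; set y := k%:R * u ^+ 2.
  have y0 : 0 <= y by rewrite mulr_ge0// sqr_ge0.
  have nz : normc z = u by exact: normc_imag.
  have u4 : 0 <= u <= 4^-1 by rewrite u0 (le_trans ua).
  set w := W (b +i* u); set X := saddle_exponent k%:R J z.
  set Et := exp_trunc J.+1 X; set S := \sum_(i < J.+1) (a i)%:C * z ^+ i.
  set tt := cexp (k%:R%:C * (cexp z - 1 - z)); set g := expR (- (y / 2)).
  have zr : normc z <= r / 2 by rewrite nz (le_trans ua).
  have wB : normc w <= B by rewrite /w zE WB// (le_trans zr)//; lra.
  have wS : normc (w - S) <= 2 * B * (u / r) ^+ J.+1 by have h := aW J.+1 z zr; rewrite nz in h; rewrite /w zE; exact: h.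
  have t1 : normc tt <= 1.
    rewrite nc_cexp -expR0 ler_expR ReZ mulr_ge0_le0// !(ReD, ReN) Re_cexp/= expR0 mul1r subr0.
    by rewrite subr_le0 cos_le1.
  have tE : normc (tt - g%:C * Et) <= C1 / k%:R ^+ q.+1 by exact: hC1.
  have gE : normc (g%:C * Et) <= expR (- (4^-1 * y)).
    rewrite ncZ ger0_norm ?expR_ge0//; apply: le_trans (ler_wpM2l (expR_ge0 _) (nc_exp_trunc_le _ _)) _.
    rewrite -expRD ler_expR.
    have := saddle_exponent_le (isT : (0 < J)%N) (ltW kR) u4; rewrite -/z -/X => h.
    have : k%:R * u ^+ 3 <= y / 4.
      by rewrite /y -mulrA ler_wpM2l// exprSr ler_wpM2l ?sqr_ge0//; case/andP: u4.
    lra.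
  have -> : cst * Re (cexp (- (k%:R * z)) * Sn (external v n) (b +i* u)) -
      g * \sum_p A p * (rq R (e p) * u ^+ e p) =
      Re (tt * (Wn v n (b +i* u) - w) + ((tt - g%:C * Et) * w + g%:C * Et * (w - S))).
    rewrite -(Re_saddle_poly q k%:R a u) -/J -/z -/X -/Et -/S -[cst * _]ReZ -[g * _]ReZ -ReN -ReD.
    by rewrite real_natc -(saddle_phase u n0 kE v) -/z -/tt; congr Re; ring.
  apply: le_trans (Re_le_nc _) _; apply: le_trans (le_normcD _ _) _.
  rewrite [leRHS]addrC; apply: lerD.
    rewrite normcM -[leRHS]mul1r; apply: ler_pM; rewrite ?nc_ge0//; exact: WE.
  apply: le_trans (le_normcD _ _) _.
  have -> : Cw * B / k%:R ^+ q.+1 = C1 / k%:R ^+ q.+1 * B + 2 * r ^- J.+1 * C3 * B / k%:R ^+ q.+1.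
    by rewrite /Cw; ring.
  apply: lerD; first by rewrite normcM; apply: ler_pM; rewrite ?nc_ge0.
  rewrite normcM; apply: le_trans (ler_pM (nc_ge0 _) (nc_ge0 _) gE wS) _.
  have JE : J.+1 = (2 * q.+1)%N by rewrite mul2n doubleS.
  have kq : k%:R ^+ q.+1 != 0 :> R by rewrite expf_neq0 ?gt_eqF.
  have -> : (u / r) ^+ J.+1 = r ^- J.+1 * (y ^+ q.+1 / k%:R ^+ q.+1).
    rewrite expr_div_n /y (exprMn _ k%:R (u ^+ 2)) -exprM -JE [_ * u ^+ J.+1]mulrC mulfK//.
    by rewrite mulrC.
  have := hC3 y y0 => h3.
  have -> : expR (- (4^-1 * y)) * (2 * B * (r ^- J.+1 * (y ^+ q.+1 / k%:R ^+ q.+1))) =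
    2 * r ^- J.+1 * (y ^+ q.+1 * expR (- (4^-1 * y))) * B / k%:R ^+ q.+1 by ring.
  rewrite ler_wpM2r ?invr_ge0 ?exprn_ge0// ler_wpM2r// ler_wpM2l// mulr_ge0// invr_ge0 exprn_ge0//.
  exact: ltW.
have inn : `|(cst * Phi alf - H alf) - (cst * Phi 0 - H 0)| <= (Cw * B / k%:R ^+ q.+1 + E) * alf.
  have dP u : is_derive u 1 (fun u => cst * Phi u - H u)
      (cst * Re (cexp (- (k%:R * (0 +i* u))) * Sn (external v n) (b +i* u)) -
      expR (- (k%:R * u ^+ 2 / 2)) * \sum_p A p * (rq R (e p) * u ^+ e p)).
    by have := dPhi u => dPu; have := dH u => dHu; pointwise_derivative; rewrite mul0r add0r.
  set m := _ + E.
  have dm (u : R) : is_derive u 1 (fun u => m * u) m.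
    by pointwise_derivative; rewrite mul0r add0r mulr1.
  have := mean_value_le (ltW a0) (fun u _ => dP u) (fun u _ => dm u) pw.
  by rewrite mulr0 subr0.
have AD : \sum_p `|A p| * Cf (e p) <= B * k%:R ^+ J * D.
  rewrite /D mulr_sumr; apply: ler_sum => p _; rewrite [leRHS]mulrA ler_wpM2r//.
  rewrite /A; set cc := _ * (cpoly R J ^+ p.2.1)`_p.2.2.
  rewrite (normrM (a p.1 * cc)) (normrM (a p.1)) (ger0_norm (exprn_ge0 _ (ltW kR))).
  have -> : B * k%:R ^+ J * (r ^- p.1 * `|cc|) = (B * r ^- p.1) * `|cc| * k%:R ^+ J by ring.
  apply: ler_pM; rewrite ?mulr_ge0 ?exprn_ge0//.
    by rewrite ler_wpM2r// ler_pdivlMr ?exprn_gt0.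
  by rewrite ler_weXn2l// -ltnS.
have small : (\sum_p `|A p| * Cf (e p)) * expR (- (k%:R * alf ^+ 2 / 2)) <= D * C4 * B / k%:R ^+ q.+1.
  apply: le_trans (ler_wpM2r (expR_ge0 _) AD) _.
  rewrite ler_pdivlMr ?exprn_gt0//.
  have := hC4 k%:R (ltW kR); rewrite exprD => h4.
  have -> : B * k%:R ^+ J * D * expR (- (k%:R * alf ^+ 2 / 2)) * k%:R ^+ q.+1 =
     D * (k%:R ^+ J * k%:R ^+ q.+1 * expR (- (alf ^+ 2 / 2 * k%:R))) * B.
    have -> : k%:R * alf ^+ 2 / 2 = alf ^+ 2 / 2 * k%:R by ring.
    by ring.
  by rewrite ler_wpM2r// ler_wpM2l.
set Th := Num.sqrt (pi / 2) * _ in hH.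
set cn := (count _ _)%:R in Phi01 *.
have main : `|pi * (cst * expR (b * k%:R) * cn) - Th| <=
    pi * (((Cw + D * C4) * B) / k%:R ^+ q.+1 + E).
  have -> : pi * (cst * expR (b * k%:R) * cn) - Th =
    cst * (Phi pi - Phi alf) + ((cst * Phi alf - H alf) - (cst * Phi 0 - H 0)) + (H alf - H 0 - Th).
    have -> : pi * (cst * expR (b * k%:R) * cn) = cst * (Phi pi - Phi 0) by rewrite Phi01; ring.
    by ring.
  apply: le_trans (ler_normD _ _) _; apply: (@le_trans _ _ (E * (pi - alf) +
     (Cw * B / k%:R ^+ q.+1 + E) * alf + D * C4 * B / k%:R ^+ q.+1)).
    by apply: lerD; [apply: le_trans (ler_normD _ _) _; exact: lerD|exact: le_trans hH small].
  have i1 : 0 <= Cw * B / k%:R ^+ q.+1 by rewrite divr_ge0 ?exprn_ge0// mulr_ge0.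
  have i2 : 0 <= D * C4 * B / k%:R ^+ q.+1 by rewrite divr_ge0 ?exprn_ge0// !mulr_ge0.
  have -> : (Cw + D * C4) * B / k%:R ^+ q.+1 = Cw * B / k%:R ^+ q.+1 + D * C4 * B / k%:R ^+ q.+1.
    by ring.
  move: (Cw * B / _) (D * C4 * B / _) i1 i2 => x1 x2 i1 i2.
  have [_ al1] := andP a01.
  have : x1 * alf <= pi * x1 by rewrite mulrC ler_wpM2r// (le_trans al1).
  have : x2 <= pi * x2 by rewrite ler_peMl.
  lra.
have pi0 : 0 < pi :> R by exact: pi_gt0.
have -> : (Num.sqrt (2 * pi * k%:R))^-1 * \sum_(i < J.+1) \sum_(l < L)
        (Num.sqrt k%:R)^-1 ^+ (i + l) * (a i * kappa R J i l) = Th / pi.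
  pose t := (Num.sqrt k%:R : R)^-1.
  have e0 : (Num.sqrt (2 * pi * k%:R))^-1 = Num.sqrt (pi / 2) / pi * t.
    have s2 : Num.sqrt 2 ^+ 2 = 2 :> R by rewrite sqr_sqrtr.
    have sp : Num.sqrt pi ^+ 2 = pi :> R by rewrite sqr_sqrtr// ltW.
    rewrite !sqrtrM ?mulr_ge0 ?ltW// sqrtrV// /t.
    have n2 : Num.sqrt 2 != 0 :> R by rewrite gt_eqF ?sqrtr_gt0.
    have np : Num.sqrt pi != 0 :> R by rewrite gt_eqF ?sqrtr_gt0.
    have nk : Num.sqrt k%:R != 0 :> R by rewrite gt_eqF ?sqrtr_gt0.
    rewrite -[X in _ / X * _]sp.
    move: (Num.sqrt 2 : R) (Num.sqrt pi : R) (Num.sqrt k%:R : R) n2 np nk => x y w x0 y0 w0.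
    by field; rewrite x0 y0 w0.
  have t2 : k%:R * t ^+ 2 = 1 by rewrite /t exprVn sqr_sqrtr ?(ltW kR)// mulfV ?gt_eqF.
  rewrite e0 /Th [RHS]mulrAC -[LHS]mulrA; congr (_ * _).
  rewrite /A /e -(pair_bigA _ (fun (i : 'I_J.+1) (p : 'I_J.+1 * 'I_L) =>
    a i * (p.1`!%:R^-1 * (cpoly R J ^+ p.1)`_p.2) * k%:R ^+ p.1 *
    (t ^+ (i + p.2 + p.1.*2).+1 * gm R (i + p.2 + p.1.*2))))/=.
  rewrite mulr_sumr; apply: eq_bigr => i _.
  rewrite -(pair_bigA _ (fun (m : 'I_J.+1) (l : 'I_L) =>
    a i * (m`!%:R^-1 * (cpoly R J ^+ m)`_l) * k%:R ^+ m *
    (t ^+ (i + l + m.*2).+1 * gm R (i + l + m.*2))))/= exchange_big/=.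
  rewrite mulr_sumr; apply: eq_bigr => l _.
  rewrite /kappa !mulr_sumr; apply: eq_bigr => m _.
  have -> : t ^+ (i + l + m.*2).+1 = t * (t ^+ (i + l) * (t ^+ 2) ^+ m).
    by rewrite exprS exprD -mul2n exprM.
  have km : k%:R ^+ m * (t ^+ 2) ^+ m = 1 by rewrite -exprMn t2 expr1n.
  rewrite -/t -[LHS]mul1r -[X in X * _ = _]km.
  move: (m`!%:R^-1 : R) (k%:R ^+ m : R) ((t ^+ 2) ^+ m) => x y w.
  by ring.
have -> : cst * expR (b * k%:R) * cn - Th / pi = (pi * (cst * expR (b * k%:R) * cn) - Th) / pi.
  by rewrite mulrBl [pi * _ / _]mulrAC mulfV ?mul1r ?gt_eqF.
by rewrite normrM [`|pi^-1|]gtr0_norm ?invr_gt0// ler_pdivrMr// [leRHS]mulrC.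
Qed.
End Pointwise.

Section EdgeworthSum.
Variable R : realType.

Lemma gm_odd q : odd q -> gm R q = 0.
Proof.
elim/ltn_ind: q => -[|[|q]]// ih; rewrite /= negbK => oq.
by rewrite -/(gm R q) ih ?mulr0.
Qed.

Lemma kappa_odd N i l : odd (i + l) -> kappa R N i l = 0.
Proof.
move=> o; rewrite /kappa big1// => m _.
by rewrite gm_odd ?mulr0// oddD odd_double addbF.
Qed.

Lemma sum_antidiagonals (f : nat -> nat -> R) p I L : (p.*2 < I)%N -> (p.*2 < L)%N ->
  (forall i l, odd (i + l) -> f i l = 0) ->
  \sum_(j < p.+1) \sum_(i < j.*2.+1) f i (j.*2 - i)%N =
  \sum_(i < I) \sum_(l < L) (if (i + l <= p.*2)%N then f i l else 0).
Proof.
move=> pI pL f0.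
have -> : \sum_(i < I) \sum_(l < L) (if (i + l <= p.*2)%N then f i l else 0) =
    \sum_(i < I) \sum_(l < L) \sum_(j < p.+1) (if (i + l == j.*2)%N then f i l else 0).
  apply: eq_bigr => i _; apply: eq_bigr => l _.
  have [io|ie] := boolP (odd (i + l)).
    by rewrite f0// if_same big1// => j _; rewrite if_same.
  have e2 : (i + l = (i + l)./2.*2)%N by rewrite -[LHS]odd_double_half (negPf ie).
  rewrite {1}e2 leq_double; case: leqP => h.
    rewrite (bigD1 (Ordinal (h : ((i + l)./2 < p.+1)%N)))//= -e2 eqxx big1 ?addr0// => j /negPf jn.
    case: eqP => // ij; move: jn => /negP; case; apply/eqP/val_inj => /=.
    by rewrite ij doubleK.
  rewrite big1// => j _; case: eqP => // ij; move: h; rewrite ij doubleK ltnNge.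
  by rewrite -ltnS ltn_ord.
under [RHS]eq_bigr do rewrite exchange_big/=.
rewrite [RHS]exchange_big/=; apply: eq_bigr => j _.
have jp : (j.*2 <= p.*2)%N by rewrite leq_double -ltnS.
rewrite (big_ord_widen I (fun i => f i (j.*2 - i)%N)) ?(leq_ltn_trans jp)//.
rewrite big_mkcond/=; apply: eq_bigr => i _; case: ltnP => ij; last first.
  rewrite big1// => l _; case: eqP => // e; move: ij; rewrite -e ltnNge.
  by rewrite leq_addr.
have jl : (j.*2 - i < L)%N by rewrite (leq_ltn_trans (leq_subr _ _))// (leq_ltn_trans jp).
rewrite (bigD1 (Ordinal jl))//= subnKC// eqxx big1 ?addr0// => l /negPf ln.
case: eqP => // e; move: ln => /negP; case; apply/eqP/val_inj => /=.
by rewrite -e addKn.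
Qed.

(** The antidiagonals of odd order vanish, those of order [j.*2] with [j <= p] are the
    terms of the Edgeworth sum, and the remaining ones have the factor
    [(Num.sqrt k)^-1 ^+ p.+1.*2]. *)
Lemma edgeworth_sum p r : 0 < r -> let J := p.+1.*2.+1 in let L := (J.+1 * J.+1).+1 in
  exists2 C, 0 <= C & forall (W : R -> R) (B b ell k : R),
  W b != 0 ->
  (forall n, derive1n n.+1 W b =
    \sum_(l < n.+1) 'C(n, l)%:R * (derive1n l W b * chi W (n - l).+1 b)) ->
  (forall i, `|derive1n i W b / i`!%:R| * r ^+ i <= B) ->
  0 < ell -> 1 <= k -> 2 * expR b * ell = k ->
  `|\sum_(i < J.+1) \sum_(l < L)
      (Num.sqrt k)^-1 ^+ (i + l) * (derive1n i W b / i`!%:R * kappa R J i l) -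
    \sum_(j < p.+1) F W j.*2 0 b / ell ^+ j| <= C * B * (Num.sqrt k)^-1 ^+ p.+1.*2.
Proof.
move=> r0 J L.
pose C := \sum_(i < J.+1) \sum_(l < L) r ^- i * `|kappa R J i l|.
exists C => [|W B b ell k W0 Wrec aB l0 k1 kE].
  by apply: sumr_ge0 => i _; apply: sumr_ge0 => l _; rewrite mulr_ge0// invr_ge0 exprn_ge0// ltW.
pose a i := derive1n i W b / i`!%:R.
set t := (Num.sqrt k)^-1.
have k0 : 0 < k by exact: lt_le_trans k1.
have t2 : t ^+ 2 = k^-1 by rewrite exprVn sqr_sqrtr// ltW.
have t0 : 0 <= t by rewrite invr_ge0 sqrtr_ge0.
have t1 : t <= 1.
  by rewrite /t invf_le1 ?sqrtr_gt0// -[leLHS]sqrtr1 ler_wsqrtr.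
pose f i l := t ^+ (i + l) * (a i * kappa R J i l).
have f0 i l : odd (i + l) -> f i l = 0 by move=> o; rewrite /f kappa_odd ?mulr0.
have pJ : (p.*2 < J)%N by rewrite /J doubleS !ltnS (leq_trans (leqnSn _)).
have pL : (p.*2 < L)%N.
  by rewrite /L ltnS (leq_trans (ltnW pJ))// mulSn (leq_trans (leqnSn _))// leq_addr.
have -> : \sum_(j < p.+1) F W j.*2 0 b / ell ^+ j = \sum_(j < p.+1) \sum_(i < j.*2.+1) f i (j.*2 - i)%N.
  apply: eq_bigr => j _; rewrite (F_expansion _ W0 Wrec) mulrAC mulr_sumr; apply: eq_bigr => i _.
  have ij : (i <= j.*2)%N by rewrite -ltnS.
  rewrite /f subnKC// (@kappa_trunc _ j.*2 J) ?leq_subr//; last first.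
    by rewrite (leq_trans _ (ltnW pJ))// leq_double -ltnS.
  congr (_ * _); rewrite -mul2n exprM t2 -kE -exprVn -exprVn -exprMn -invfM.
  by [].
rewrite (sum_antidiagonals (ltn_trans pJ (ltnSn J)) pL f0) -sumrB.
apply: le_trans (ler_norm_sum _ _ _) _; rewrite /C !mulr_suml; apply: ler_sum => i _.
rewrite -sumrB; apply: le_trans (ler_norm_sum _ _ _) _; rewrite !mulr_suml; apply: ler_sum => l _.
have B0 : 0 <= B by apply: le_trans (aB 0%N); rewrite mulr_ge0// exprn_ge0// ltW.
have rhs0 : 0 <= r ^- i * `|kappa R J i l| * B * t ^+ p.+1.*2.
  have ri : 0 <= r ^- i by rewrite invr_ge0 exprn_ge0// ltW.
  exact: mulr_ge0 (mulr_ge0 (mulr_ge0 ri (normr_ge0 _)) B0) (exprn_ge0 _ t0).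
rewrite -/(a i) -/(f i l); case: leqP => il; first by rewrite subrr normr0.
rewrite subr0; have [io|ie] := boolP (odd (i + l)); first by rewrite f0// normr0.
have il2 : (p.+1.*2 <= i + l)%N.
  have e2 : (i + l = (i + l)./2.*2)%N by rewrite -[LHS]odd_double_half (negPf ie).
  have : (p.*2 < (i + l)./2.*2)%N by rewrite -e2.
  by rewrite ltn_double -leq_double -e2.
rewrite /f !normrM (ger0_norm (exprn_ge0 _ t0)) mulrC.
apply: ler_pM; rewrite ?mulr_ge0 ?exprn_ge0//; last by rewrite ler_wiXn2l.
rewrite [leRHS]mulrAC; apply: ler_pM => //; rewrite [leRHS]mulrC ler_pdivlMr ?exprn_gt0//.
by rewrite -normrM; exact: aB.
Qed.
End EdgeworthSum.

(** * The limit function on the real axis *)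

Section LimitFunction.
Variable R : realType.
Implicit Types (W : R[i] -> R[i]) (v : nat -> seq bool) (b r : R).

(** The power series of the limit on a disc around a real point has real coefficients,
    which are therefore its real derivatives. *)
Lemma limit_taylor v W b1 b2 r B b : 0 < r -> disc_cvg v W b1 b2 r -> b1 <= b <= b2 ->
  (forall z, normc z <= r -> normc (W (b%:C + z)) <= B) ->
  let a i := derive1n i (on_reals W) b / i`!%:R in
  [/\ forall i, derivable (derive1n i (on_reals W)) b 1,
    forall i, `|a i| * r ^+ i <= B &
    forall n z, normc z <= r / 2 ->
      normc (W (b%:C + z) - \sum_(i < n) (a i)%:C * z ^+ i) <= 2 * B * (normc z / r) ^+ n].
Proof.
move=> r0 vW bb WB a.
have [c [cB cW]] := approx_power_series r0 (disc_cvg_approx vW bb) WB.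
have r40 : 0 < r / 4 by rewrite divr_gt0.
have gc : geometric_coef c (r / 4).
  exists B => i; apply: le_trans (cB i); rewrite ler_wpM2l// lerXn2r ?nnegrE ?(ltW r0) ?(ltW r40)//.
  by rewrite ler_pdivrMr// ler_peMr ?(ltW r0)// ler1n.
have series_W (y : R) : `|y| < r / 4 -> on_reals W (b + y) = limn (pseries c y).
  move=> yr; apply/esym/cvg_lim => //.
  have B0 : 0 <= 2 * B.
    by rewrite mulr_ge0// (le_trans (nc_ge0 (W (b%:C + 0))))// WB// normc0 ltW.
  have q : normc y%:C / r < 1.
    by rewrite nc_real ltr_pdivrMr// mul1r; lra.
  have gx : (fun n => 2 * B * (normc y%:C / r) ^+ n) @ \oo --> (0 : R).
    by apply: cvg_geometric; rewrite ger0_norm// divr_ge0 ?nc_ge0 ?ltW.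
  apply/cvgrPdist_lt => e e0; move/cvgrPdist_lt : gx => /(_ e e0); apply: filterS => n.
  have gn0 : 0 <= 2 * B * (normc y%:C / r) ^+ n.
    exact: mulr_ge0 B0 (exprn_ge0 _ (divr_ge0 (nc_ge0 _) (ltW r0))).
  rewrite sub0r normrN ger0_norm//.
  apply: le_lt_trans; have yr2 : normc y%:C <= r / 2 by rewrite nc_real; lra.
  apply: le_trans (cW n y%:C yr2); apply: le_trans (Re_le_nc _).
  rewrite ReD ReN Re_sum /on_reals rmorphD/= /pseries /series/= big_mkord.
  rewrite le_eqVlt; apply/orP; left; apply/eqP; congr `|_ - _|; apply: eq_bigr => i _.
  by rewrite -rmorphXn -rmorphM.
have dc i := analytic_derive1n i r40 gc series_W.
have ac i : a i = c i.
  by rewrite /a (dc i).2 mulrC mulKf// pnatr_eq0 -lt0n fact_gt0.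
split=> [i|i|n z zr]; [exact: (dc i).1|by rewrite ac|].
by under eq_bigr do rewrite ac; exact: cW.
Qed.

(** The normalised profiles are real and non-negative on the real axis. *)
Lemma limit_ge0 v W b r : 0 < r -> disc_cvg v W b b r -> W b%:C = (on_reals W b)%:C /\ 0 <= on_reals W b.
Proof.
move=> r0 vW.
have near_W e : 0 < e -> exists n, normc (Wn v n b%:C - W b%:C) < e.
  move=> /vW[N WN]; exists N; have := WN N (leqnn N) b 0; rewrite addr0; apply.
    by rewrite lexx.
  by rewrite normc0 ltW.
split.
  apply: complexP => //=; apply/eqP; rewrite -normr_eq0 eq_le normr_ge0 andbT.
  apply/ler_addgt0Pr => e /near_W[n]; rewrite Wn_real add0r => h.
  by have := le_trans (Im_le_nc _) (ltW h); rewrite ImD ImN/= sub0r normrN.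
rewrite -lerN2 oppr0; apply/ler_addgt0Pr => e /near_W[n]; rewrite Wn_real add0r => h.
have := le_trans (Re_le_nc _) (ltW h); rewrite ReD ReN/= ler_norml => /andP[_]; apply: le_trans.
by rewrite lerDr mulr_ge0 ?expR_ge0// rSn_ge0.
Qed.

(** At 0 the generating function counts the external nodes, and is normalised by [n]. *)
Lemma limit_at0 v W r : 0 < r -> disc_cvg v W 0 0 r -> (forall n, size (external v n) = n.+1) ->
  on_reals W 0 = 1.
Proof.
move=> r0 vW sv; apply/eqP; rewrite -subr_eq0 -normr_eq0 eq_le normr_ge0 andbT.
apply/ler_addgt0Pr => e e0; rewrite add0r.
have e2 : 0 < e / 2 by rewrite divr_gt0.
have [N WN] := vW _ e2.
pose n := maxn N (Num.truncn (2 / e)).+1.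
have := WN n (leq_maxl _ _) 0 0; rewrite lexx addr0 normc0 (ltW r0) => /(_ isT isT) h.
have n0 : (0 < n)%N by rewrite leq_max orbT.
have nR : 0 < n%:R :> R by rewrite ltr0n.
have ne : n%:R^-1 <= e / 2 :> R.
  rewrite invf_ple ?posrE// invf_div.
  by rewrite (le_trans (ltW (truncnS_gt _)))// ler_nat leq_maxr.
have W0 : Wn v n (0%:C : R[i]) = (1 + n%:R^-1)%:C.
  rewrite Wn_real expR0 mulr1 (_ : 2 - 1 = 1 :> R) ?mul1r; last by ring.
  rewrite expRN lnK ?posrE//; congr (_%:C).
  have -> : rSn (external v n) (0 : R) = n.+1%:R.
    by rewrite /rSn; under eq_bigr do rewrite mul0r expR0; rewrite sumr_const_seq mulr1 sv.
  by rewrite -natr1 mulrDr mulr1 mulVf ?gt_eqF.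
rewrite W0 in h; have := le_trans (Re_le_nc _) (ltW h); rewrite ReD ReN/= => h2.
have -> : on_reals W 0 - 1 = n%:R^-1 - (1 + n%:R^-1 - on_reals W 0) by ring.
rewrite (le_trans (ler_normB _ _))// [e]splitr lerD//.
by rewrite ger0_norm ?invr_ge0.
Qed.
End LimitFunction.

Section SaddleRange.
Variable R : realType.
Implicit Types (b bm bp : R).

(** [psi] takes the value 2 at 0, and is monotone on either side of 0 as long as it is positive. *)
Lemma psi_range_pos bm bp : 2 * expR bm * (1 - bm) = 1 -> 2 * expR bp * (1 - bp) = 1 ->
  bm < bp -> bm < 0 < bp.
Proof.
move=> m1 p1 mp; have [pm pp] : psi bm = 1 /\ psi bp = 1 by [].
have psi0 : psi 0 = 2 :> R by rewrite /psi expR0 mulr1 subr0 mulr1.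
apply/andP; split; rewrite ltNge; apply/negP; rewrite le_eqVlt => /predU1P[e|h].
- by move: pm; rewrite -e psi0; lra.
- by have := psi_lt_pos h mp; rewrite pm pp ltxx => /(_ ltr01).
- by move: pp; rewrite e psi0; lra.
- by have := psi_lt_neg mp (ltW h); rewrite pm pp ltxx.
Qed.

Lemma compact_saddle_range bm bp (L : set R) : bm < bp -> compact L ->
  L `<=` `]2 * expR bm, 2 * expR bp[ ->
  exists b1 b2, [/\ bm < b1, b1 <= b2, b2 < bp &
    forall y, L y -> 2 * expR b1 <= y <= 2 * expR b2].
Proof.
move=> mp cL Lr; have [[y0 Ly0]|nL] := pselect (exists y, L y); last first.
  exists ((bm + bp) / 2), ((bm + bp) / 2); split; rewrite ?midf_lt//.
  by move=> y Ly; exfalso; apply: nL; exists y.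
have cid : {within L, continuous (fun y : R => y)} by apply: continuous_subspaceT => x; exact: cvg_id.
have L0 : L !=set0 by exists y0.
have [y1 Ly1 h1] := compact_EVT_min L0 cL cid.
have [y2 Ly2 h2] := compact_EVT_max L0 cL cid.
have rg y : L y -> 2 * expR bm < y < 2 * expR bp by move=> /Lr /=; rewrite in_itv.
move/set_mem : Ly1 => Ly1; move/set_mem : Ly2 => Ly2.
have [/andP[a1 a2] /andP[c1 c2]] := (rg _ Ly1, rg _ Ly2).
have pos (y : R) : 2 * expR bm < y -> 0 < y / 2.
  by move=> h; rewrite divr_gt0// (lt_trans _ h)// mulr_gt0// expR_gt0.
exists (ln (y1 / 2)), (ln (y2 / 2)); split.
- rewrite -ltr_expR lnK ?posrE ?pos//; lra.
- rewrite ler_ln ?posrE ?pos//.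
  by have := h1 y2; rewrite inE => /(_ Ly2); lra.
- rewrite -ltr_expR lnK ?posrE ?pos//; lra.
move=> y Ly; rewrite !lnK ?posrE ?pos//.
have := h1 y; have := h2 y; rewrite inE => /(_ Ly) h3 /(_ Ly) h4.
by apply/andP; split; lra.
Qed.

Lemma sup_le_bound (S : set R) M : 0 <= M -> (forall x, S x -> 0 <= x <= M) -> `|sup S| <= M.
Proof.
move=> M0 SM; have [[x Sx]|nS] := pselect (exists x, S x); last first.
  have -> : S = set0 by apply/seteqP; split => // x Sx; apply: nS; exists x.
  by rewrite sup0 normr0.
have ub : ubound S M by move=> y /SM/andP[].
have S0 : S !=set0 by exists x.
have /andP[x0 _] := SM x Sx.
rewrite ger0_norm; first exact: ge_sup.
by apply: le_trans x0 _; apply: ub_le_sup => //; exists M.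
Qed.

Lemma cvg_inv_sqrt_ln (K : R) : K / Num.sqrt (ln n%:R) @[n --> \oo] --> (0 : R).
Proof.
apply/cvgrPdist_lt => e e0.
pose X := (`|K| / e + 1) ^+ 2.
exists (Num.truncn (expR X)).+1 => // n /= Xn.
have nX : expR X < n%:R by apply: lt_le_trans (truncnS_gt _) _; rewrite ler_nat.
have lX : X < ln n%:R by rewrite -ltr_expR lnK// posrE (lt_trans _ nX)// expR_gt0.
have c0 : 0 < `|K| / e + 1 by rewrite ltr_wpDl// divr_ge0// ltW.
have sX : `|K| / e + 1 < Num.sqrt (ln n%:R).
  rewrite -(@gtr0_norm _ (_ + 1))// -sqrtr_sqr ltr_sqrt// (lt_trans _ lX)//.
  by rewrite exprn_gt0.
have s0 : 0 < Num.sqrt (ln n%:R : R) by exact: lt_trans sX.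
rewrite sub0r normrN normrM normfV (gtr0_norm s0) ltr_pdivrMr// mulrC -ltr_pdivrMr//.
by apply: lt_trans sX; rewrite ltrDl.
Qed.
End SaddleRange.

(** * The coefficients of low order *)
Section LowOrder.
Variable R : realType.

Lemma cpoly2_coefs : [/\ (cpoly R 2)`_0 = 0, (cpoly R 2)`_1 = 6^-1 & (cpoly R 2)`_2 = 24^-1].
Proof. by split; rewrite coef_cpoly. Qed.

Lemma sum_ord3 (f : nat -> R) : \sum_(i < 3) f i = f 0%N + f 1%N + f 2%N.
Proof. by rewrite !big_ord_recr big_ord0/= add0r. Qed.

Lemma kappa_low : [/\ kappa R 0 0 0 = 1, kappa R 2 0 2 = - (12^-1), kappa R 2 1 1 = 2^-1 &
  kappa R 2 2 0 = -1].
Proof.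
have [c0 c1 c2] := cpoly2_coefs.
have g2 : gm R 2 = -1 by rewrite -[LHS]/(- 1%:R * 1) mulr1.
have g4 : gm R 4 = 3 by rewrite -[LHS]/(- 3%:R * gm R 2) g2 mulrN1 opprK.
have g6 : gm R 6 = - 15 by rewrite -[LHS]/(- 5%:R * gm R 4) g4; ring.
have kE i l : kappa R 2 i l = (l == 0%N)%:R * gm R (i + l) + (cpoly R 2)`_l * gm R (i + l + 2) +
    2^-1 * (\sum_(j < l.+1) (cpoly R 2)`_j * (cpoly R 2)`_(l - j)) * gm R (i + l + 4).
  rewrite /kappa (big_ord_recr 2) (big_ord_recr 1) big_ord1 expr0 expr1 expr2 coef1 coefM.
  by rewrite addn0 -[_`! in LHS]/1%N -[1`!]/1%N -[2`!]/2%N invr1 !mul1r.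
split.
- by rewrite /kappa big_ord1 expr0 coefC/= invr1 !mul1r.
- rewrite kE (sum_ord3 (fun j => (cpoly R 2)`_j * (cpoly R 2)`_(2 - j))).
  rewrite -[(0 + 2 + 4)%N]/6%N -[(0 + 2 + 2)%N]/4%N.
  rewrite -[(2 - _)%N]/2%N -[(2 - _)%N]/1%N subnn.
  by rewrite c0 c1 c2 g4 g6 [X in X * _ + _]/(0 : R) mul0r; field.
- rewrite kE (_ : \sum_(j < 2) _ = (cpoly R 2)`_0 * (cpoly R 2)`_1 + (cpoly R 2)`_1 * (cpoly R 2)`_0).
    by rewrite c0 c1 -[(1 + 1 + 2)%N]/4%N g4 [X in X * _ + _]/(0 : R) mul0r; field.
  by rewrite big_ord_recr big_ord1.
- by rewrite kE big_ord1 subn0 c0 addn0 g2 !mul0r mulr0 mul0r mul1r !addr0.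
Qed.

Lemma F_low (W : R -> R) b : W b != 0 ->
  (forall n, derive1n n.+1 W b =
    \sum_(l < n.+1) 'C(n, l)%:R * (derive1n l W b * chi W (n - l).+1 b)) ->
  F W 0 0 b = W b /\
  F W 2 0 b = expR (- b) * ((derive1n 1 W b - derive1n 2 W b) / 4 - W b / 24).
Proof.
move=> W0 Wrec; have [k0 k1 k2 k3] := kappa_low; split.
  have := F_expansion 0 W0 Wrec.
  by rewrite expr0 invr1 mul1r big_ord1 k0 mulr1 fact0 invr1 mulr1.
have -> := F_expansion 1 W0 Wrec.
rewrite (sum_ord3 (fun i => derive1n i W b / i`!%:R * kappa R 1.*2 i (1.*2 - i))) expr1.
have -> : derive1n 0 W b = W b by [].
rewrite -[(1.*2 - _)%N]/2%N -[(1.*2 - _)%N]/1%N -[(1.*2 - _)%N]/0%N k1 k2 k3.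
have [-> -> ->] : [/\ 0`! = 1%N, 1`! = 1%N & (1.*2)`! = 2%N] by [].
rewrite expRN.
have := expR_gt0 b; move: (expR b) => e e0.
by field; rewrite gt_eqF.
Qed.
End LowOrder.

(** * Almost sure expansion of the profile *)
Section ProfileError.
Variable R : realType.
Implicit Types (W : R[i] -> R[i]) (v : nat -> seq bool).

(** The three errors are the remainder of the saddle point expansion, the distance of the
    generating function to its limit, and the terms of the expansion beyond the Edgeworth
    sum. Each beats the required power of [ell] by a factor of order [ell ^ (-1 / 2)]. *)
Lemma error_rate (p : nat) (ell s k Cs Ce C C5 eps : R) : 0 < s -> 1 <= ell -> 1 <= k -> s * ell <= k ->
  0 <= Cs -> 0 <= Ce -> ell ^+ p.+2 * expR (- (eps * ell)) <= C5 ->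
  ell ^+ p.+1 * (Cs / k ^+ p.+2 + C * expR (- (eps * ell)) +
    (Num.sqrt (2 * pi * k))^-1 * (Ce * (Num.sqrt k)^-1 ^+ p.+1.*2)) <=
  ((Cs + Ce) * s^-1 ^+ p.+1 * (Num.sqrt s)^-1 + `|C| * C5) / Num.sqrt ell.
Proof.
move=> s0 l1 k1 sk Cs0 Ce0 h5.
have l0 : 0 < ell by exact: lt_le_trans l1.
have k0 : 0 < k by exact: lt_le_trans k1.
set t := (Num.sqrt k)^-1; set u := (Num.sqrt ell)^-1.
have sk0 : 0 < Num.sqrt k by rewrite sqrtr_gt0.
have sl0 : 0 < Num.sqrt ell by rewrite sqrtr_gt0.
have t0 : 0 <= t by rewrite invr_ge0 sqrtr_ge0.
have t2 : t ^+ 2 = k^-1 by rewrite exprVn sqr_sqrtr// ltW.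
have t1 : t <= 1 by rewrite invf_le1// -sqrtr1 ler_wsqrtr.
have u0 : 0 <= u by rewrite invr_ge0 sqrtr_ge0.
have u2 : u ^+ 2 = ell^-1 by rewrite exprVn sqr_sqrtr// ltW.
have u1 : u <= 1 by rewrite invf_le1// -sqrtr1 ler_wsqrtr.
have tu : t <= (Num.sqrt s)^-1 * u.
  rewrite -invfM lef_pV2 ?posrE ?mulr_gt0 ?sqrtr_gt0//.
  by rewrite -sqrtrM ?(ltW s0)// ler_wsqrtr.
have lk : (ell / k) ^+ p.+1 <= s^-1 ^+ p.+1.
  rewrite lerXn2r ?nnegrE ?invr_ge0 ?(ltW s0) ?divr_ge0 ?(ltW l0) ?(ltW k0)//.
  by rewrite ler_pdivrMr// mulrC ler_pdivlMr// mulrC.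
have lk0 : 0 <= (ell / k) ^+ p.+1 by rewrite exprn_ge0// divr_ge0// ltW.
have At : (Num.sqrt (2 * pi * k))^-1 <= t.
  rewrite lef_pV2 ?posrE// ?sqrtr_gt0 ?mulr_gt0 ?pi_gt0//.
  rewrite ler_wsqrtr// ler_peMl ?(ltW k0)//.
  by have := pi_ge2 R; lra.
have e1 : ell ^+ p.+1 * (Cs / k ^+ p.+2) <= Cs * (s^-1 ^+ p.+1 * ((Num.sqrt s)^-1 * u)).
  rewrite (_ : _ * _ = Cs * ((ell / k) ^+ p.+1 * k^-1)); last first.
    by rewrite exprMn exprVn exprS invfM; ring.
  rewrite ler_wpM2l// ler_pM// ?invr_ge0 ?(ltW k0)// -t2.
  by apply: le_trans tu; rewrite expr2 ler_piMl.
have e2 : ell ^+ p.+1 * ((Num.sqrt (2 * pi * k))^-1 * (Ce * t ^+ p.+1.*2)) <=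
    Ce * (s^-1 ^+ p.+1 * ((Num.sqrt s)^-1 * u)).
  rewrite -mul2n exprM t2.
  rewrite (_ : _ * _ = Ce * ((ell / k) ^+ p.+1 * (Num.sqrt (2 * pi * k))^-1)); last first.
    by rewrite exprMn; ring.
  by rewrite ler_wpM2l// ler_pM// ?invr_ge0 ?sqrtr_ge0// (le_trans At).
have e3 : ell ^+ p.+1 * (C * expR (- (eps * ell))) <= `|C| * C5 * u.
  apply: (@le_trans _ _ (`|C| * (ell ^+ p.+2 * expR (- (eps * ell))) * u ^+ 2)).
    rewrite u2 (exprS _ p.+1) (_ : _ / ell = ell ^+ p.+1 * (`|C| * expR (- (eps * ell)))); last first.
      move: (ell ^+ p.+1) (expR _) => X Y; field; by rewrite gt_eqF.
    rewrite ler_wpM2l ?exprn_ge0 ?(ltW l0)//.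
    by rewrite ler_wpM2r ?expR_ge0// ler_norm.
  have C50 : 0 <= C5 by apply: le_trans h5; rewrite mulr_ge0 ?expR_ge0// exprn_ge0// ltW.
  apply: (@le_trans _ _ (`|C| * C5 * u ^+ 2)).
    by rewrite ler_wpM2r ?exprn_ge0// ler_wpM2l.
  by rewrite ler_wpM2l ?mulr_ge0// expr2 ler_piMl.
have := lerD (lerD e1 e3) e2; rewrite -!mulrDr => h; apply: le_trans h _.
rewrite le_eqVlt; apply/orP; left; apply/eqP; rewrite -/u; ring.
Qed.

(** At the saddle point, [m / (2 * ln n)] is [expR b]. *)
Lemma saddle_prefactor (n m : nat) (b : R) : 0 < ln (n%:R : R) ->
  2 * expR b * ln n%:R = m%:R ->
  n%:R * (m%:R / (2 * expR 1 * ln n%:R)) ^+ m = n%:R * expR (- m%:R) * expR (b * m%:R).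
Proof.
move=> l0 bm; rewrite -[RHS]mulrA; congr (_ * _).
rewrite -bm; set l := ln _ in bm l0 *.
rewrite (_ : _ / _ = expR (- 1) * expR b); last first.
  by rewrite expRN; have := expR_gt0 (1 : R); move: (expR 1) => e e0; field; rewrite !gt_eqF.
rewrite exprMn -!expRM_natr bm mulN1r; congr (_ * _).
Qed.

(** From here on the argument is deterministic: it concerns a single trajectory on which
    the rates hold, with constants that are uniform over the saddle points in
    the segment. *)
Lemma profile_error v W b1 b2 r alf eps C N p : 0 < r -> disc_cvg v W b1 b2 r ->
  0 < alf -> alf <= 4^-1 -> alf <= r / 2 -> 0 < eps ->
  (forall b, b1 <= b <= b2 -> on_reals W b != 0 /\
    forall n, derive1n n.+1 (on_reals W) b =
     \sum_(l < n.+1) 'C(n, l)%:R * (derive1n l (on_reals W) b * chi (on_reals W) (n - l).+1 b)) ->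
  (forall n, (N <= n)%N ->
      (forall z, rect b1 b2 0 alf z -> normc (Wn v n z - W z) <= C * expR (- (eps * ln n%:R))) /\
      (forall z, rect b1 b2 alf pi z -> normc (Sn (external v n) z) <=
         C * expR ((2 * expR (Re z) - 1 - eps) * ln n%:R))) ->
  exists2 M, 0 <= M & exists N', forall n, (N' <= n)%N -> forall (k : int) y,
    2 * expR b1 <= y <= 2 * expR b2 -> k%:~R = y * ln n%:R ->
    0 <= ln (n%:R : R) ^+ p.+1 * normalized_error v (on_reals W) p n k <= M / Num.sqrt (ln n%:R).
Proof.
move=> r0 vW a0 a4 ar eps0 Wgood rates.
have [B B0 [N0 WB]] := disc_cvg_bounded vW.
have [Cs Cs0 saddle] := saddle_point_integral p.+1 B r0 a0 a4 ar.
have [Ce Ce0 edge] := edgeworth_sum p r0.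
have [C5 _ h5] := exp_decay p.+2 eps0.
pose s := 2 * expR b1.
have s0 : 0 < s by rewrite mulr_gt0// expR_gt0.
pose X := 1 + s^-1 + 2 / (s * alf ^+ 2).
have sa0 : 0 < s * alf ^+ 2 by rewrite mulr_gt0// exprn_gt0.
have si0 : 0 < s^-1 by rewrite invr_gt0.
have sa10 : 0 < 2 / (s * alf ^+ 2) by rewrite divr_gt0.
exists ((Cs + Ce * B) * s^-1 ^+ p.+1 * (Num.sqrt s)^-1 + `|C| * C5).
  have CB0 : 0 <= Ce * B by rewrite mulr_ge0// ltW.
  have C50 : 0 <= C5 by apply: le_trans (h5 0 (lexx _)); rewrite expr0n mul0r.
  rewrite addr_ge0// mulr_ge0 ?invr_ge0 ?sqrtr_ge0// mulr_ge0 ?addr_ge0//.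
  by rewrite exprn_ge0// ltW.
exists (maxn N (Num.truncn (expR X)).+1) => n; rewrite geq_max => /andP[Nn Xn] k y /andP[y1 y2] ky.
have nX : expR X < n%:R by apply: lt_le_trans (truncnS_gt _) _; rewrite ler_nat.
have nR : 0 < n%:R :> R by apply: lt_trans nX; exact: expR_gt0.
have n0 : (0 < n)%N by rewrite -(ltr0n R).
have lX : X < ln n%:R by rewrite -ltr_expR lnK.
have [l1 ls la] : [/\ 1 <= ln (n%:R : R), s^-1 <= ln (n%:R : R) & 2 / (s * alf ^+ 2) <= ln (n%:R : R)].
  by move: lX; rewrite /X; move: (ln _) => l lX; split; lra.
have l0 : 0 < ln (n%:R : R) by exact: lt_le_trans l1.
have y0 : 0 < y by exact: lt_le_trans y1.
have k0 : 0 < k%:~R :> R by rewrite ky mulr_gt0.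
case: k ky k0 => [m|m]; last by rewrite NegzE mulrNz oppr_gt0 => _; rewrite ltNge ler0n.
rewrite -pmulrn => ky k0.
set b := beta_n R n m.
have bE : 2 * expR b * ln n%:R = m%:R.
  have h0 : 0 < (m : int)%:~R / ln (n%:R : R) by rewrite divr_gt0.
  by rewrite ((beta_nP _ h0).2 erefl) -pmulrn divfK// gt_eqF.
have yb : y = 2 * expR b by apply: (@mulIf _ (ln n%:R)); rewrite ?gt_eqF// bE.
have bb : b1 <= b <= b2 by move: y1 y2; rewrite yb !ler_pM2l// !ler_expR => -> ->.
have m0 : (0 < m)%N by rewrite -(ltr0n R).
have sk : s * ln n%:R <= m%:R by rewrite ky ler_wpM2r// ltW.
have m1 : 1 <= m%:R :> R by rewrite ler1n.
have ma : 2 <= m%:R * alf ^+ 2.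
  move: la; rewrite ler_pdivrMr// mulrC mulrAC => la; apply: le_trans la _.
  by rewrite ler_wpM2r// exprn_ge0// ltW.
have Wb z : normc z <= r -> normc (W (b%:C + z)) <= B by move=> zr; have [] := WB b z bb zr.
have [_ aB aW] := limit_taylor r0 vW bb Wb.
have [W0 Wrec] := Wgood b bb.
have [rin rout] := rates n Nn.
have rb c d u : (rect b1 b2 c d (b +i* u)) = (c <= u <= d) by rewrite /rect/= bb.
have S1 := saddle v W b (C * expR (- (eps * ln n%:R))) _ n m n0 m0 ma bE Wb aB aW
  (fun u hu => rin _ (etrans (rb _ _ _) hu)).
have Sout u : alf <= u <= pi -> normc (Sn (external v n) (b +i* u)) <=
    C * expR (- (eps * ln n%:R)) * expR ((2 * expR b - 1) * ln n%:R).
  move=> hu; have := rout _ (etrans (rb alf pi u) hu); rewrite /= => h; apply: le_trans h _.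
  by rewrite -mulrA -expRD -mulNr -mulrDl addrC.
move/(_ Sout) : S1 => S1.
have E1 := edge (on_reals W) B b (ln n%:R) m%:R W0 Wrec aB l0 m1 bE.
rewrite mulr_ge0 ?normr_ge0 ?exprn_ge0 ?(ltW l0)//=.
apply: le_trans (error_rate _ s0 l1 m1 sk Cs0 (mulr_ge0 Ce0 (ltW B0)) (h5 _ (ltW l0))).
rewrite ler_wpM2l ?exprn_ge0 ?(ltW l0)//.
rewrite /normalized_error -/b -pmulrn.
have -> : n%:R * ((m%:R : R) / (2 * expR 1 * ln n%:R)) ^ m = n%:R * expR (- m%:R) * expR (b * m%:R).
  exact: saddle_prefactor.
rewrite (_ : ext_profile v n m = count (fun w => size w == m) (external v n))//.
move: S1 E1; set X1 := _ * _%:R; set X2 := \sum_(i < _) \sum_(l < _) _; set X3 := \sum_(j < _) _.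
set A := (Num.sqrt _)^-1 => S1 E1.
have A0 : 0 <= A by rewrite invr_ge0 sqrtr_ge0.
rewrite (_ : X1 - A * X3 = (X1 - A * X2) + A * (X2 - X3)); last by ring.
apply: le_trans (ler_normD _ _) _; rewrite normrM (ger0_norm A0).
by rewrite lerD// ler_wpM2l.
Qed.
End ProfileError.

Section Conclusion.
Variable R : realType.
Implicit Types (W : (R[i])^o -> (R[i])^o) (v : nat -> seq bool).

(** The limit is real and non-negative on the interval, so where it does not vanish it is
    positive and its logarithm is as smooth as the limit itself. *)
Lemma good_trajectory v W (D : set (R[i])^o) (bm bp : R) : open D ->
  (forall b, bm < b < bp -> D b%:C) ->
  (forall K : set (R[i])^o, compact K -> K `<=` D ->
     {uniform K, (fun n => Wn v n : (R[i])^o -> (R[i])^o) @ \oo --> W}) ->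
  (forall b : R, bm < b < bp -> W b%:C != 0) ->
  forall b, bm < b < bp -> on_reals W b != 0 /\
    forall n, derive1n n.+1 (on_reals W) b =
     \sum_(l < n.+1) 'C(n, l)%:R * (derive1n l (on_reals W) b * chi (on_reals W) (n - l).+1 b).
Proof.
move=> oD bD Wlim W0.
have pt b : bm < b < bp -> exists2 r, 0 < r & disc_cvg v W b b r.
  move=> bb; have Db x : b <= x <= b -> D x%:C.
    by move=> /le_anti <-; exact: bD.
  have [r r0 [K [cK KD] hK]] := discs_in_compact (lexx b) oD Db.
  exists r => // e e0; have [N hN] := uniform_nc (Wlim K cK KD) e0.
  by exists N => n Nn x z xb zr; apply: hN => //; exact: hK.
have pos b : bm < b < bp -> 0 < on_reals W b.
  move=> bb; have [r r0 vW] := pt b bb; have [WE W_ge0] := limit_ge0 r0 vW.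
  rewrite lt_neqAle W_ge0 andbT eq_sym; apply/eqP => h.
  by have := W0 b bb; rewrite WE h eqxx.
have sm k : smooth_to `]bm, bp[ k (on_reals W).
  move=> i _ b /=; rewrite in_itv/= => bb; have [r r0 vW] := pt b bb.
  have [B _ [N WB]] := disc_cvg_bounded vW.
  have bb1 : b <= b <= b by rewrite lexx.
  have Wb z : normc z <= r -> normc (W (b%:C + z)) <= B by move=> zr; have [] := WB b z bb1 zr.
  by have [+ _ _] := limit_taylor r0 vW bb1 Wb; exact.
move=> b bb; split=> [|n]; first by rewrite gt_eqF// pos.
apply: (log_derivative_rec (I := `]bm, bp[)) => //.
Qed.
End Conclusion.

Theorem theorem1p2 (R : realType) (d : measure_display) (T : measurableType d)
    (P : probability T R)
    (V : nat -> T -> seq bool) (hV : is_bst_process P V)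
    (bm bp : R) (hbm : 2 * expR bm * (1 - bm) = 1)
    (hbp : 2 * expR bp * (1 - bp) = 1) (hb : bm < bp)
    (D : set (R[i])^o) (hDo : open D)
    (hD : forall b : R, bm < b < bp -> D b%:C)
    (Winf : T -> (R[i])^o -> (R[i])^o) (hWan : random_analytic_function D Winf)
    (hWlim : {ae P, forall w, forall K : set (R[i])^o, compact K -> K `<=` D ->
       {uniform K, (fun n => Wn (fun m => V m w) n : (R[i])^o -> (R[i])^o)
                     @ \oo --> Winf w}})
    (hW0 : {ae P, forall w, forall b : R, bm < b < bp -> Winf w b%:C != 0}) :
  let W w := on_reals (Winf w) in
  (forall (r : nat) (L : set R), compact L ->
     L `<=` `]2 * expR bm, 2 * expR bp[ ->
     {ae P, forall w,
       (fun n : nat => ln (n%:R : R) ^+ r.+1 *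
          sup [set normalized_error (fun m => V m w) (W w) r n k
              | k in [set k : int | exists2 y : R, L y & k%:~R = y * ln n%:R]])
       @ \oo --> (0 : R)}) /\
  (forall (w : T) (j : nat) (b : R), bm < b < bp ->
     exists p : {poly R}, forall x : R, G (W w) j x b = p.[x]) /\
  (exists (a : nat -> R -> R) (c : nat -> nat -> R -> R),
     {ae P, forall w, forall (j : nat) (b : R), bm < b < bp ->
       F (W w) j.*2 0 b =
       a j b + \sum_(i < j.*2.+1) c j i b * derive1n i (W w) b}) /\
  {ae P, forall w,
    (forall b : R, bm < b < bp ->
       F (W w) 0 0 b = W w b /\
       F (W w) 2 0 b =
         expR (- b) * ((derive1n 1 (W w) b - derive1n 2 (W w) b) / 4 - W w b / 24)) /\
    F (W w) 2 0 0 = (derive1n 1 (W w) 0 - derive1n 2 (W w) 0) / 4 - 24^-1}.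

Proof.
move=> W.
have m1 : psi bm = 1 := hbm.
have p1 : psi bp = 1 := hbp.
have good : {ae P, forall w, [/\ forall n, valid (path V w n),
    forall K : set (R[i])^o, compact K -> K `<=` D ->
       {uniform K, (fun n => Wn (fun m => V m w) n : (R[i])^o -> (R[i])^o)
                     @ \oo --> Winf w} &
    forall b, bm < b < bp -> W w b != 0 /\
    forall n, derive1n n.+1 (W w) b =
     \sum_(l < n.+1) 'C(n, l)%:R * (derive1n l (W w) b * chi (W w) (n - l).+1 b)]}.
  have hv := ae_valid hV.
  apply: filterS3 hv hWlim hW0 => w w1 w2 w3; split => //.
  exact: good_trajectory hDo hD w2 w3.
split.
  move=> r L cL Lb.
  have [b1 [b2 [mb b12 bp2 rg]]] := compact_saddle_range hb cL Lb.
  have Db x : b1 <= x <= b2 -> D x%:C.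
    by move=> /andP[h1 h2]; apply: hD; rewrite (lt_le_trans mb)// (le_lt_trans h2).
  have [rho rho0 [K [cK KD] hK]] := discs_in_compact b12 hDo Db.
  have a00 : 0 < Num.min 4^-1 (rho / 2) by rewrite lt_min invr_gt0 ltr0n divr_gt0.
  have pb1 : 1 < psi b1 by apply: (psi_gt1 m1 p1); rewrite mb (le_lt_trans b12).
  have pb2 : 1 < psi b2 by apply: (psi_gt1 m1 p1); rewrite bp2 (lt_le_trans mb).
  have [alf [eps [/andP[al0]]]] := profile_rates hV b12 pb1 pb2 rho0 a00.
  rewrite le_min => /andP[al4 alr] _ eps0 rates.
  apply: filterS2 good rates => w [wv wlim wgood] wrates.
  have vW : disc_cvg (V^~ w) (Winf w) b1 b2 rho.
    move=> e e0; have [N hN] := uniform_nc (wlim K cK KD) e0.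
    by exists N => n Nn x z xb zr; apply: hN => //; exact: hK.
  have [C [N hN]] := wrates _ vW.
  have wg b : b1 <= b <= b2 -> bm < b < bp.
    by move=> /andP[h1 h2]; rewrite (lt_le_trans mb)// (le_lt_trans h2).
  have [M M0 [N' hN']] := profile_error r rho0 vW al0 al4 alr eps0
    (fun b bb => wgood b (wg b bb)) hN.
  have cM := cvg_inv_sqrt_ln M.
  apply: norm_cvg0; apply: (@squeeze_cvgr _ _ _ _ (cst 0) (fun n => M / Num.sqrt (ln n%:R))) cM; last exact: cvg_cst.
  exists (maxn N' 2) => // n /=; rewrite geq_max => /andP[nN n2].
  rewrite normr_ge0/=.
  have l0 : 0 < ln (n%:R : R) ^+ r.+1 by rewrite exprn_gt0// ln_gt0// ltr1n.
  rewrite normrM (gtr0_norm l0) mulrC -ler_pdivlMr//.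
  apply: sup_le_bound => [|_ [k [y Ly ky] <-]].
    by rewrite !mulr_ge0// invr_ge0 ?sqrtr_ge0// ltW.
  have /andP[h1 h2] := hN' n nN k y (rg y Ly) ky.
  by rewrite normr_ge0/= ler_pdivlMr// mulrC.
split.
  by move=> w j b _; exact: G_polynomial.
split.
  exists (fun _ _ => 0), (fun j i b => (2 * expR b) ^- j / i`!%:R * kappa R j.*2 i (j.*2 - i)).
  apply: filterS good => w [_ _ wgood] j b bb; have [W0 Wrec] := wgood b bb.
  rewrite (F_expansion j W0 Wrec) add0r mulr_sumr; apply: eq_bigr => i _.
  by ring.
have [m0 p0] := andP (psi_range_pos hbm hbp hb).
apply: filterS good => w [wv wlim wgood].
have wlow b : bm < b < bp -> F (W w) 0 0 b = W w b /\
       F (W w) 2 0 b =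
         expR (- b) * ((derive1n 1 (W w) b - derive1n 2 (W w) b) / 4 - W w b / 24).
  by move=> bb; have [W0 Wrec] := wgood b bb; exact: F_low.
split=> //.
have bb : bm < 0 < bp by rewrite m0 p0.
have Db x : 0 <= x <= 0 -> D x%:C by move=> /le_anti <-; exact: hD.
have [rho rho0 [K [cK KD] hK]] := discs_in_compact (lexx 0) hDo Db.
have vW : disc_cvg (V^~ w) (Winf w) 0 0 rho.
  move=> e e0; have [N hN] := uniform_nc (wlim K cK KD) e0.
  by exists N => n Nn x z xb zr; apply: hN => //; exact: hK.
have W1 : W w 0 = 1.
  apply: (limit_at0 rho0 vW) => n.
  by rewrite external_hist size_ext ?size_hist//; exact: wv.
have [_ ->] := wlow 0 bb.
by rewrite W1 oppr0 expR0 !mul1r.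
Qed.
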